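(* Let $\gamma\in\mathbb R$. If $u_0$ and $v_0$ are (real-valued) real-analytic functions on $S^1$, then the Cauchy problem $$\begin{cases}u_t+2\mu(u)uv-\frac13v^3+\partial_xA^{-1}\big[2\mu^2(u)u+\mu(u)v^2+\gamma u\big]+\frac13\mu(v^3)=0,\\ v_t+2\mu(u)(uv)_x-\frac13(v^3)_x+\partial_xA^{-1}\big[2\mu^2(u)v+\mu(u)(v^2)_x+\gamma v\big]=0,\\ u(0,x)=u_0(x),\ v(0,x)=v_0(x)\end{cases}$$ has a holomorphic solution near $t=0$. More precisely: (i) There exists $\Delta>0$ such that $u_0,v_0\in G^{\Delta,s+1}\subset A(\Delta)$ for any $s\ge0$. (ii) With such a $\Delta$, if $s>1/2$, there exists a positive time $T_\Delta=T(u_0,v_0,s,\Delta)$ such that for every $d\in(0,1)$, the Cauchy problem has a unique solution which is a holomorphic function valued in $\oplus^2G^{\Delta d,s+1}$ in the disk $D(0,T_\Delta(1-d))$. Furthermore, when $\Delta$ is fixed: if $\gamma=0$, the analytic lifespan $T_\Delta$ satisfies, for $(u_0,v_0)\ne(0,0)$, $$T_\Delta=\frac{\mathrm{const.}}{\|(u_0,v_0)\|_{\Delta,s+1}^2};$$ if $\gamma\neq0$, we have the asymptotic behavior $$T_\Delta\approx\frac{\mathrm{const.}}{\|(u_0,v_0)\|_{\Delta,s+1}^2}\ (\text{large initial values}),\qquad T_\Delta\approx\mathrm{const.}\ (\text{small initial values}),$$ that is, $T_\Delta\|(u_0,v_0)\|_{\Delta,s+1}^2$ approaches a positive constant as $\|(u_0,v_0)\|_{\Delta,s+1}\to\infty$,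 and $T_\Delta$ approaches a positive constant as $\|(u_0,v_0)\|_{\Delta,s+1}\to0$. Here the constants do not depend on $(u_0,v_0)$ (they may depend on $s$, $\Delta$ and $\gamma$).
   Context: $S^1=\mathbb R/\mathbb Z$; $L^2(S^1)$ denotes real-valued square-integrable functions; $\hat\varphi(k)=\int_{S^1}\varphi(x)e^{-2k\pi ix}\,dx$; $\langle k\rangle=(1+k^2)^{1/2}$. For $\delta\ge0,s\ge0$, $G^{\delta,s}=\{\varphi\in L^2(S^1):\|\varphi\|_{\delta,s}<\infty\}$ with $\|\varphi\|_{\delta,s}^2=\sum_{k\in\mathbb Z}\langle k\rangle^{2s}e^{4\pi\delta|k|}|\hat\varphi(k)|^2$. On $\oplus^2G^{\delta,s+1}=G^{\delta,s+1}\oplus G^{\delta,s+1}$ the norm is $\|(u,v)\|_{\delta,s+1}=\|u\|_{\delta,s+1}+\|v\|_{\delta,s+1}$. For $\delta>0$, $A(\delta)$ is the space of functions $f:S^1\to\mathbb R$ having an analytic continuation to $\{x+iy\in\mathbb C:|y|<\delta\}$. $\mu(\varphi)=\int_{S^1}\varphi\,dx$ (integration in $x$), $\mu^2(u)=(\mu(u))^2$; the operator $A(\varphi)=\mu(\varphi)-\varphi_{xx}$ has inverse $A^{-1}(\varphi)=\hat\varphi(0)+\sum_{k\ne0}\frac{\hat\varphi(k)}{(2\pi k)^2}e^{2k\pi ix}$. $D(0,r)=\{t\in\mathbb C:|t|<r\}$. For complex $t$ the values of a holomorphic function of $t$ are taken in the complexification of the spaces (complex-valued functions, same norm), with $\mu$,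 $A^{-1}$, $\partial_x$ and products extended by the same formulas. *)

(* Defs.v *)
From HB Require Import structures.
From mathcomp Require Import all_boot all_order all_algebra.
From mathcomp Require Import complex.
From mathcomp Require Import all_classical all_reals all_analysis.

Set Implicit Arguments.
Unset Strict Implicit.
Unset Printing Implicit Defensive.

Import Order.TTheory GRing.Theory Num.Theory numFieldNormedType.Exports.

Local Open Scope classical_set_scope.
Local Open Scope ring_scope.
Local Open Scope complex_scope.

(* A function on the circle R/Z is a 1-periodic function on R; elements of L^2
   and of its subspaces are represented by such functions, and equality of
   elements is equality almost everywhere. *)

Section CircleFunctions.
Context {R : realType}.
Implicit Types (f g : R -> R[i]) (k : int) (delta s : R).

Definition ae_equal (T : Type) (f g : R -> T) : Prop :=
  {ae lebesgue_measure, forall x : R, f x = g x}.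

Definition cplx (f : R -> R) : R -> R[i] := fun x => (f x)%:C.

Definition reF f : R -> R := fun x => complex.Re (f x).
Definition imF f : R -> R := fun x => complex.Im (f x).

Definition cmod (z : R[i]) : R := ComplexField.Normc.normc z.

Definition expi (theta : R) : R[i] := cos theta +i* sin theta.

(* Lebesgue measure on the fundamental domain `[0, 1] of R/Z. *)
Definition circle_measure :
    {measure set (measurableTypeR R) -> \bar R} :=
  mrestr (@lebesgue_measure R) (measurable_itv `[0%R, 1%R]).

Definition L2 f : Prop :=
  [/\ periodic f 1,
      (reF f) \in Lfun circle_measure 2%:E &
      (imF f) \in Lfun circle_measure 2%:E].

Definition mean f : R[i] :=
  Rintegral lebesgue_measure `[0%R, 1%R] (reF f)
  +i* Rintegral lebesgue_measure `[0%R, 1%R] (imF f).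

Definition fourier f k : R[i] :=
  mean (fun x => f x * expi (- (2 * k%:~R * pi * x))).

Definition japanese k : R := Num.sqrt (1 + k%:~R ^+ 2).

Definition gevrey_sqnorm delta s f : \bar R :=
  \esum_(k in [set: int])
    (japanese k `^ (2 * s) * expR (4 * pi * delta * `|k%:~R|)
       * cmod (fourier f k) ^+ 2)%:E.

Definition inG delta s f : Prop := L2 f /\ (gevrey_sqnorm delta s f < +oo)%E.

(* Meaningful only for f in the space inG delta s. *)
Definition gevrey_norm delta s f : R :=
  Num.sqrt (fine (gevrey_sqnorm delta s f)).

Definition pair_norm delta s f g : R :=
  gevrey_norm delta s f + gevrey_norm delta s g.

Definition real_analytic (f : R -> R) : Prop :=
  forall x0 : R, exists r : R, 0 < r /\
    exists a : nat -> R, forall x : R, `|x - x0| < r ->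
      series (fun n => a n * (x - x0) ^+ n) @ \oo --> f x.

Definition inA delta (f : R -> R) : Prop :=
  periodic f 1 /\
  exists F : R[i]^o -> R[i]^o,
    (forall z : R[i], `|complex.Im z| < delta -> derivable F z 1) /\
    (forall x : R, F x%:C = (f x)%:C).

(* G^{delta,s} is contained in A(delta): every real-valued class in the former
   has a representative in the latter. *)
Definition G_subset_A delta s : Prop :=
  forall f : R -> R, inG delta s (cplx f) ->
    exists g : R -> R, inA delta g /\ ae_equal f g.

(* The classical derivative of classes: f has an everywhere differentiable
   representative F, and g represents F'.  F is unique, being continuous. *)
Definition is_dx f g : Prop :=
  exists F : R -> R[i],
    [/\ ae_equal f F,
        forall x, derivable (reF F) x 1
                  /\ derivable (imF F) x 1 &
        ae_equal g (fun x => derive1 (reF F) x +i* derive1 (imF F) x)].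

(* The inverse of phi |-> mu(phi) - phi_xx, the series over k <> 0 being summed
   symmetrically; it converges absolutely for f in L^2. *)
Definition Ainv f (x : R) : R[i] :=
  let term k := fourier f k / (((2 * pi * k%:~R) ^+ 2)%:C)
                * expi (2 * k%:~R * pi * x) in
  fourier f 0 +
  limn (fun N : nat =>
    (\sum_(1 <= n < N.+1) (term n%:Z + term (- n%:Z)) : R[i]^o)).

(* (ut, vt) is the complex derivative at t of (u, v), as a limit of difference
   quotients in the norm of the direct sum of two copies of G^{delta,s}. *)
Definition has_tderiv delta s (u v : R[i] -> R -> R[i]) (t : R[i])
    (ut vt : R -> R[i]) : Prop :=
  [/\ inG delta s ut, inG delta s vt &
      pair_norm delta s
        (fun x => h^-1 * (u (t + h) x - u t x) - ut x)
        (fun x => h^-1 * (v (t + h) x - v t x) - vt x)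
      @[h --> (0 : R[i]^o)^'] --> (0 : R)].

Definition system (gamma : R) (u v ut vt : R -> R[i]) : Prop :=
  let m := mean u in
  (exists w : R -> R[i],
     is_dx (Ainv (fun x => 2 * m ^+ 2 * u x + m * v x ^+ 2
                           + gamma%:C * u x)) w /\
     ae_equal
       (fun x => ut x + 2 * m * u x * v x - 3^-1 * v x ^+ 3 + w x
                 + 3^-1 * mean (fun y => v y ^+ 3))
       (fun=> 0)) /\
  (exists uv_x v2_x v3_x w : R -> R[i],
     [/\ is_dx (fun x => u x * v x) uv_x,
         is_dx (fun x => v x ^+ 2) v2_x,
         is_dx (fun x => v x ^+ 3) v3_x,
         is_dx (Ainv (fun x => 2 * m ^+ 2 * v x + m * v2_x x
                               + gamma%:C * v x)) w &
         ae_equal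
           (fun x => vt x + 2 * m * uv_x x - 3^-1 * v3_x x + w x)
           (fun=> 0)]).

(* (u, v) is a holomorphic solution on the disk D(0, r), valued in the direct
   sum of two copies of the complexified G^{delta,s}.  The values of u and v
   outside the disk are irrelevant. *)
Definition holomorphic_solution (gamma delta s r : R) (u0 v0 : R -> R)
    (u v : R[i] -> R -> R[i]) : Prop :=
  [/\ forall t, cmod t < r -> inG delta s (u t) /\ inG delta s (v t),
      ae_equal (u 0) (cplx u0), ae_equal (v 0) (cplx v0) &
      forall t, cmod t < r ->
        exists ut vt : R -> R[i],
          has_tderiv delta s u v t ut vt /\ system gamma (u t) (v t) ut vt].

Definition analytic_data (u0 v0 : R -> R) : Prop :=
  [/\ periodic u0 1, periodic v0 1, real_analytic u0 & real_analytic v0].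

Definition data_in_G delta (u0 v0 : R -> R) : Prop :=
  forall s, 0 <= s -> inG delta (s + 1) (cplx u0) /\ inG delta (s + 1) (cplx v0).

End CircleFunctions.

(* Main.v *)
Require Import Defs.
From HB Require Import structures.
From mathcomp Require Import all_boot all_order all_algebra.
From mathcomp Require Import complex.
From mathcomp Require Import all_classical all_reals all_analysis.
From mathcomp Require Import measurable_realfun.
From mathcomp Require Import ring lra.
Import Order.TTheory GRing.Theory Num.Theory numFieldNormedType.Exports.
Local Open Scope classical_set_scope.
Local Open Scope ring_scope.
Set Implicit Arguments.
Unset Strict Implicit.
Unset Printing Implicit Defensive.

(** The system is an ordinary differential equation for Fourier coefficients.

   Write U and V for the coefficients of u and v, and add the mean of u, seen as
   a sequence supported at 0, as a third unknown. Products become convolutions,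
   and the system becomes x' = rhs x, where every term of rhs is a triple
   convolution or a linear term, multiplied by a symbol that grows at most like
   1 + 2 pi |k| (system_fourier). Sequences are measured by the weighted sum
   of the e^(2 pi delta |k|) |c_k| (wbnd). Convolution is submultiplicative for
   it (wbnd_conv), and a multiplier of order one costs 1 + 1 / (delta - delta')
   when the width decreases from delta to delta' (wbnd_loss). This sum is bounded
   by the Gevrey norm of the same width and of any order s >= 1, since the
   <k>^-2 are summable (gevrey_wbnd), and it bounds the Gevrey norms of any
   smaller width (wbnd_gevrey).

   Existence. The equation determines the Taylor coefficients in time
   recursively, and the n-th one is bounded at width Delta d by
   A (n + 1)^-2 (T (1 - d))^-n, for all d in ]0, 1[ simultaneously: the
   coefficient n + 1 at scale d is estimated through the previous ones at scale
   d + (1 - d) / (n + 2), and the factor (n + 1)^-2 survives the Cauchy products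
   (taylor_step, taylor_exists). The induction closes when
   T (K N^2 + 8 e |gamma|) <= 1, where N is the norm of the data and K depends
   only on Delta. The series then converges for |t| < T (1 - d), and its sum is a
   holomorphic solution (evalt_deriv, solution_exists). Taking equality gives
   T = 1 / (K N^2 + 8 e |gamma|): this is c / N^2 when gamma = 0, and otherwise
   T N^2 tends to 1 / K for large N, and T tends to 1 / (8 e |gamma|) for small N.

   Uniqueness. Along the segment from 0 to t, two solutions are bounded by
   compactness. Integrating the equation n times, each time giving up a fraction
   of the remaining width, bounds their difference by the n-th term of a geometric
   sequence (difference_bound), so that they agree on short segments, and then on
   the whole one (ray_uniqueness, solution_unique).

   Analytic data. Real-analyticity and compactness give Cauchy estimates on all
   derivatives, uniformly on the circle; integrations by parts turn them into
   exponential decay of the coefficients (fourier_decay). Conversely, the Fourier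
   series of an element of a Gevrey class sums to a holomorphic function on the
   strip (gevrey_analytic).

   Functions and coefficients determine each other by fourier_inversion. It rests
   on the fact that an integrable function g with vanishing coefficients is null:
   g is orthogonal to all the trigonometric polynomials (1 - b^n)^(2^n), where b
   is a trigonometric polynomial above 1/2 on ]0, y[ and below 1/2 on ]y, 1[. These
   converge boundedly to the indicator of ]y, 1], so that all the integrals of g
   over [0, y] vanish. *)

(** * Moduli of complex numbers *)

Section Modulus.
Context {R : realType}.
Implicit Types (x y z : R[i]) (a : R).

Lemma cmodM x y : cmod (x * y) = cmod x * cmod y.
Proof. exact: ComplexField.Normc.normcM. Qed.

Lemma cmodE z : cmod z = Num.sqrt (complex.Re z ^+ 2 + complex.Im z ^+ 2).
Proof. by case: z. Qed.

Lemma normcmod z : `|z| = (cmod z)%:C%C.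
Proof. by rewrite normc_def cmodE. Qed.

Lemma cmod_ge0 z : 0 <= cmod z.
Proof. by rewrite cmodE sqrtr_ge0. Qed.

Lemma cmod0 : cmod (0 : R[i]) = 0.
Proof. exact: ComplexField.Normc.normc0. Qed.

Lemma cmod1 : cmod (1 : R[i]) = 1.
Proof. exact: ComplexField.Normc.normc1. Qed.

Lemma cmod_eq0 z : cmod z = 0 -> z = 0.
Proof. exact: ComplexField.Normc.eq0_normc. Qed.

Lemma cmod_gt0 z : z != 0 -> 0 < cmod z.
Proof.
by rewrite lt_def cmod_ge0 andbT; apply: contra => /eqP/cmod_eq0 ->.
Qed.

Lemma cmodD x y : cmod (x + y) <= cmod x + cmod y.
Proof. exact: le_normcD. Qed.

Lemma cmodN x : cmod (- x) = cmod x.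
Proof. by rewrite -mulN1r cmodM cmodE /= oppr0 expr0n addr0 sqrrN expr1n sqrtr1 mul1r. Qed.

Lemma cmodV x : cmod x^-1 = (cmod x)^-1.
Proof. exact: ComplexField.Normc.normcV. Qed.

Lemma cmodX x n : cmod (x ^+ n) = cmod x ^+ n.
Proof. by elim: n => [|n IH]; rewrite ?expr0 ?cmod1// !exprS cmodM IH. Qed.

Lemma cmodR a : cmod (a%:C)%C = `|a|.
Proof. by rewrite cmodE /= expr0n addr0 sqrtr_sqr. Qed.

Lemma cmod_nat n : cmod (n%:R : R[i]) = n%:R.
Proof.
have -> : (n%:R : R[i]) = (n%:R : R)%:C%C by rewrite rmorph_nat.
by rewrite cmodR ger0_norm.
Qed.

Lemma Re_le_cmod z : `|complex.Re z| <= cmod z.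
Proof. by rewrite cmodE -sqrtr_sqr ler_sqrt ?lerDl ?sqr_ge0// addr_ge0 ?sqr_ge0. Qed.

Lemma Im_le_cmod z : `|complex.Im z| <= cmod z.
Proof. by rewrite cmodE -sqrtr_sqr ler_sqrt ?lerDr ?sqr_ge0// addr_ge0 ?sqr_ge0. Qed.

Lemma cmod_le_ReIm z : cmod z <= `|complex.Re z| + `|complex.Im z|.
Proof.
rewrite cmodE -[leRHS]ger0_norm ?addr_ge0// -sqrtr_sqr ler_sqrt ?sqr_ge0//.
rewrite sqrrD !real_normK ?num_real// lerD2r lerDl mulrn_wge0// mulr_ge0//.
Qed.

Lemma complexP x y :
  complex.Re x = complex.Re y -> complex.Im x = complex.Im y -> x = y.
Proof. by case: x => a b; case: y => c d /= -> ->. Qed.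

Lemma cReD x y : complex.Re (x + y) = complex.Re x + complex.Re y.
Proof. by case: x; case: y. Qed.
Lemma cImD x y : complex.Im (x + y) = complex.Im x + complex.Im y.
Proof. by case: x; case: y. Qed.
Lemma cReN x : complex.Re (- x) = - complex.Re x.
Proof. by case: x. Qed.
Lemma cImN x : complex.Im (- x) = - complex.Im x.
Proof. by case: x. Qed.
Lemma cReM x y : complex.Re (x * y) =
  complex.Re x * complex.Re y - complex.Im x * complex.Im y.
Proof. by case: x; case: y. Qed.
Lemma cImM x y : complex.Im (x * y) =
  complex.Re x * complex.Im y + complex.Im x * complex.Re y.
Proof. by case: x; case: y. Qed.

(** Turns a modulus into a real part, so that sums and derivatives of complex
   quantities are estimated through real ones. *)
Lemma cmod_rotate z : exists w : R[i], cmod w = 1 /\ w * z = (cmod z)%:C%C.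
Proof.
have [->|z0] := eqVneq z 0.
  by exists 1; rewrite cmod1 mulr0 cmod0.
exists ((cmod z)%:C%C / z); split.
  rewrite cmodM cmodV cmodR ger0_norm ?cmod_ge0// divff//.
  by rewrite gt_eqF// cmod_gt0.
by rewrite -mulrA mulVf// mulr1.
Qed.

End Modulus.

(** * Unconditional sums *)

Section UnconditionalSums.
Context {R : realType}.
Implicit Types (I J : choiceType).

(** One relation carries both the finiteness of the sum and its value, so that
   equations between sums need no separate summability hypotheses. *)
Definition nhs I (a : I -> R) (A : R) : Prop :=
  (forall i, 0 <= a i) /\ (\esum_(i in [set: I]) (a i)%:E = A%:E)%E.

(** Signed families are differences of nonnegative ones: linearity, reindexing
   and Fubini then come from the nonnegative case. *)
Definition hs I (f : I -> R) (S : R) : Prop :=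
  exists a b A B, [/\ nhs a A, nhs b B, (forall i, f i = a i - b i) & S = A - B].

Definition chs I (f : I -> R[i]) (S : R[i]) : Prop :=
  hs (fun i => complex.Re (f i)) (complex.Re S) /\
  hs (fun i => complex.Im (f i)) (complex.Im S).

Definition csum I (f : I -> R[i]) : R[i] := xget 0 [set S | chs f S].

(** Bounds are used in place of norms throughout: finiteness is part of the
   bound, and suprema never have to be computed. *)
Definition abnd I (f : I -> R[i]) (M : R) : Prop :=
  (\esum_(i in [set: I]) (cmod (f i))%:E <= M%:E)%E.

Lemma nhs_ge0 I (a : I -> R) A : nhs a A -> 0 <= A.
Proof.
by move=> [a0 aA]; rewrite -lee_fin -aA; apply: esum_ge0 => i _; rewrite lee_fin.
Qed.

Lemma eq_nhs I (a b : I -> R) A : a =1 b -> nhs a A -> nhs b A.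
Proof. by move=> /funext ->. Qed.

Lemma nhs_uniq I (a : I -> R) A B : nhs a A -> nhs a B -> A = B.
Proof. by move=> [_ aA] [_ aB]; have := aA; rewrite aB => -[]. Qed.

Lemma nhsD I (a b : I -> R) A B :
  nhs a A -> nhs b B -> nhs (fun i => a i + b i) (A + B).
Proof.
move=> [a0 aA] [b0 bB]; split; first by move=> i; rewrite addr_ge0.
under eq_esum do rewrite EFinD.
by rewrite esumD ?aA ?bB// => i _; rewrite lee_fin.
Qed.

Lemma nhs_le_sum I (a : I -> R) A (s : seq I) : nhs a A -> uniq s ->
  \sum_(i <- s) a i <= A.
Proof.
move=> [a0 aA] us; rewrite -lee_fin -aA; apply: esum_ge.
exists [set` s]; first by split.
by rewrite -fsbig_seq// sumEFin.
Qed.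

Lemma nhs_dom I (a b : I -> R) A : (forall i, 0 <= b i <= a i) -> nhs a A ->
  exists B, nhs b B /\ B <= A.
Proof.
move=> ba [a0 aA].
have b0 i : 0 <= b i by have /andP[] := ba i.
have le : (\esum_(i in [set: I]) (b i)%:E <= A%:E)%E.
  by rewrite -aA; apply: le_esum => i _; rewrite lee_fin; have /andP[] := ba i.
have ge : (0 <= \esum_(i in [set: I]) (b i)%:E)%E.
  by apply: esum_ge0 => i _; rewrite lee_fin.
exists (fine (\esum_(i in [set: I]) (b i)%:E)%E).
have fin : (\esum_(i in [set: I]) (b i)%:E)%E \is a fin_num.
  by rewrite ge0_fin_numE// (le_lt_trans le)// ltry.
split; first by split => //; rewrite fineK.
by rewrite -lee_fin fineK.
Qed.

Lemma nhsZ I (a : I -> R) A (r : R) : 0 <= r -> nhs a A ->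
  nhs (fun i => r * a i) (r * A).
Proof.
rewrite le_eqVlt => /orP[/eqP <- _|r0].
  split; first by move=> i; rewrite mul0r.
  by rewrite mul0r esum1// => i _; rewrite mul0r.
have le (q : R) (b : I -> R) B : 0 < q -> nhs b B ->
    (\esum_(i in [set: I]) (q * b i)%:E <= (q * B)%:E)%E.
  move=> q0 [b0 bB]; apply: ge_ereal_sup => _ [X [fX _] <-].
  rewrite fsbig_finite//= sumEFin lee_fin -mulr_sumr ler_pM2l//.
  exact: (nhs_le_sum (conj b0 bB)).
move=> aA; have r0' := ltW r0; split; first by move=> i; rewrite mulr_ge0//; case: aA.
apply/eqP; rewrite eq_le le//=.
have h : nhs (fun i => r * a i) (fine (\esum_(i in [set: I]) (r * a i)%:E)%E).
  split; first by move=> i; rewrite mulr_ge0//; case: aA.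
  rewrite fineK// ge0_fin_numE; last first.
    by apply: esum_ge0 => i _; rewrite lee_fin mulr_ge0//; case: aA.
  by rewrite (le_lt_trans (le _ _ _ r0 aA))// ltry.
have ri : 0 < r^-1 by rewrite invr_gt0.
have := le _ _ _ ri h.
rewrite (eq_esum (b := fun i => (a i)%:E)); last first.
  by move=> i _; rewrite mulrA mulVf ?mul1r// gt_eqF.
case: aA => _ ->; rewrite lee_fin ler_pdivlMl// => H.
by case: h => _ ->; rewrite lee_fin.
Qed.

Lemma nhs_bij I J (e : I -> J) (a : J -> R) A : bijective e ->
  nhs a A -> nhs (fun i => a (e i)) A.
Proof.
move=> be [a0 aA]; split=> //.
by rewrite -aA; symmetry; apply: reindex_esum; rewrite setTT_bijective.
Qed.

Lemma nhs_pair I J (a : I * J -> R) A : nhs a A ->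
  exists B, (forall i, nhs (fun j => a (i, j)) (B i)) /\ nhs B A.
Proof.
move=> [a0 aA].
have aA2 : (\esum_(i in [set: I]) \esum_(j in [set: J]) (a (i, j))%:E = A%:E)%E.
  rewrite esum_esum; last by move=> i j _ _; rewrite lee_fin.
  rewrite -aA; congr esum; last by apply/funext => -[].
  by apply/seteqP; split.
have g0 i : (0 <= \esum_(j in [set: J]) (a (i, j))%:E)%E.
  by apply: esum_ge0 => j _; rewrite lee_fin.
have fin i : (\esum_(j in [set: J]) (a (i, j))%:E)%E \is a fin_num.
  rewrite ge0_fin_numE// (@le_lt_trans _ _ A%:E) ?ltry// -aA2.
  rewrite (esumID [set i])// setI1 mem_set// esum_set1// leeDl//.
  exact: esum_ge0.
exists (fun i => fine (\esum_(j in [set: J]) (a (i, j))%:E)%E); split.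
  by move=> i; split => //; rewrite fineK.
split; first by move=> i; rewrite fine_ge0.
by rewrite -aA2; apply: eq_esum => i _; rewrite fineK.
Qed.

Lemma nhs_pairI I J (a : I * J -> R) B A : (forall p, 0 <= a p) ->
  (forall i, nhs (fun j => a (i, j)) (B i)) -> nhs B A -> nhs a A.
Proof.
move=> a0 aB [B0 BA]; split => //.
rewrite -BA -[RHS](eq_esum (a := fun i => (\esum_(j in [set: J]) (a (i, j))%:E)%E)); last first.
  by move=> i _; case: (aB i).
rewrite esum_esum; last by move=> i j _ _; rewrite lee_fin.
congr esum; last by apply/funext => -[].
by apply/seteqP; split.
Qed.

Lemma nhs1 I (i0 : I) (a : R) : 0 <= a -> nhs (fun i => if i == i0 then a else 0) a.
Proof.
move=> a0; split; first by move=> i; case: ifP.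
rewrite (esumID [set i0]); last by move=> i _; case: ifP; rewrite lee_fin.
rewrite setI1 mem_set// esum_set1 ?eqxx ?lee_fin//.
rewrite esum1 ?adde0// => i [_ /= ii0].
by case: eqP => // /ii0.
Qed.

(** The sum is the supremum of the finite partial sums. *)
Lemma nhs_tail I (a : I -> R) A e : nhs a A -> 0 < e ->
  exists2 s : seq I, uniq s & A - e < \sum_(i <- s) a i.
Proof.
move=> [a0 aA] e0.
have : (ereal_sup [set (\sum_(i \in X) (a i)%:E)%E | X in fsets [set: I]] \is a fin_num)%E.
  by rewrite -/(esum _ _) aA.
move=> /ub_ereal_sup_adherent-/(_ _ e0) [x [X [fX _] <-]].
rewrite -/(esum _ _) aA -EFinB fsbig_finite//= sumEFin lte_fin => h.
by exists (finmap.enum_fset (fset_set X)) => //; exact: finmap.fset_uniq.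
Qed.

(** Two decompositions a - b and a' - b' of the same family satisfy
   a + b' = a' + b, and sums of nonnegative families are unique. *)
Lemma hs_uniq I (f : I -> R) S T : hs f S -> hs f T -> S = T.
Proof.
move=> [a [b [A [B [aA bB fab ->]]]]] [a' [b' [A' [B' [aA' bB' fab' ->]]]]].
have h1 := nhsD aA bB'; have h2 := nhsD aA' bB.
have : A + B' = A' + B.
  apply: (nhs_uniq h1); apply: eq_nhs h2 => i.
  by have := fab i; rewrite fab'; lra.
lra.
Qed.

Lemma nhs_hs I (a : I -> R) A : nhs a A -> hs a A.
Proof.
move=> aA; exists a, (fun=> 0), A, 0; split => //.
- by split=> //; rewrite esum1.
- by move=> i; rewrite subr0.
- by rewrite subr0.
Qed.

Lemma eq_hs I (f g : I -> R) S : f =1 g -> hs f S -> hs g S.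
Proof. by move=> /funext ->. Qed.

Lemma hsD I (f g : I -> R) S T : hs f S -> hs g T ->
  hs (fun i => f i + g i) (S + T).
Proof.
move=> [a [b [A [B [aA bB fab ->]]]]] [a' [b' [A' [B' [aA' bB' fab' ->]]]]].
exists (fun i => a i + a' i), (fun i => b i + b' i), (A + A'), (B + B').
split; [exact: nhsD|exact: nhsD| |]; last by lra.
by move=> i; rewrite fab fab'; lra.
Qed.

Lemma hsN I (f : I -> R) S : hs f S -> hs (fun i => - f i) (- S).
Proof.
move=> [a [b [A [B [aA bB fab ->]]]]]; exists b, a, B, A.
by split => //; [move=> i; rewrite fab opprB|rewrite opprB].
Qed.

Lemma hsZ I (f : I -> R) S r : hs f S -> hs (fun i => r * f i) (r * S).
Proof.
wlog r0 : r / 0 <= r.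
  move=> H fS; have [/H|r0] := leP 0 r; first exact.
  have Nr : 0 <= - r by lra.
  have := hsN (H _ Nr fS); rewrite mulNr opprK.
  by apply: eq_hs => i; rewrite mulNr opprK.
move=> [a [b [A [B [aA bB fab ->]]]]].
exists (fun i => r * a i), (fun i => r * b i), (r * A), (r * B).
split; [exact: nhsZ|exact: nhsZ| |]; last by rewrite mulrBr.
by move=> i; rewrite fab mulrBr.
Qed.

Lemma hs_bij I J (e : I -> J) (f : J -> R) S : bijective e ->
  hs f S -> hs (fun i => f (e i)) S.
Proof.
move=> be [a [b [A [B [aA bB fab ->]]]]].
exists (fun i => a (e i)), (fun i => b (e i)), A, B.
by split => //; exact: nhs_bij.
Qed.

Lemma hs_pair I J (f : I * J -> R) S : hs f S ->
  exists T, (forall i, hs (fun j => f (i, j)) (T i)) /\ hs T S.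
Proof.
move=> [a [b [A [B [aA bB fab ->]]]]].
have [A' [aA' A'A]] := nhs_pair aA; have [B' [bB' B'B]] := nhs_pair bB.
exists (fun i => A' i - B' i); split.
  move=> i; exists (fun j => a (i, j)), (fun j => b (i, j)), (A' i), (B' i).
  by split.
by exists A', B', A, B; split.
Qed.

(** Summability of a dominated real family, through its positive and negative
   parts. *)
Lemma hs_dom I (f : I -> R) (a : I -> R) A :
  (forall i, `|f i| <= a i) -> nhs a A -> exists2 S, hs f S & `|S| <= A.
Proof.
move=> fa aA.
have [|P [hP _]] := @nhs_dom I a (fun i => Num.max (f i) 0) A _ aA.
  move=> i; rewrite le_max lexx orbT/= ge_max.
  by rewrite (le_trans (ler_norm _) (fa i)) (le_trans (normr_ge0 _) (fa i)).
have [|N [hN _]] := @nhs_dom I a (fun i => Num.max (- f i) 0) A _ aA.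
  move=> i; rewrite le_max lexx orbT/= ge_max.
  by rewrite (le_trans (ler_norm _)) ?normrN ?fa// (le_trans (normr_ge0 _) (fa i)).
have [|Q [hQ QA]] := @nhs_dom I a (fun i => `|f i|) A _ aA.
  by move=> i; rewrite fa normr_ge0.
exists (P - N).
  exists (fun i => Num.max (f i) 0), (fun i => Num.max (- f i) 0), P, N.
  by split => // i; rewrite /Order.max; case: ifPn; case: ifPn; lra.
have PNQ : P + N = Q.
  apply: (nhs_uniq (nhsD hP hN)); apply: eq_nhs hQ => i.
  by rewrite /Order.max; case: ifPn; case: ifPn => ? ?; 
     (rewrite ger0_norm + rewrite ler0_norm); lra.
have P0 := nhs_ge0 hP; have N0 := nhs_ge0 hN.
by rewrite ler_norml; apply/andP; split; lra.
Qed.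

End UnconditionalSums.

(** * Unconditional sums of complex families *)

Section ComplexSums.
Context {R : realType}.
Implicit Types (I J : choiceType) (c : R[i]).

Lemma abndP I (f : I -> R[i]) M : abnd f M <->
  exists2 A, nhs (fun i => cmod (f i)) A & A <= M.
Proof.
split=> [fM|[A [_ fA] AM]]; last by rewrite /abnd fA lee_fin.
have ge : (0 <= \esum_(i in [set: I]) (cmod (f i))%:E)%E.
  by apply: esum_ge0 => i _; rewrite lee_fin cmod_ge0.
have fin : (\esum_(i in [set: I]) (cmod (f i))%:E)%E \is a fin_num.
  by rewrite ge0_fin_numE// (le_lt_trans fM)// ltry.
exists (fine (\esum_(i in [set: I]) (cmod (f i))%:E)%E).
  by split; [move=> i; exact: cmod_ge0|rewrite fineK].
by rewrite -lee_fin fineK.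
Qed.

Lemma abnd_seqP I (f : I -> R[i]) M : abnd f M <->
  forall s : seq I, uniq s -> \sum_(i <- s) cmod (f i) <= M.
Proof.
split=> [/abndP[A fA AM] s us|h]; first exact: le_trans (nhs_le_sum fA us) AM.
apply: ge_ereal_sup => _ [X [fX _] <-].
rewrite fsbig_finite//= sumEFin lee_fin; apply: h; exact: finmap.fset_uniq.
Qed.

Lemma abnd_ge0 I (f : I -> R[i]) M : abnd f M -> 0 <= M.
Proof. by move=> /abndP[A /nhs_ge0 A0 AM]; exact: le_trans AM. Qed.

Lemma abnd_le I (f : I -> R[i]) M N : M <= N -> abnd f M -> abnd f N.
Proof. by move=> MN fM; rewrite /abnd (le_trans fM)// lee_fin. Qed.

Lemma abnd_mono I (f g : I -> R[i]) M :
  (forall i, cmod (f i) <= cmod (g i)) -> abnd g M -> abnd f M.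
Proof.
by move=> fg; rewrite /abnd; apply: le_trans; apply: le_esum => i _; rewrite lee_fin.
Qed.

Lemma abnd_dom I (f : I -> R[i]) a A :
  (forall i, cmod (f i) <= a i) -> nhs a A -> abnd f A.
Proof.
by move=> fa [a0 aA]; rewrite /abnd -aA; apply: le_esum => i _; rewrite lee_fin.
Qed.

Lemma abnd_term I (f : I -> R[i]) M i : abnd f M -> cmod (f i) <= M.
Proof. by move=> /abnd_seqP/(_ [:: i] isT); rewrite big_seq1. Qed.

Lemma abnd0 I : abnd (fun _ : I => 0 : R[i]) 0.
Proof. by rewrite /abnd esum1// => i _; rewrite cmod0. Qed.

Lemma abndD I (f g : I -> R[i]) M N : abnd f M -> abnd g N ->
  abnd (fun i => f i + g i) (M + N).
Proof.
move=> /abndP[A fA AM] /abndP[B gB BN].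
apply: abnd_le (abnd_dom _ (nhsD fA gB)); first exact: lerD.
by move=> i; exact: cmodD.
Qed.

Lemma abndN I (f : I -> R[i]) M : abnd f M -> abnd (fun i => - f i) M.
Proof. by apply: abnd_mono => i; rewrite cmodN. Qed.

Lemma abndB I (f g : I -> R[i]) M N : abnd f M -> abnd g N ->
  abnd (fun i => f i - g i) (M + N).
Proof. by move=> fM /abndN; exact: abndD. Qed.

Lemma abndZ I (f : I -> R[i]) M c r : cmod c <= r -> abnd f M ->
  abnd (fun i => c * f i) (r * M).
Proof.
move=> cr /abndP[A fA AM].
have r0 : 0 <= r by rewrite (le_trans _ cr)// cmod_ge0.
have A0 := nhs_ge0 fA.
apply: abnd_le (abnd_dom _ (nhsZ r0 fA)); first exact: ler_wpM2l.
by move=> i; rewrite cmodM ler_wpM2r// cmod_ge0.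
Qed.

Lemma abnd_bij I J (e : I -> J) (f : J -> R[i]) M : bijective e ->
  abnd f M -> abnd (fun i => f (e i)) M.
Proof.
move=> be /abndP[A fA AM]; apply/abndP; exists A => //.
exact: (nhs_bij be fA).
Qed.

Lemma chs_uniq I (f : I -> R[i]) S T : chs f S -> chs f T -> S = T.
Proof.
by move=> [h1 h2] [h3 h4]; apply: complexP; [exact: hs_uniq h1 h3|exact: hs_uniq h2 h4].
Qed.

Lemma csumE I (f : I -> R[i]) S : chs f S -> csum f = S.
Proof. by move=> fS; rewrite /csum; apply: xget_subset1 => // x y /= h1 h2; exact: chs_uniq h1 h2. Qed.

Lemma eq_csum I (f g : I -> R[i]) : f =1 g -> csum f = csum g.
Proof. by move=> /funext ->. Qed.

Lemma chsD I (f g : I -> R[i]) S T : chs f S -> chs g T ->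
  chs (fun i => f i + g i) (S + T).
Proof.
move=> [f1 f2] [g1 g2]; split; rewrite ?cReD ?cImD.
  by apply: eq_hs (hsD f1 g1) => i; rewrite cReD.
by apply: eq_hs (hsD f2 g2) => i; rewrite cImD.
Qed.

Lemma chsN I (f : I -> R[i]) S : chs f S -> chs (fun i => - f i) (- S).
Proof.
move=> [f1 f2]; split; rewrite ?cReN ?cImN.
  by apply: eq_hs (hsN f1) => i; rewrite cReN.
by apply: eq_hs (hsN f2) => i; rewrite cImN.
Qed.

Lemma chsZ I (f : I -> R[i]) S (c : R[i]) : chs f S -> chs (fun i => c * f i) (c * S).
Proof.
move=> [f1 f2]; split; rewrite ?cReM ?cImM.
  have h := hsD (hsZ (complex.Re c) f1) (hsN (hsZ (complex.Im c) f2)).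
  apply: eq_hs h => i.
  by rewrite cReM.
apply: eq_hs (hsD (hsZ (complex.Re c) f2) (hsZ (complex.Im c) f1)) => i.
by rewrite cImM.
Qed.

Lemma chs_bij I J (e : I -> J) (f : J -> R[i]) S : bijective e ->
  chs f S -> chs (fun i => f (e i)) S.
Proof. by move=> be [f1 f2]; split; [exact: (hs_bij be f1)|exact: (hs_bij be f2)]. Qed.

Lemma chs_pair I J (f : I * J -> R[i]) S : chs f S ->
  exists T, (forall i, chs (fun j => f (i, j)) (T i)) /\ chs T S.
Proof.
move=> [/hs_pair[T1 [h1 g1]] /hs_pair[T2 [h2 g2]]].
by exists (fun i => T1 i +i* T2 i)%C; split.
Qed.

Lemma abnd_chs_le I (f : I -> R[i]) M : abnd f M ->
  exists2 S, chs f S & cmod S <= M.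
Proof.
move=> /abndP[A fA AM].
have [S1 h1 _] := hs_dom (fun i => Re_le_cmod (f i)) fA.
have [S2 h2 _] := hs_dom (fun i => Im_le_cmod (f i)) fA.
pose S := (S1 +i* S2)%C.
have hS : chs f S by [].
exists S => //; apply: le_trans AM.
(* Rotating the sum onto the positive axis turns its modulus into the sum of
   the real parts, each at most the modulus of the term. *)
have [w [w1 wS]] := cmod_rotate S.
have [hw _] := chsZ w hS.
have [T hT TA] : exists2 T, hs (fun i => complex.Re (w * f i)) T & `|T| <= A.
  apply: hs_dom fA => i.
  by rewrite (le_trans (Re_le_cmod _))// cmodM w1 mul1r.
rewrite wS in hw; have e : cmod S = T := hs_uniq hw hT.
by rewrite e (le_trans (ler_norm _)).
Qed.

Lemma abnd_chs I (f : I -> R[i]) M : abnd f M -> chs f (csum f).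
Proof. by move=> /abnd_chs_le[S fS _]; rewrite (csumE fS). Qed.

Lemma cmod_csum I (f : I -> R[i]) M : abnd f M -> cmod (csum f) <= M.
Proof. by move=> /abnd_chs_le[S fS SM]; rewrite (csumE fS). Qed.

Lemma csumD I (f g : I -> R[i]) M N : abnd f M -> abnd g N ->
  csum (fun i => f i + g i) = csum f + csum g.
Proof. by move=> /abnd_chs h1 /abnd_chs h2; exact/csumE/chsD. Qed.

Lemma csumN I (f : I -> R[i]) M : abnd f M ->
  csum (fun i => - f i) = - csum f.
Proof. by move=> /abnd_chs h1; exact/csumE/chsN. Qed.

Lemma csumB I (f g : I -> R[i]) M N : abnd f M -> abnd g N ->
  csum (fun i => f i - g i) = csum f - csum g.
Proof. by move=> h1 h2; rewrite (csumD h1 (abndN h2)) (csumN h2). Qed.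

Lemma csumZ I (f : I -> R[i]) M c : abnd f M ->
  csum (fun i => c * f i) = c * csum f.
Proof. by move=> /abnd_chs h1; exact/csumE/chsZ. Qed.

Lemma csum_bij I J (e : I -> J) (f : J -> R[i]) M : bijective e -> abnd f M ->
  csum f = csum (fun i => f (e i)).
Proof. by move=> be /abnd_chs h; symmetry; apply/csumE/(chs_bij be h). Qed.

Lemma abnd_row I J (f : I * J -> R[i]) M i : abnd f M ->
  abnd (fun j => f (i, j)) M.
Proof.
move=> /abnd_seqP fM; apply/abnd_seqP => s us.
rewrite -(big_map (fun j => (i, j)) xpredT (fun p => cmod (f p))).
by apply: fM; rewrite map_inj_uniq// => ? ? [].
Qed.

Lemma csum_pair I J (f : I * J -> R[i]) M : abnd f M ->
  csum f = csum (fun i => csum (fun j => f (i, j))).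
Proof.
move=> fM; have [T [h1 h2]] := chs_pair (abnd_chs fM).
rewrite -(csumE h2); apply: eq_csum => i; symmetry; exact: csumE.
Qed.

Lemma abnd_csum_row I J (f : I * J -> R[i]) M : abnd f M ->
  abnd (fun i => csum (fun j => f (i, j))) M.
Proof.
move=> /abndP[A fA AM]; apply: abnd_le AM _.
have [B [hB BA]] := nhs_pair fA.
apply: abnd_dom BA => i; apply: cmod_csum.
by apply/abndP; exists (B i).
Qed.

Lemma swap_bij I J : bijective (fun p : I * J => (p.2, p.1)).
Proof. by exists (fun p => (p.2, p.1)) => -[]. Qed.

Lemma csum_swap I J (f : I -> J -> R[i]) M :
  abnd (fun p : I * J => f p.1 p.2) M ->
  csum (fun i => csum (fun j => f i j)) = csum (fun j => csum (fun i => f i j)).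
Proof.
move=> fM; rewrite -(csum_pair fM) (csum_bij (swap_bij J I) fM).
by rewrite (csum_pair (abnd_bij (swap_bij J I) fM)).
Qed.

Lemma abnd_pairI I J (f : I -> J -> R[i]) B M :
  (forall i, abnd (f i) (B i)) -> nhs B M ->
  abnd (fun p : I * J => f p.1 p.2) M.
Proof.
move=> fB BM.
have /choice[A hA] : forall i, exists a, nhs (fun j => cmod (f i j)) a /\ a <= B i.
  by move=> i; have /abndP[a] := fB i; exists a.
have [|N [hN NM]] := @nhs_dom R I B A M _ BM.
  by move=> i; have [h ->] := hA i; rewrite (nhs_ge0 h).
apply: abnd_le NM _; apply/abndP; exists N => //.
apply: (nhs_pairI _ _ hN) => [p|i]; first exact: cmod_ge0.
by case: (hA i).
Qed.

Lemma abnd_prod I J (f : I -> R[i]) (g : J -> R[i]) M N : abnd f M -> abnd g N ->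
  abnd (fun p : I * J => f p.1 * g p.2) (M * N).
Proof.
move=> fM gN; have N0 := abnd_ge0 gN.
have /abndP[A fA AM] := fM.
apply: (@abnd_le _ _ (N * A)); first by rewrite mulrC ler_wpM2r.
apply: (@abnd_pairI _ _ (fun i j => f i * g j) (fun i => N * cmod (f i)) _ _ (nhsZ N0 fA)) => i.
by rewrite mulrC; apply: abndZ gN.
Qed.

Lemma csum0 I : csum (fun _ : I => 0 : R[i]) = 0.
Proof. by apply: cmod_eq0; apply/eqP; rewrite eq_le cmod_ge0 (cmod_csum (abnd0 I)). Qed.

Lemma chs1 I (i0 : I) (c : R[i]) : chs (fun i => if i == i0 then c else 0) c.
Proof.
have h (a : R) : hs (fun i : I => if i == i0 then a else 0) a.
  have [a0|a0] := leP 0 a; first exact/nhs_hs/nhs1.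
  have Na : 0 <= - a by lra.
  have := hsN (nhs_hs (nhs1 i0 Na)); rewrite opprK; apply: eq_hs => i.
  by case: ifP; rewrite ?opprK ?oppr0.
by split; [apply: eq_hs (h (complex.Re c))|apply: eq_hs (h (complex.Im c))] => i; case: ifP.
Qed.

Lemma csum1 I (i0 : I) (f : I -> R[i]) : (forall i, i != i0 -> f i = 0) ->
  csum f = f i0.
Proof.
move=> f0; rewrite -(csumE (chs1 i0 (f i0))); apply: eq_csum => i.
by case: eqP => [->//|/eqP/f0].
Qed.

Lemma abnd_finite I (f : I -> R[i]) (s : seq I) : uniq s ->
  (forall i, i \notin s -> f i = 0) -> abnd f (\sum_(i <- s) cmod (f i)).
Proof.
move=> us fs; apply/abnd_seqP => t ut.
rewrite [leRHS](bigID [in t])/= [leLHS](bigID [in s])/= [X in _ + X]big1 ?addr0.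
  rewrite -[leLHS]big_filter -[X in _ <= X + _]big_filter.
  have pe : perm_eq [seq i <- t | i \in s] [seq i <- s | i \in t].
    apply: uniq_perm; rewrite ?filter_uniq// => i.
    by rewrite !mem_filter /= andbC.
  by rewrite (perm_big _ pe)/= lerDl sumr_ge0// => i _; exact: cmod_ge0.
by move=> i /fs ->; rewrite cmod0.
Qed.

Lemma csum_finite I (f : I -> R[i]) (s : seq I) : uniq s ->
  (forall i, i \notin s -> f i = 0) -> csum f = \sum_(i <- s) f i.
Proof.
elim: s f => [|i0 s IH] f /= => [_ f0|/andP[i0s us] f0].
  by rewrite big_nil -(csum0 I); apply: eq_csum => i; rewrite f0.
pose g i := if i == i0 then 0 else f i.
have g0 i : i \notin s -> g i = 0.
  rewrite /g; case: eqP => // /eqP ii0 si; apply: f0.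
  by rewrite in_cons negb_or ii0.
have := IH _ us g0.
rewrite big_cons => gE; rewrite (_ : \sum_(i <- s) f i = csum g); last first.
  rewrite gE !big_seq; apply: eq_bigr => i si; rewrite /g; case: eqP => // e.
  by rewrite -e si in i0s.
rewrite -(csumE (chsD (chs1 i0 (f i0)) (abnd_chs (abnd_finite us g0)))).
by apply: eq_csum => i; rewrite /g; case: eqP => [->|]; rewrite ?addr0 ?add0r.
Qed.

Lemma csum_sum I J (s : seq J) (f : J -> I -> R[i]) B :
  (forall j, abnd (f j) (B j)) ->
  csum (fun i => \sum_(j <- s) f j i) = \sum_(j <- s) csum (f j) /\
  abnd (fun i => \sum_(j <- s) f j i) (\sum_(j <- s) B j).
Proof.
move=> fB; elim: s => [|j s [IH1 IH2]].
  have -> : (fun i => \sum_(j <- [::]) f j i) = (fun=> 0).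
    by apply/funext => i; rewrite big_nil.
  by rewrite !big_nil; split; [exact: csum0|exact: abnd0].
have -> : (fun i => \sum_(j <- j :: s) f j i) =
    (fun i => f j i + \sum_(j <- s) f j i).
  by apply/funext => i; rewrite big_cons.
rewrite !big_cons; split; last exact: abndD.
by rewrite (csumD (fB j) IH2) IH1.
Qed.

(** A finite set carrying the sum up to e leaves at most e to its
   complement. *)
Lemma abnd_tail I (f : I -> R[i]) M e : abnd f M -> 0 < e ->
  exists s0 : seq I, forall s, uniq s -> {subset s0 <= s} ->
    abnd (fun i => if i \in s then 0 else f i) e.
Proof.
move=> /abndP[A fA _] e0; have [s0 us0 hs0] := nhs_tail fA e0.
exists s0 => s us s0s; apply/abnd_seqP => t ut.
rewrite (eq_bigr (fun i => if i \in s then 0 else cmod (f i))); last first.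
  by move=> i _; case: ifP; rewrite ?cmod0.
rewrite (bigID [in s])/= big1 ?add0r; last by move=> i ->.
rewrite (eq_bigr (fun i => cmod (f i))); last by move=> i /negPf ->.
rewrite -big_filter; set t' := [seq _ <- t | _].
have ut' : uniq (s ++ t').
  rewrite cat_uniq us filter_uniq// andbT/=.
  by apply/hasPn => i; rewrite mem_filter => /andP[].
have := nhs_le_sum fA ut'; rewrite big_cat/=.
have : \sum_(i <- s0) cmod (f i) <= \sum_(i <- s) cmod (f i).
  rewrite [leRHS](bigID [in s0])/= -[X in _ <= X + _]big_filter.
  have pe : perm_eq s0 [seq i <- s | i \in s0].
    apply: uniq_perm; rewrite ?filter_uniq// => i.
    by rewrite mem_filter /=; case: (boolP (i \in s0)) => //= /s0s ->.
  by rewrite (perm_big _ pe)/= lerDl sumr_ge0// => i _; exact: cmod_ge0.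
by lra.
Qed.

Lemma csum_off I (f : I -> R[i]) M s : uniq s -> abnd f M ->
  csum f - \sum_(i <- s) f i = csum (fun i => if i \in s then 0 else f i).
Proof.
move=> us fM.
have h0 i : i \notin s -> (if i \in s then f i else 0) = 0 by move=> /negPf ->.
have := csum_finite us h0.
rewrite big_seq (eq_bigr f) -?big_seq; last by move=> i ->.
move=> <-; rewrite -(csumB fM (abnd_finite us h0)).
by apply: eq_csum => i; case: ifP; rewrite ?subrr ?subr0.
Qed.

End ComplexSums.

(** * Cauchy products *)

Section CauchyProducts.
Context {R : realType}.
Implicit Types (I J : choiceType).

(** Transport along an injection that reaches the whole support; it serves to
   split the integers into two copies of the naturals and to pass from squares
   of indices to triangles. *)
Lemma nhs_inj I J (e : I -> J) (a : J -> R) A : injective e ->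
  (forall j, 0 <= a j) -> (forall j, (forall i, e i <> j) -> a j = 0) ->
  nhs (fun i => a (e i)) A -> nhs a A.
Proof.
move=> ie a0 aoff [_ aA]; split => //.
rewrite (esumID (range e)); last by move=> j _; rewrite lee_fin.
rewrite setTI [X in (_ + X)%E]esum1 ?adde0; last first.
  by move=> j [_ nj]; rewrite aoff// => i eij; apply: nj; exists i.
rewrite -aA; apply: reindex_esum; split=> //.
by move=> i j _ _; exact: ie.
Qed.

Lemma abnd_inj I J (e : I -> J) (f : J -> R[i]) M : injective e ->
  abnd f M -> abnd (fun i => f (e i)) M.
Proof.
move=> ie /abnd_seqP fM; apply/abnd_seqP => s us.
rewrite -(big_map e xpredT (fun p => cmod (f p))).
by apply: fM; rewrite map_inj_uniq.
Qed.

Lemma hs_inj I J (e : I -> J) (f : J -> R) S : injective e ->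
  (forall j, (forall i, e i <> j) -> f j = 0) -> 
  hs (fun i => f (e i)) S -> hs f S.
Proof.
move=> ie foff [a [b [A [B [aA bB fab SAB]]]]].
pose ext (c : I -> R) j := if pselect (exists i, e i = j) is left h
  then c (sval (cid h)) else 0.
have extE c i : ext c (e i) = c i.
  rewrite /ext; case: pselect => [h|[]]; last by exists i.
  by congr c; apply: ie; exact: (svalP (cid h)).
have ext0 c j : (forall i, e i <> j) -> ext c j = 0.
  by move=> h; rewrite /ext; case: pselect => // -[i ei]; case: (h i).
have extnhs c C : nhs c C -> nhs (ext c) C.
  move=> cC; apply: (@nhs_inj _ _ e) => //.
  - by move=> j; rewrite /ext; case: pselect => // h; case: cC.
  - by move=> j /ext0.
  - by apply: eq_nhs cC => i; rewrite extE.
exists (ext a), (ext b), A, B; split; [exact: extnhs|exact: extnhs| |by []].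
move=> j; have [[i <-]|h] := pselect (exists i, e i = j); first by rewrite !extE.
have h' i : e i <> j by move=> eij; apply: h; exists i.
by rewrite foff// !ext0// subr0.
Qed.

Lemma chs_inj I J (e : I -> J) (f : J -> R[i]) S : injective e ->
  (forall j, (forall i, e i <> j) -> f j = 0) ->
  chs (fun i => f (e i)) S -> chs f S.
Proof.
move=> ie foff [h1 h2]; split.
- by apply: (hs_inj ie) h1 => j /foff ->.
- by apply: (hs_inj ie) h2 => j /foff ->.
Qed.

Definition diag (p : nat * nat) : nat * nat := (p.1 + p.2, p.1)%N.

Lemma diag_inj : injective diag.
Proof. by move=> [i m] [i' m'] [] /= + ii'; rewrite ii' => /addnI ->. Qed.

Lemma diag_off j : (forall p, diag p <> j) -> (j.1 < j.2)%N.
Proof.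
case: j => n i /= h; rewrite ltnNge; apply/negP => ni.
by apply: (h (i, (n - i)%N)); rewrite /diag /= subnKC.
Qed.

(** The map (i, m) |-> (i + m, i) carries the product family to a family
   summed by rows, whose rows are the terms of the Cauchy product. *)
Lemma nhs_cauchy (a b : nat -> R) A B : nhs a A -> nhs b B ->
  nhs (fun n => \sum_(i < n.+1) a i * b (n - i)%N) (A * B).
Proof.
move=> aA bB.
have a0 i : 0 <= a i by case: aA. have b0 i : 0 <= b i by case: bB.
have ab : nhs (fun p : nat * nat => a p.1 * b p.2) (A * B).
  have B0 := nhs_ge0 bB.
  apply: (nhs_pairI (B := fun i => a i * B)) => [p|i|]; first exact: mulr_ge0.
    exact: (nhsZ (a0 i) bB).
  by rewrite mulrC; apply: eq_nhs (nhsZ B0 aA) => i; rewrite mulrC.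
pose h (p : nat * nat) := if (p.2 <= p.1)%N then a p.2 * b (p.1 - p.2)%N else 0.
have hAB : nhs h (A * B).
  apply: (nhs_inj diag_inj).
  - by move=> p; rewrite /h; case: ifP => // _; exact: mulr_ge0.
  - by move=> j /diag_off lt; rewrite /h leqNgt lt.
  - by apply: eq_nhs ab => -[i m]; rewrite /h /= leq_addr addKn.
have [C [hC CAB]] := nhs_pair hAB.
apply: eq_nhs CAB => n.
pose s := index_iota 0 n.+1.
have hn i : i \notin s -> h (n, i) = 0.
  by rewrite mem_index_iota /= -leqNgt /h /= => ni; rewrite leqNgt ni.
have us : uniq s by exact: iota_uniq.
rewrite -(big_mkord xpredT (fun i => a i * b (n - i)%N)).
have e1 : \sum_(0 <= i < n.+1) a i * b (n - i)%N = \sum_(i <- s) h (n, i).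
  by apply: eq_big_nat => i /andP[_]; rewrite ltnS /h /= => ->.
rewrite e1; apply: (nhs_uniq (hC n)); split; first by case: hAB.
apply/eqP; rewrite eq_le; apply/andP; split; last first.
  apply: esum_ge; exists [set` s]; first by split=> //; exact: finite_seq.
  by rewrite -fsbig_seq// sumEFin.
have [_ ->] := hC n; rewrite lee_fin.
rewrite -[leLHS]subr0; apply: (@le_trans _ _ (C n - 0)) => //.
rewrite subr0 leNgt; apply/negP => lt.
have e0 : 0 < C n - \sum_(i <- s) h (n, i) by rewrite subr_gt0.
have [t ut] := nhs_tail (hC n) e0.
rewrite subKr ltNge => /negP; apply.
rewrite (bigID [in s])/= [X in _ + X]big1 ?addr0; last by move=> i /hn.
rewrite [leRHS](bigID [in t])/= -big_filter -[X in _ <= X + _]big_filter.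
have pe : perm_eq [seq i <- t | i \in s] [seq i <- s | i \in t].
  apply: uniq_perm; rewrite ?filter_uniq// => i.
  by rewrite !mem_filter /= andbC.
by rewrite (perm_big _ pe)/= lerDl sumr_ge0// => i _; case: hAB.
Qed.

Lemma csum_cauchy (h : nat -> nat -> R[i]) M :
  abnd (fun p : nat * nat => h p.1 p.2) M ->
  csum (fun n => \sum_(i < n.+1) h i (n - i)%N) =
  csum (fun p : nat * nat => h p.1 p.2).
Proof.
move=> hM.
pose g (p : nat * nat) := if (p.2 <= p.1)%N then h p.2 (p.1 - p.2)%N else 0.
have gS : chs g (csum (fun p : nat * nat => h p.1 p.2)).
  apply: (chs_inj diag_inj).
    by move=> j /diag_off lt; rewrite /g leqNgt lt.
  rewrite (_ : (fun p => _) = (fun p : nat * nat => h p.1 p.2)); first exact: abnd_chs hM.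
  by apply/funext => -[i m]; rewrite /g /= leq_addr addKn.
have [T [gT TS]] := chs_pair gS.
rewrite -(csumE TS); apply: eq_csum => n.
rewrite -(csumE (gT n)) (@csum_finite _ _ _ (index_iota 0 n.+1)).
- rewrite -(big_mkord xpredT (fun i => h i (n - i)%N)).
  by apply: eq_big_nat => i /andP[_]; rewrite ltnS /g /= => ->.
- exact: iota_uniq.
- by move=> i; rewrite mem_index_iota /= -leqNgt /g /= => ni; rewrite leqNgt ni.
Qed.

End CauchyProducts.

(** * Weighted summable sequences and convolution *)

Section WienerAlgebra.
Context {R : realType}.
Implicit Types (c d : int -> R[i]) (k j : int) (delta : R).

Definition wt delta k : R := expR (2 * pi * delta * `|k%:~R|).

(** With these weights, sequences of finite norm are the Fourier coefficients of
   functions that extend holomorphically to the strip |Im z| < delta. *)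
Definition wbnd delta c M : Prop := abnd (fun k => (wt delta k)%:C%C * c k) M.

Definition conv c d k : R[i] := csum (fun j => c j * d (k - j)).

Lemma wt_ge0 delta k : 0 <= wt delta k.
Proof. exact: expR_ge0. Qed.

Lemma wt_gt0 delta k : 0 < wt delta k.
Proof. exact: expR_gt0. Qed.

Lemma cmod_wt delta k (z : R[i]) : cmod ((wt delta k)%:C%C * z) = wt delta k * cmod z.
Proof. by rewrite cmodM cmodR ger0_norm// wt_ge0. Qed.

Lemma wt_le delta delta' k : delta <= delta' -> wt delta k <= wt delta' k.
Proof.
move=> dd; rewrite ler_expR ler_wpM2r// ler_wpM2l// mulr_ge0// pi_ge0//.
Qed.

Lemma wt_ge1 delta k : 0 <= delta -> 1 <= wt delta k.
Proof.
by move=> d0; rewrite /wt -expR0 ler_expR mulr_ge0// mulr_ge0// mulr_ge0// pi_ge0.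
Qed.

(** The weights are submultiplicative by the triangle inequality for |k|; this
   is what makes the weighted spaces algebras under convolution. *)
Lemma wt_sub delta k j : 0 <= delta -> wt delta k <= wt delta j * wt delta (k - j).
Proof.
move=> d0; rewrite -expRD ler_expR -mulrDr ler_wpM2l ?mulr_ge0 ?pi_ge0//.
have -> : (k%:~R : R) = j%:~R + (k - j)%:~R by rewrite -intrD addrC subrK.
exact: ler_normD.
Qed.

Lemma eq_wbnd delta c d M : c =1 d -> wbnd delta c M -> wbnd delta d M.
Proof. by move=> /funext ->. Qed.

Lemma wbnd_le delta c M N : M <= N -> wbnd delta c M -> wbnd delta c N.
Proof. exact: abnd_le. Qed.

Lemma wbnd_ge0 delta c M : wbnd delta c M -> 0 <= M.
Proof. exact: abnd_ge0. Qed.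

Lemma wbnd_wt delta delta' c M : delta <= delta' -> wbnd delta' c M -> wbnd delta c M.
Proof.
by move=> dd; apply: abnd_mono => k; rewrite !cmod_wt ler_wpM2r ?cmod_ge0// wt_le.
Qed.

Lemma wbnd_abnd delta c M : 0 <= delta -> wbnd delta c M -> abnd c M.
Proof.
move=> d0; apply: abnd_mono => k; rewrite cmod_wt.
by rewrite ler_peMl ?cmod_ge0// wt_ge1.
Qed.

Lemma wbnd_mono delta c d M : (forall k, cmod (c k) <= cmod (d k)) ->
  wbnd delta d M -> wbnd delta c M.
Proof.
move=> cd; apply: abnd_mono => k; rewrite !cmod_wt.
by apply: ler_wpM2l => //; exact: wt_ge0.
Qed.

Lemma wbnd_term delta c M k : wbnd delta c M -> wt delta k * cmod (c k) <= M.
Proof. by move=> /(@abnd_term _ _ _ _ k); rewrite cmod_wt. Qed.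

Lemma wbnd0 delta : wbnd delta (fun=> 0) 0.
Proof. by rewrite /wbnd; under eq_fun do rewrite mulr0; exact: abnd0. Qed.

Lemma wbndD delta c d M N : wbnd delta c M -> wbnd delta d N ->
  wbnd delta (fun k => c k + d k) (M + N).
Proof.
by move=> cM dN; rewrite /wbnd; under eq_fun do rewrite mulrDr; exact: abndD.
Qed.

Lemma wbndN delta c M : wbnd delta c M -> wbnd delta (fun k => - c k) M.
Proof. by apply: wbnd_mono => k; rewrite cmodN. Qed.

Lemma wbndB delta c d M N : wbnd delta c M -> wbnd delta d N ->
  wbnd delta (fun k => c k - d k) (M + N).
Proof. by move=> cM /wbndN; exact: wbndD. Qed.

Lemma wbndZ delta c M (a : int -> R[i]) r : 0 <= r -> (forall k, cmod (a k) <= r) ->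
  wbnd delta c M -> wbnd delta (fun k => a k * c k) (r * M).
Proof.
move=> r0 ar cM.
have : wbnd delta (fun k => r%:C%C * c k) (r * M).
  rewrite /wbnd; under eq_fun do rewrite mulrCA.
  by apply: abndZ => //; rewrite cmodR ger0_norm.
apply: wbnd_mono => k; rewrite !cmodM cmodR ger0_norm//.
by rewrite ler_wpM2r// cmod_ge0.
Qed.

Lemma wbnd_sum (I : eqType) (s : seq I) delta (c : I -> int -> R[i]) (M : I -> R) :
  (forall i, wbnd delta (c i) (M i)) ->
  wbnd delta (fun k => \sum_(i <- s) c i k) (\sum_(i <- s) M i).
Proof.
move=> cM; elim: s => [|i s IH].
  by rewrite big_nil; apply: eq_wbnd (wbnd0 delta) => k; rewrite big_nil.
by rewrite big_cons; apply: eq_wbnd (wbndD (cM i) IH) => k; rewrite big_cons.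
Qed.

(** Since x <= expR x, a factor |k| is absorbed by the exponential weights of
   the lost part of the width, at the price of its inverse. *)
Lemma wbnd_loss delta delta' c M (a : int -> R[i]) r : 0 <= r -> delta' < delta ->
  (forall k, cmod (a k) <= r * (1 + 2 * pi * `|k%:~R|)) ->
  wbnd delta c M -> wbnd delta' (fun k => a k * c k) (r * (1 + (delta - delta')^-1) * M).
Proof.
move=> r0 dd ar cM; set e := delta - delta'.
have e0 : 0 < e by rewrite subr_gt0.
have : wbnd delta (fun k => (r * (1 + e^-1))%:C%C * c k) (r * (1 + e^-1) * M).
  apply: (@wbndZ _ _ _ (fun=> (r * (1 + e^-1))%:C%C)) => // [|_].
    by rewrite mulr_ge0// addr_ge0// invr_ge0 ltW.
  by rewrite cmodR ger0_norm// mulr_ge0// addr_ge0// invr_ge0 ltW.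
apply: abnd_mono => k; rewrite !cmod_wt !cmodM cmodR ger0_norm; last first.
  by rewrite mulr_ge0// addr_ge0// invr_ge0 ltW.
rewrite !mulrA ler_wpM2r ?cmod_ge0//.
have -> : wt delta k = wt delta' k * wt e k.
  by rewrite -expRD -mulrDl -mulrDr [delta' + _]addrC subrK.
rewrite -!mulrA ler_wpM2l ?wt_ge0//.
apply: (le_trans (ar k)); rewrite [leRHS]mulrCA ler_wpM2l//.
set x := `|k%:~R|; have p0 := pi_ge0 R.
have x0 : 0 <= 2 * pi * x by rewrite /x !mulr_ge0.
have h1 : 1 <= wt e k by rewrite wt_ge1// ltW.
have h2 : e * (2 * pi * x) <= wt e k.
  rewrite /wt -/x (_ : e * _ = 2 * pi * e * x); last by ring.
  by rewrite (le_trans _ (expR_ge1Dx _))// lerDr.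
rewrite [leRHS]mulrDr mulr1 lerD// -ler_pdivrMr ?invr_gt0// invrK.
by rewrite mulrC.
Qed.

Definition conv_fam c d k j := c j * d (k - j).

Lemma shear_inj : injective (fun p : int * int => (p.2, p.1 - p.2)).
Proof. by move=> [k j] [k' j'] /= [-> /eqP]; rewrite -subr_eq0 opprB addrA subrK subr_eq0 => /eqP ->. Qed.

(** The family of the convolution is a shear of a product family. *)
Lemma abnd_conv_fam c d M N : abnd c M -> abnd d N ->
  abnd (fun p : int * int => conv_fam c d p.1 p.2) (M * N).
Proof. by move=> cM dN; exact: (abnd_inj shear_inj (abnd_prod cM dN)). Qed.

Lemma abnd_conv_row c d M N k : abnd c M -> abnd d N ->
  abnd (fun j => c j * d (k - j)) (M * N).
Proof. by move=> cM dN; exact: (abnd_row k (abnd_conv_fam cM dN)). Qed.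

Lemma wbnd_conv delta c d M N : 0 <= delta -> wbnd delta c M -> wbnd delta d N ->
  wbnd delta (conv c d) (M * N).
Proof.
move=> d0 cM dN.
have h := abnd_conv_fam cM dN.
have h' : abnd (fun p : int * int => (wt delta p.1)%:C%C * (c p.2 * d (p.1 - p.2))) (M * N).
  apply: abnd_mono h => -[k j] /=; rewrite /conv_fam cmod_wt !cmodM.
  rewrite !cmodR !ger0_norm ?wt_ge0// mulrACA ler_wpM2r ?mulr_ge0 ?cmod_ge0//.
  exact: wt_sub.
have := abnd_csum_row h'; rewrite /wbnd; congr abnd; apply/funext => k /=.
rewrite (@csumZ _ _ _ (M * N))//.
exact: (abnd_conv_row k (wbnd_abnd d0 cM) (wbnd_abnd d0 dN)).
Qed.

Lemma convBl c c' d M M' N : abnd c M -> abnd c' M' -> abnd d N ->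
  conv (fun k => c k - c' k) d = fun k => conv c d k - conv c' d k.
Proof.
move=> cM cM' dN; apply/funext => k; rewrite /conv.
rewrite -(csumB (abnd_conv_row k cM dN) (abnd_conv_row k cM' dN)).
by apply: eq_csum => j; rewrite mulrBl.
Qed.

Lemma convBr c d d' M N N' : abnd c M -> abnd d N -> abnd d' N' ->
  conv c (fun k => d k - d' k) = fun k => conv c d k - conv c d' k.
Proof.
move=> cM dN dN'; apply/funext => k; rewrite /conv.
rewrite -(csumB (abnd_conv_row k cM dN) (abnd_conv_row k cM dN')).
by apply: eq_csum => j; rewrite mulrBr.
Qed.

Lemma convZZ c d M N (a b : R[i]) : abnd c M -> abnd d N ->
  conv (fun k => a * c k) (fun k => b * d k) = fun k => a * b * conv c d k.
Proof.
move=> cM dN; apply/funext => k; rewrite /conv.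
rewrite -(csumZ (a * b) (abnd_conv_row k cM dN)).
by apply: eq_csum => j; rewrite mulrACA.
Qed.

(** Formal power series (in an auxiliary variable) of sequences, with the
   product of series of convolutions; [tot] evaluates the variable at 1. *)
Definition fconv (u v : nat -> int -> R[i]) n k : R[i] :=
  \sum_(i < n.+1) conv (u i) (v (n - i)%N) k.

Definition tot (u : nat -> int -> R[i]) k : R[i] := csum (fun n => u n k).

Definition fbnd delta (u : nat -> int -> R[i]) (A : R) : Prop :=
  exists2 a, (forall n, wbnd delta (u n) (a n)) & nhs a A.

Lemma fbnd_pair delta u A : fbnd delta u A ->
  abnd (fun p : nat * int => (wt delta p.2)%:C%C * u p.1 p.2) A.
Proof.
move=> [a ua aA].
exact: (@abnd_pairI _ _ _ (fun n k => (wt delta k)%:C%C * u n k) a).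
Qed.

Lemma fbnd_pair0 delta u A : 0 <= delta -> fbnd delta u A ->
  abnd (fun p : nat * int => u p.1 p.2) A.
Proof.
move=> d0 /fbnd_pair; apply: abnd_mono => -[n k] /=; rewrite cmod_wt.
by rewrite ler_peMl ?cmod_ge0// wt_ge1.
Qed.

Lemma abnd_col (I J : choiceType) (f : I * J -> R[i]) M (j : J) : abnd f M ->
  abnd (fun i => f (i, j)) M.
Proof. by move=> fM; apply: (abnd_inj _ fM) => ? ? []. Qed.

Lemma wbnd_tot delta u A : 0 <= delta -> fbnd delta u A -> wbnd delta (tot u) A.
Proof.
move=> d0 uA.
have h := abnd_csum_row (abnd_bij (swap_bij _ _) (fbnd_pair uA)).
rewrite /wbnd; move: h; congr abnd; apply/funext => k /=.
by rewrite (csumZ _ (abnd_col k (fbnd_pair0 d0 uA))).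
Qed.

Lemma fbnd_fconv delta u v A B : 0 <= delta -> fbnd delta u A -> fbnd delta v B ->
  fbnd delta (fconv u v) (A * B).
Proof.
move=> d0 [a ua aA] [b vb bB].
exists (fun n => \sum_(i < n.+1) a i * b (n - i)%N); last exact: nhs_cauchy.
by move=> n; apply: wbnd_sum => i; exact: wbnd_conv.
Qed.

(** Cauchy products in the formal variable and convolutions in k are both
   rearrangements of one absolutely summable family. *)
Lemma tot_fconv delta u v A B : 0 <= delta -> fbnd delta u A -> fbnd delta v B ->
  tot (fconv u v) = conv (tot u) (tot v).
Proof.
move=> d0 uA vB; apply/funext => k.
have u0 := fbnd_pair0 d0 uA; have v0 := fbnd_pair0 d0 vB.
have big : abnd (fun p : nat * nat * int => u p.1.1 p.2 * v p.1.2 (k - p.2)) (A * B).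
  apply: (abnd_inj (e := fun p : nat * nat * int => ((p.1.1, p.2), (p.1.2, k - p.2)))
    _ (abnd_prod u0 v0)).
  by move=> [[i m] j] [[i' m'] j'] [-> -> -> _].
have big2 := abnd_csum_row big.
rewrite /tot /fconv /conv (@csum_cauchy _
  (fun i m => csum (fun j => u i j * v m (k - j))) _ big2).
rewrite (@csum_swap _ _ _ (fun (p : nat * nat) j => u p.1 j * v p.2 (k - j)) _ big).
apply: eq_csum => j.
rewrite (csum_pair (abnd_col j big)) /=.
under eq_csum => i do rewrite (csumZ _ (abnd_col (k - j) v0)) mulrC.
by rewrite (csumZ _ (abnd_col j u0)) mulrC.
Qed.

End WienerAlgebra.

(** * Elementary estimates *)

Section Elementary.
Context {R : realType}.

Definition invsq (n : nat) : R := (n.+1%:R ^+ 2)^-1.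

Lemma invsq_gt0 n : 0 < invsq n.
Proof. by rewrite invr_gt0 exprn_gt0. Qed.

Lemma invsq_ge0 n : 0 <= invsq n.
Proof. exact/ltW/invsq_gt0. Qed.

Lemma sum_invsq n : \sum_(i < n.+1) invsq i <= 2 - n.+1%:R^-1.
Proof.
elim: n => [|n IH].
  by rewrite big_ord1 /invsq expr1n invr1; lra.
rewrite big_ord_recr/=; apply: (le_trans (lerD IH (lexx _))).
have n0 : 0 < n.+1%:R :> R by rewrite ltr0n.
rewrite /invsq -(natr1 n.+1).
set x : R := n.+1%:R in n0 *.
have -> : x^-1 = (x + 1)^-1 + (x * (x + 1))^-1.
  by field; rewrite !gt_eqF//; lra.
have : ((x + 1) ^+ 2)^-1 <= (x * (x + 1))^-1.
  have x1 : 0 < x + 1 by lra.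
  by rewrite lef_pV2 ?posrE ?exprn_gt0 ?mulr_gt0// expr2 ler_pM2r//; lra.
move: (_^-1) (_^-1) (_^-1) => p q r.
by lra.
Qed.

(** The factor 1 / (n + 1)^2 is stable under Cauchy products up to a constant:
   1 / (a b) = (1 / a + 1 / b) / (a + b) with a + b = n + 2, so no logarithm
   or power of n is lost. *)
Lemma invsq_cauchy n :
  \sum_(i < n.+1) invsq i * invsq (n - i)%N <= 8 * invsq n.
Proof.
have n0 : 0 < n.+2%:R :> R by rewrite ltr0n.
apply: (@le_trans _ _ (\sum_(i < n.+1)
    2 * (invsq i + invsq (n - i)%N) * (n.+2%:R ^+ 2)^-1)).
  apply: ler_sum => i _.
  have e : n.+2%:R = i.+1%:R + (n - i).+1%:R :> R.
    by rewrite -natrD addSn addnS subnKC// -ltnS.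
  rewrite e /invsq; set a : R := i.+1%:R; set b : R := (n - i).+1%:R.
  have a0 : 0 < a by rewrite ltr0n. have b0 : 0 < b by rewrite ltr0n.
  have -> : (a ^+ 2)^-1 * (b ^+ 2)^-1 = (a^-1 + b^-1) ^+ 2 * ((a + b) ^+ 2)^-1.
    by field; rewrite !gt_eqF// addr_gt0.
  rewrite ler_wpM2r ?invr_ge0 ?exprn_ge0 ?addr_ge0 ?(ltW a0) ?(ltW b0)//.
  rewrite -!exprVn; move: (a^-1) (b^-1) => p q.
  by have := sqr_ge0 (p - q); rewrite sqrrB sqrrD !mulr2n; lra.
rewrite -mulr_suml -mulr_sumr big_split/=.
have -> : \sum_(i < n.+1) invsq (n - i) = \sum_(i < n.+1) invsq i.
  rewrite (reindex_inj rev_ord_inj)/=; apply: eq_bigr => i _.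
  by rewrite subKn// -ltnS.
have h : \sum_(i < n.+1) invsq i <= 2.
  by rewrite (le_trans (sum_invsq n))// gerBl invr_ge0.
apply: (@le_trans _ _ (8 * (n.+2%:R ^+ 2)^-1)).
  by rewrite ler_wpM2r ?invr_ge0 ?exprn_ge0//; lra.
rewrite ler_wpM2l// lef_pV2 ?posrE ?exprn_gt0 ?ltr0n//.
by rewrite lerXn2r ?nnegrE// ler_nat.
Qed.

Lemma succ_ratio_pow n : (n.+2%:R / n.+1%:R) ^+ n <= expR 1 :> R.
Proof.
have n0 : 0 < n.+1%:R :> R by rewrite ltr0n.
apply: (@le_trans _ _ (expR (n.+1%:R^-1) ^+ n)).
  rewrite lerXn2r ?nnegrE ?expR_ge0 ?divr_ge0//.
  apply: le_trans (expR_ge1Dx _).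
  by rewrite -(natr1 n.+1) mulrDl divff ?gt_eqF// mul1r.
rewrite -expRM_natl ler_expR ler_pdivrMr// mul1r ler_nat.
exact: leqnSn.
Qed.

Lemma nhs_geo (q : R) : 0 <= q < 1 -> nhs (fun n : nat => q ^+ n) (1 - q)^-1.
Proof.
move=> /andP[q0 q1]; split; first by move=> n; exact: exprn_ge0.
rewrite -nneseries_esumT; last by move=> n; rewrite lee_fin exprn_ge0.
have := @cvg_geometric_series R 1 q; rewrite ger0_norm// => /(_ q1) h.
apply/cvg_lim => //.
rewrite (_ : (fun n => _) = EFin \o series (geometric 1 q)).
  by apply: cvg_EFin; [exact: nearW|rewrite -(div1r (1 - q)); exact: h].
apply/funext => n /=; rewrite sumEFin; congr (_%:E).
by apply: eq_bigr => i _; rewrite /geometric/= mul1r.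
Qed.

(** The equation for the Taylor coefficient n + 1 involves all the previous ones. *)
Lemma causal_rec (V : Type) (G : nat -> (nat -> V) -> V) (a : V) :
  (forall n f g, (forall m, (m <= n)%N -> f m = g m) -> G n f = G n g) ->
  exists f : nat -> V, f 0%N = a /\ forall n, f n.+1 = G n f.
Proof.
move=> GE.
pose step F n := if n is m.+1 then G m F else a.
pose X N := iter N step (fun=> a).
have XE N M n : (n < N)%N -> (n < M)%N -> X N n = X M n.
  elim: N M n => // N IH [//|M] [//|n] nN nM /=.
  by apply: GE => m mn; apply: IH; [exact: leq_ltn_trans mn nN|exact: leq_ltn_trans mn nM].
exists (fun n => X n.+1 n); split => // n.
have -> : X n.+2 n.+1 = G n (X n.+1) by [].
by apply: GE => m mn; apply: XE.
Qed.

End Elementary.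

(** * Taylor coefficients of the solution of a cubic system *)

Section CubicSystem.
Context {R : realType} (I : finType).
Variables (al : I -> I * I * I -> int -> R[i]) (be : I -> int -> R[i]).
Variables (C0 g0 : R).
Hypothesis C0_ge0 : 0 <= C0.
Hypothesis g0_ge0 : 0 <= g0.
Hypothesis alP : forall i p k, cmod (al i p k) <= C0 * (1 + 2 * pi * `|k%:~R|).
Hypothesis beP : forall i k, cmod (be i k) <= g0.

Definition conv3 (c d e : int -> R[i]) := conv (conv c d) e.
Definition fconv3 (u v w : nat -> int -> R[i]) := fconv (fconv u v) w.

(** The multipliers al may grow like |k|, as those of first order operators do,
   while the multipliers be are bounded. *)
Definition rhs (x : I -> int -> R[i]) i k : R[i] :=
  \sum_(p : I * I * I) al i p k * conv3 (x p.1.1) (x p.1.2) (x p.2) k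
  + be i k * x i k.

(** The same vector field on formal power series in time, n being the power. *)
Definition frhs (x : I -> nat -> int -> R[i]) i n k : R[i] :=
  \sum_(p : I * I * I) al i p k * fconv3 (x p.1.1) (x p.1.2) (x p.2) n k
  + be i k * x i n k.

Definition ntriples : R := #|{: I * I * I}|%:R.

Lemma ntriples_ge0 : 0 <= ntriples.
Proof. exact: ler0n. Qed.

Lemma wbnd_multipliers delta delta' (c : I * I * I -> int -> R[i])
    (y : int -> R[i]) i M N : delta' < delta -> 0 <= N ->
  (forall p, wbnd delta (c p) M) -> wbnd delta y N ->
  wbnd delta' (fun k => \sum_(p : I * I * I) al i p k * c p k + be i k * y k)
    (ntriples * (C0 * (1 + (delta - delta')^-1) * M) + g0 * N).
Proof.
move=> dd N0 cM yN; apply: wbndD; last first.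
  by apply: wbndZ => //; exact: wbnd_wt (ltW dd) yN.
rewrite /ntriples (_ : _ * (C0 * _ * M) =
  \sum_(p : I * I * I) (C0 * (1 + (delta - delta')^-1) * M)).
  by apply: wbnd_sum => p; exact: wbnd_loss.
by rewrite sumr_const mulr_natl.
Qed.

Lemma wbnd_conv3 (delta : R) c d e M : 0 <= delta ->
  wbnd delta c M -> wbnd delta d M -> wbnd delta e M ->
  wbnd delta (conv3 c d e) (M ^+ 3).
Proof.
move=> d0 cM dM eM; rewrite exprSr expr2.
by apply: wbnd_conv => //; exact: wbnd_conv.
Qed.

Lemma wbnd_fconv (delta : R) u v a b n : 0 <= delta ->
  (forall m, (m <= n)%N -> wbnd delta (u m) (a m)) ->
  (forall m, (m <= n)%N -> wbnd delta (v m) (b m)) ->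
  wbnd delta (fconv u v n) (\sum_(i < n.+1) a i * b (n - i)%N).
Proof.
move=> d0 ua vb; apply: wbnd_sum => i; apply: wbnd_conv => //.
- by apply: ua; rewrite -ltnS.
- by apply: vb; exact: leq_subr.
Qed.

(** Coefficients of size [A q^n / (n + 1)^2] keep this form under triple
   products, with [A] replaced by a multiple of [A^3]. *)
Lemma wbnd_fconv3 (delta : R) u v w A q n : 0 <= delta -> 0 <= A -> 0 <= q ->
  (forall m, (m <= n)%N -> wbnd delta (u m) (A * invsq m * q ^+ m)) ->
  (forall m, (m <= n)%N -> wbnd delta (v m) (A * invsq m * q ^+ m)) ->
  (forall m, (m <= n)%N -> wbnd delta (w m) (A * invsq m * q ^+ m)) ->
  wbnd delta (fconv3 u v w n) (64 * A ^+ 3 * invsq n * q ^+ n).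
Proof.
move=> d0 A0 q0 hu hv hw.
have step (f g : nat -> int -> R[i]) B D m : 0 <= B -> 0 <= D ->
    (forall l, (l <= m)%N -> wbnd delta (f l) (B * invsq l * q ^+ l)) ->
    (forall l, (l <= m)%N -> wbnd delta (g l) (D * invsq l * q ^+ l)) ->
    wbnd delta (fconv f g m) (8 * (B * D) * invsq m * q ^+ m).
  move=> B0 D0 fB gD; apply: wbnd_le (wbnd_fconv d0 fB gD).
  rewrite (eq_bigr (fun i : 'I_m.+1 => (B * D * q ^+ m) * (invsq i * invsq (m - i)%N))).
    rewrite -mulr_sumr (_ : 8 * _ * _ * _ = B * D * q ^+ m * (8 * invsq m)); last by ring.
    by rewrite ler_wpM2l ?invsq_cauchy// !mulr_ge0// exprn_ge0.
  move=> i _; have im : (i <= m)%N by rewrite -ltnS.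
  have -> : q ^+ m = q ^+ i * q ^+ (m - i) by rewrite -exprD subnKC.
  by ring.
have h := step _ _ A A _ A0 A0.
have -> : 64 * A ^+ 3 = 8 * (8 * (A * A) * A) by ring.
apply: step => //; first by rewrite !mulr_ge0.
move=> m mn; apply: h => l lm; [apply: hu|apply: hv]; exact: leq_trans lm mn.
Qed.

Section Taylor.
Variables (a : I -> int -> R[i]) (A Delta T : R).
Hypothesis Delta_gt0 : 0 < Delta.
Hypothesis T_gt0 : 0 < T.
Hypothesis aA : forall i, wbnd Delta (a i) A.

(** The choice of the lifespan T: the inverse of a quadratic expression in the
   size A of the data, plus a multiple of the size of the linear part. The
   numerical factors are those of the induction step below. *)
Definition smallness := T * (8 * expR 1 *
  (64 * (ntriples * C0 * (1 + Delta^-1)) * A ^+ 2 + g0)) <= 1.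

Hypothesis TP : smallness.
Hypothesis A_ge0 : 0 <= A.

(** The width lost between the scales d' and d is proportional to
   (1 - d) / (n + 2), so the order one multipliers cost (n + 2) / (1 - d): the
   first factor is compensated by the n + 1 of the recursion, the second by the
   extra power of (T (1 - d))^-1. Changing d' into d in the powers costs only
   ((n + 2) / (n + 1))^n <= e. *)
Lemma taylor_step d d' n : 0 < d < 1 -> d' = d + (1 - d) / n.+2%:R ->
  ntriples * (C0 * (1 + (Delta * d' - Delta * d)^-1) *
    (64 * A ^+ 3 * invsq n * (T * (1 - d'))^-1 ^+ n)) +
  g0 * (A * invsq n * (T * (1 - d'))^-1 ^+ n)
  <= n.+1%:R * (A * invsq n.+1 * (T * (1 - d))^-1 ^+ n.+1).
Proof.
move=> /andP[d0 d1] d'def.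
have n1 : 0 < n.+1%:R :> R by rewrite ltr0n.
have n2 : 0 < n.+2%:R :> R by rewrite ltr0n.
have e0 : 0 < 1 - d by rewrite subr_gt0.
have K0 : 0 <= ntriples * C0 by rewrite mulr_ge0// ntriples_ge0.
set q := (T * (1 - d))^-1.
have q0 : 0 < q by rewrite invr_gt0 mulr_gt0.
have d'E : 1 - d' = (1 - d) * (n.+1%:R / n.+2%:R).
  rewrite d'def -(natr1 n.+1); move: n1; set x : R := n.+1%:R => x0.
  by field; apply: lt0r_neq0; lra.
have qn : (T * (1 - d'))^-1 ^+ n <= expR 1 * q ^+ n.
  have -> : (T * (1 - d'))^-1 = n.+2%:R / n.+1%:R * q.
    by rewrite d'E /q; field; rewrite !gt_eqF.
  by rewrite exprMn ler_wpM2r ?succ_ratio_pow// exprn_ge0// ltW.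
have qn0 : 0 <= (T * (1 - d'))^-1 ^+ n.
  by rewrite exprn_ge0// invr_ge0 mulr_ge0 ?(ltW T_gt0)// d'E mulr_ge0 ?(ltW e0)// divr_ge0.
have gap : 1 + (Delta * d' - Delta * d)^-1 <= (1 + Delta^-1) * n.+2%:R / (1 - d).
  have -> : Delta * d' - Delta * d = Delta * (1 - d) / n.+2%:R.
    by rewrite d'def; field; rewrite gt_eqF.
  have -> : (Delta * (1 - d) / n.+2%:R)^-1 = Delta^-1 * n.+2%:R / (1 - d).
    by field; rewrite !gt_eqF.
  rewrite mulrDl mulrDl mul1r lerD2r ler_pdivlMr// mul1r.
  by apply: (@le_trans _ _ 1); [lra|rewrite ler1n].
set Q := (T * (1 - d'))^-1 ^+ n in qn qn0 *.
have i0 : 0 <= invsq n :> R := invsq_ge0 n.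
have G0 : 0 <= (1 + Delta^-1) * n.+2%:R / (1 - d).
  by rewrite divr_ge0 ?mulr_ge0 ?(ltW e0)// addr_ge0// invr_ge0 ltW.
pose Z := 64 * (ntriples * C0 * (1 + Delta^-1)) * A ^+ 2 + g0.
have Di0 : 0 <= Delta^-1 by rewrite invr_ge0 ltW.
have Z0 : 0 <= Z by rewrite /Z addr_ge0// !mulr_ge0 ?ntriples_ge0 ?exprn_ge0 ?addr_ge0.
apply: (@le_trans _ _ (Z * (n.+2%:R / (1 - d)) * (A * invsq n) * (expR 1 * q ^+ n))).
  apply: (@le_trans _ _ (Z * (n.+2%:R / (1 - d)) * (A * invsq n) * Q)); last first.
    by rewrite ler_wpM2l// !mulr_ge0 ?invr_ge0 ?(ltW e0).
  rewrite [X in _ <= X](_ : _ = ntriples * C0 * ((1 + Delta^-1) * n.+2%:R / (1 - d)) *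
      (64 * A ^+ 3 * invsq n * Q) + g0 * (n.+2%:R / (1 - d)) * (A * invsq n * Q)); last first.
    by rewrite /Z; ring.
  apply: lerD.
    rewrite [leLHS]mulrA [X in X * _ <= _]mulrA.
    have A3 : 0 <= A ^+ 3 by exact: exprn_ge0.
    rewrite ler_wpM2r//; first by do ?[apply: mulr_ge0 => //].
    by rewrite ler_wpM2l.
  rewrite ler_wpM2r ?mulr_ge0// ler_peMr// ler_pdivlMr// mul1r.
  by apply: (@le_trans _ _ 1); [lra|rewrite ler1n].
rewrite [q ^+ n.+1]exprS.
rewrite (_ : Z * _ * _ * _ = (Z * expR 1 * n.+2%:R / (1 - d) * invsq n) * (A * q ^+ n)); last by ring.
rewrite (_ : _ * (A * _ * _) = (n.+1%:R * invsq n.+1 * q) * (A * q ^+ n)); last by ring.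
rewrite ler_wpM2r//; first by rewrite mulr_ge0// exprn_ge0// ltW.
rewrite /q invfM.
have -> : Z * expR 1 * n.+2%:R / (1 - d) * invsq n = Z * expR 1 * (n.+2%:R * invsq n) / (1 - d).
  by ring.
rewrite !mulrA ler_wpM2r ?invr_ge0 ?(ltW e0)// ler_pdivlMr//.
(* It remains to replace n by n + 1 in the weights, as (x + 1)^3 <= (2 x)^3 for
   x = n + 1. *)
have w3 : n.+2%:R * invsq n <= 8 * (n.+1%:R * invsq n.+1) :> R.
  rewrite /invsq; set x : R := n.+1%:R in n1 *.
  have -> : n.+2%:R = x + 1 :> R by rewrite -(natr1 n.+1).
  rewrite [leRHS](_ : _ = 8 * x ^+ 3 / (x + 1) ^+ 2 / x ^+ 2); last first.
    by field; rewrite !lt0r_neq0//; lra.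
  have x1 : 1 <= x by rewrite ler1n.
  rewrite ler_wpM2r ?invr_ge0 ?exprn_ge0 ?(ltW n1)//.
  rewrite ler_pdivlMr ?exprn_gt0//; last by lra.
  have -> : (x + 1) * (x + 1) ^+ 2 = (x + 1) ^+ 3 by ring.
  have -> : 8 * x ^+ 3 = (2 * x) ^+ 3 by ring.
  by rewrite lerXn2r ?nnegrE//; lra.
have c0 : 0 <= Z * expR 1 * T by rewrite !mulr_ge0 ?expR_ge0 ?(ltW T_gt0).
rewrite (_ : _ * T = (Z * expR 1 * T) * (n.+2%:R * invsq n)); last by ring.
apply: (le_trans (ler_wpM2l c0 w3)).
rewrite [leLHS]mulrA ler_piMl ?mulr_ge0 ?invsq_ge0//.
move: TP; rewrite /smallness -/Z; congr (_ <= _); ring.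
Qed.

(** The bounds hold for all scales d in ]0, 1[ at once, because the induction on
   n passes from d to a larger scale; they degenerate as d tends to 1. *)
Definition taylor_sol (x : I -> nat -> int -> R[i]) : Prop :=
  [/\ forall i, x i 0%N = a i,
      forall i n k, n.+1%:R * x i n.+1 k = frhs x i n k &
      forall d n i, 0 < d < 1 ->
        wbnd (Delta * d) (x i n) (A * invsq n * (T * (1 - d))^-1 ^+ n)].

Lemma taylor_exists : exists x, taylor_sol x.
Proof.
pose G n (f : nat -> I -> int -> R[i]) : I -> int -> R[i] :=
  fun i k => n.+1%:R^-1 * frhs (fun j m => f m j) i n k.
have [|f [f0 fS]] := @causal_rec _ G a.
  move=> n f g fg; apply/funext => i; apply/funext => k; rewrite /G; congr (_ * _).
  rewrite /frhs fg//; congr (_ + _); apply: eq_bigr => p _; congr (_ * _).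
  rewrite /fconv3 /fconv; apply: eq_bigr => j _.
  have jn : (j <= n)%N by rewrite -ltnS.
  rewrite fg ?leq_subr//; congr conv; apply/funext => l.
  apply: eq_bigr => m _; have mj : (m <= j)%N by rewrite -ltnS.
  by rewrite !fg// (leq_trans _ jn)// leq_subr.
exists (fun i n => f n i).
have rec i n k : n.+1%:R * f n.+1 i k = frhs (fun i n => f n i) i n k.
  by rewrite fS /G mulrA mulfV ?mul1r// pnatr_eq0.
split=> // [i|d n i hd]; first by rewrite f0.
elim/ltn_ind: n d i hd => -[|n] IH d i /andP[d0 d1].
  rewrite f0 expr0 mulr1 /invsq expr1n invr1 mulr1.
  by apply: wbnd_wt (aA i); rewrite ler_piMr// ltW.
set d' := d + (1 - d) / n.+2%:R.
have n2 : 0 < n.+2%:R :> R by rewrite ltr0n.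
have hd' : d < d' < 1.
  apply/andP; split; first by rewrite ltrDl divr_gt0// subr_gt0.
  rewrite /d' -ltrBrDl ltr_pdivrMr// ltr_pMr ?subr_gt0// ltr1n//.
have d'0 : 0 < d' < 1 by case/andP: hd' => h ->; rewrite (lt_trans d0 h).
have DD : Delta * d < Delta * d' by rewrite ltr_pM2l//; case/andP: hd'.
have Dd0 : 0 <= Delta * d' by rewrite mulr_ge0 ?(ltW Delta_gt0)// ltW//; case/andP: d'0.
have q0 : 0 <= (T * (1 - d'))^-1.
  by rewrite invr_ge0 mulr_ge0 ?(ltW T_gt0)// subr_ge0 ltW//; case/andP: d'0.
have IHn m j : (m <= n)%N ->
    wbnd (Delta * d') (f m j) (A * invsq m * (T * (1 - d'))^-1 ^+ m).
  by move=> mn; apply: IH.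
have h : wbnd (Delta * d) (frhs (fun i n => f n i) i n)
    (n.+1%:R * (A * invsq n.+1 * (T * (1 - d))^-1 ^+ n.+1)).
  have dd : 0 < d < 1 by rewrite d0.
  apply: wbnd_le (taylor_step dd erefl) _.
  apply: (wbnd_multipliers (c := fun p => fconv3 (fun m => f m p.1.1) (fun m => f m p.1.2)
     (fun m => f m p.2) n)) => //.
  - by rewrite !mulr_ge0 ?invsq_ge0 ?exprn_ge0.
  - by move=> p; apply: wbnd_fconv3 => // m mn; exact: IHn.
  - exact: IHn.
have i0 : 0 <= n.+1%:R^-1 :> R by rewrite invr_ge0 ler0n.
have hn (k : int) : cmod ((fun=> n.+1%:R^-1 : R[i]) k) <= n.+1%:R^-1.
  by rewrite cmodV cmod_nat.
have := wbndZ i0 hn h; rewrite [X in wbnd _ _ X]mulrA mulVf ?mul1r ?pnatr_eq0//.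
by apply: eq_wbnd => k; rewrite -rec mulrA mulVf ?mul1r// pnatr_eq0.
Qed.

End Taylor.

End CubicSystem.

(** * The sum of the Taylor series *)

Section CubicSolution.
Context {R : realType} (I : finType).
Variables (al : I -> I * I * I -> int -> R[i]) (be : I -> int -> R[i]).

Lemma csum_shift (f : nat -> R[i]) M : abnd f M -> f 0%N = 0 ->
  csum f = csum (fun n => f n.+1).
Proof.
move=> fM f0; apply: csumE; apply: (@chs_inj _ _ _ S); first by move=> ? ? [].
  by case=> // n /(_ n).
by apply: (@abnd_chs _ _ _ M); apply: (abnd_inj _ fM) => ? ? [].
Qed.

Lemma abnd_shift (f : nat -> R[i]) M : f 0%N = 0 ->
  abnd (fun n => f n.+1) M -> abnd f M.
Proof.
move=> f0 /abndP[B fB BM]; apply/abndP; exists B => //.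
apply: (@nhs_inj _ _ _ S) fB; first by move=> ? ? [].
- by move=> n; exact: cmod_ge0.
- by case=> [|n /(_ n)//]; rewrite f0 cmod0.
Qed.

(** Summability of each coefficient in k, without any control in n: enough for
   the algebra of formal series. *)
Definition ffin (u : nat -> int -> R[i]) := forall n, exists M, abnd (u n) M.

Lemma ffin_fconv u v : ffin u -> ffin v -> ffin (fconv u v).
Proof.
move=> /choice[a ua] /choice[b vb] n.
have w0 (c : int -> R[i]) M : abnd c M -> wbnd 0 c M.
  by apply: abnd_mono => k; rewrite cmod_wt /wt mulr0 mul0r expR0 mul1r.
exists (\sum_(i < n.+1) a i * b (n - i)%N); apply: (@wbnd_abnd _ 0) => //.
by apply: wbnd_sum => i; apply: wbnd_conv => //; exact: w0.
Qed.

Definition fscale t (u : nat -> int -> R[i]) n k := t ^+ n * u n k.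

Lemma fconv_scale t u v : ffin u -> ffin v ->
  fconv (fscale t u) (fscale t v) = fscale t (fconv u v).
Proof.
move=> uf vf; apply/funext => n; apply/funext => k.
rewrite /fconv /fscale mulr_sumr; apply: eq_bigr => i _.
have [M uM] := uf i; have [N vN] := vf (n - i)%N.
by rewrite (convZZ _ _ uM vN) -exprD subnKC// -ltnS.
Qed.

Lemma frhs_scale t (x : I -> nat -> int -> R[i]) i n k : (forall j, ffin (x j)) ->
  frhs al be (fun j => fscale t (x j)) i n k = t ^+ n * frhs al be x i n k.
Proof.
move=> xf; rewrite /frhs mulrDr; congr (_ + _); last by rewrite /fscale mulrCA.
rewrite mulr_sumr; apply: eq_bigr => p _.
by rewrite /fconv3 !fconv_scale//; [rewrite /fscale mulrCA|exact: ffin_fconv].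
Qed.

Lemma tot_frhs delta (x : I -> nat -> int -> R[i]) M i k : 0 <= delta ->
  (forall j, fbnd delta (x j) M) ->
  tot (frhs al be x i) k = rhs al be (fun j => tot (x j)) i k /\
  exists N, abnd (fun n => frhs al be x i n k) N.
Proof.
move=> d0 xM.
have tri p : fbnd delta (fconv3 (x p.1.1) (x p.1.2) (x p.2)) (M * M * M).
  by apply: fbnd_fconv => //; exact: fbnd_fconv.
have col u N : fbnd delta u N -> abnd (fun n => u n k) N.
  by move=> uN; exact: (abnd_col k (fbnd_pair0 d0 uN)).
have h1 p : abnd (fun n => al i p k * fconv3 (x p.1.1) (x p.1.2) (x p.2) n k)
    (cmod (al i p k) * (M * M * M)).
  by apply: abndZ => //; exact: (col _ _ (tri p)).
have h2 : abnd (fun n => be i k * x i n k) (cmod (be i k) * M).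
  by apply: abndZ => //; exact: col.
have [h3 h4] := csum_sum (index_enum ((I * I * I)%type : finType)) h1.
split; last by exists (\sum_p cmod (al i p k) * (M * M * M) + cmod (be i k) * M); exact: abndD.
rewrite /tot /frhs (csumD h4 h2) /rhs h3; congr (_ + _).
  apply: eq_bigr => p _; rewrite (csumZ _ (col _ _ (tri p))).
  rewrite /conv3 -(tot_fconv d0 (xM p.1.1) (xM p.1.2)).
  by rewrite -(tot_fconv d0 (fbnd_fconv d0 (xM p.1.1) (xM p.1.2)) (xM p.2)).
by rewrite (csumZ _ (col _ _ (xM i))).
Qed.

Variables (a : I -> int -> R[i]) (A Delta T : R).
Hypothesis Delta_gt0 : 0 < Delta.
Hypothesis T_gt0 : 0 < T.
Hypothesis A_ge0 : 0 <= A.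
Variable x : I -> nat -> int -> R[i].
Hypothesis xP : taylor_sol al be a A Delta T x.

Definition evalt t i := tot (fscale t (x i)).

Lemma invsq_le1 n : invsq n <= 1 :> R.
Proof. by rewrite invr_le1 ?unitfE ?expf_neq0 ?pnatr_eq0 ?exprn_gt0// exprn_ege1// ler1n. Qed.

Lemma radius_gt0 d : 0 < d < 1 -> 0 < T * (1 - d).
Proof. by move=> /andP[_ d1]; rewrite mulr_gt0// subr_gt0. Qed.

Lemma fbnd_fscale t d i : 0 < d < 1 -> cmod t < T * (1 - d) ->
  fbnd (Delta * d) (fscale t (x i)) (A * (1 - cmod t / (T * (1 - d)))^-1).
Proof.
move=> hd ht; have r0 := radius_gt0 hd; case: xP => _ _ xb.
set q := cmod t / _.
have q0 : 0 <= q by rewrite divr_ge0 ?cmod_ge0 ?(ltW r0).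
have q1 : q < 1 by rewrite ltr_pdivrMr// mul1r.
exists (fun n => A * q ^+ n); last by apply: nhsZ => //; apply: nhs_geo; rewrite q0.
move=> n; rewrite /fscale.
have tn : forall k : int, cmod ((fun=> t ^+ n) k) <= cmod t ^+ n by move=> _; rewrite cmodX.
apply: wbnd_le (wbndZ _ tn (xb d n i hd)); last exact: exprn_ge0 (cmod_ge0 _).
rewrite /q expr_div_n exprVn; set rn := (_ ^+ n)^-1.
rewrite [leLHS](_ : _ = A * (cmod t ^+ n * rn) * invsq n); last by ring.
rewrite ler_piMr ?invsq_le1//.
by rewrite !mulr_ge0 ?invr_ge0 ?exprn_ge0 ?cmod_ge0// ltW.
Qed.

Lemma ffin_x j : ffin (x j).
Proof.
move=> n; case: xP => _ _ xb.
have h : 0 < (2^-1 : R) < 1 by apply/andP; split; lra.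
eexists; apply: (wbnd_abnd _ (xb _ n j h)).
by rewrite mulr_ge0 ?(ltW Delta_gt0)//; lra.
Qed.

Lemma evalt0 i : evalt 0 i = a i.
Proof.
case: xP => x0 _ _; apply/funext => k; rewrite /evalt /tot (csum1 (i0 := 0%N)).
  by rewrite /fscale expr0 mul1r x0.
by move=> n n0; rewrite /fscale expr0n (negPf n0) mul0r.
Qed.

Lemma wbnd_evalt t d i : 0 < d < 1 -> cmod t < T * (1 - d) ->
  wbnd (Delta * d) (evalt t i) (A * (1 - cmod t / (T * (1 - d)))^-1).
Proof.
move=> hd ht; apply: wbnd_tot; last exact: fbnd_fscale.
by rewrite mulr_ge0 ?(ltW Delta_gt0)//; case/andP: hd => /ltW.
Qed.

(** At a point of the disk the series may be summed inside the vector field, and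
   the recursion for the coefficients turns it into the termwise derivative. *)
Lemma rhs_evalt t d i k : 0 < d < 1 -> cmod t < T * (1 - d) ->
  exists N, abnd (fun n => n%:R * t ^+ n.-1 * x i n k) N /\
  rhs al be (evalt t) i k = csum (fun n => n%:R * t ^+ n.-1 * x i n k).
Proof.
move=> hd ht.
have d0 : 0 <= Delta * d.
  by rewrite mulr_ge0 ?(ltW Delta_gt0)//; case/andP: hd => /ltW.
have [e [N hN]] := tot_frhs i k d0 (fun j => fbnd_fscale j hd ht).
have fE n : frhs al be (fun j => fscale t (x j)) i n k = n.+1%:R * t ^+ n * x i n.+1 k.
  rewrite (frhs_scale _ _ _ _ ffin_x); case: xP => _ <- _.
  by rewrite mulrCA mulrA.
have hN' : abnd (fun n => n%:R * t ^+ n.-1 * x i n k) N.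
  apply: abnd_shift; first by rewrite !mul0r.
  by move: hN; congr abnd; apply/funext => n; rewrite fE.
exists N; split => //.
rewrite (csum_shift hN') ?mul0r// -e /tot.
by apply: eq_csum => n; rewrite fE.
Qed.

(** Multiplied by rho^2, so that the exponent n - 2 does not occur. *)
Lemma pow_taylor (t s : R[i]) rho n : cmod t <= rho -> cmod s <= rho ->
  cmod (s ^+ n - t ^+ n - n%:R * t ^+ n.-1 * (s - t)) * rho ^+ 2
   <= cmod (s - t) ^+ 2 * n%:R ^+ 2 * rho ^+ n.
Proof.
move=> tr sr; have rho0 : 0 <= rho by rewrite (le_trans _ tr)// cmod_ge0.
elim: n => [|n IH].
  by rewrite !expr0 subrr mul0r mul0r subr0 cmod0 expr0n/= mulr0 !mul0r.
have -> : s ^+ n.+1 - t ^+ n.+1 - n.+1%:R * t ^+ n.+1.-1 * (s - t) =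
   s * (s ^+ n - t ^+ n - n%:R * t ^+ n.-1 * (s - t)) + n%:R * t ^+ n.-1 * (s - t) ^+ 2.
  case: n {IH} => [|n]; first by rewrite /= !expr0 !expr1; ring.
  rewrite /= -(natr1 n.+1) !exprS; move: (n.+1%:R : R[i]) (t ^+ n) (s ^+ n) => N P Q.
  by ring.
have h1 : cmod (n%:R * t ^+ n.-1 * (s - t) ^+ 2) * rho ^+ 2 <=
    cmod (s - t) ^+ 2 * n%:R * rho ^+ n.+1.
  case: n {IH} => [|n]; first by rewrite !mul0r cmod0 mul0r mulr0 mul0r.
  rewrite !cmodM cmod_nat !cmodX /=.
  rewrite [leLHS](_ : _ = cmod (s - t) ^+ 2 * n.+1%:R * (cmod t ^+ n * rho ^+ 2)); last by ring.
  rewrite ler_wpM2l ?mulr_ge0 ?exprn_ge0 ?cmod_ge0//.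
  rewrite (_ : rho ^+ n.+2 = rho ^+ n * rho ^+ 2); last by rewrite -exprD addn2.
  by rewrite ler_wpM2r ?exprn_ge0// lerXn2r ?nnegrE ?cmod_ge0.
have h2 : cmod (s * (s ^+ n - t ^+ n - n%:R * t ^+ n.-1 * (s - t))) * rho ^+ 2 <=
    rho * (cmod (s - t) ^+ 2 * n%:R ^+ 2 * rho ^+ n).
  by rewrite cmodM -mulrA ler_pM ?mulr_ge0 ?cmod_ge0 ?exprn_ge0.
apply: (le_trans (ler_wpM2r _ (cmodD _ _))); first exact: exprn_ge0.
rewrite mulrDl; apply: (le_trans (lerD h2 h1)).
rewrite -natr1 (exprS rho n).
set N : R := n%:R; set P := rho ^+ n; set H := cmod (s - t) ^+ 2.
rewrite -subr_ge0 (_ : _ - _ = H * (rho * P) * (N + 1)); last by ring.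
by rewrite !mulr_ge0 ?exprn_ge0 ?cmod_ge0// addr_ge0// ler0n.
Qed.

(** The quadratic Taylor errors of the powers of t are summed against the
   decay of the coefficients, at a radius strictly between |t| and the radius of
   the disk; their factor n^2 is cancelled by the 1 / (n + 1)^2 in the bounds. *)
Lemma evalt_deriv t d : 0 < d < 1 -> cmod t < T * (1 - d) ->
  exists L rho : R, 0 < rho /\ forall h i, h != 0 -> cmod h < rho ->
    cmod (t + h) < T * (1 - d) /\
    wbnd (Delta * d) (fun k => h^-1 * (evalt (t + h) i k - evalt t i k)
      - rhs al be (evalt t) i k) (cmod h * L).
Proof.
move=> hd ht; have r0 := radius_gt0 hd.
set r := T * (1 - d) in ht r0 *.
have d0 : 0 <= Delta * d.
  by rewrite mulr_ge0 ?(ltW Delta_gt0)//; case/andP: hd => /ltW.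
have [rho [trho rhor]] : exists rho, cmod t < rho /\ rho < r.
  by exists ((cmod t + r) / 2); split; lra.
have rho0 : 0 < rho by exact: le_lt_trans (cmod_ge0 t) trho.
have rho0' := ltW rho0.
pose q := rho / r.
have q01 : 0 <= q < 1 by rewrite divr_ge0 ?(ltW rho0) ?(ltW r0)//= ltr_pdivrMr// mul1r.
exists (A / rho ^+ 2 * (1 - q)^-1), (rho - cmod t); split; first by rewrite subr_gt0.
move=> h i h0 hh.
have thrho : cmod (t + h) <= rho by rewrite (le_trans (cmodD _ _))// -lerBrDl ltW.
have thr : cmod (t + h) < r by exact: le_lt_trans rhor.
split=> //.
pose e n := h^-1 * ((t + h) ^+ n - t ^+ n - n%:R * t ^+ n.-1 * h).
have eE n : cmod (e n) <= cmod h * n%:R ^+ 2 * rho ^+ n / rho ^+ 2.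
  have := pow_taylor n (ltW trho) thrho; rewrite [t + h - t](_ : _ = h); last by ring.
  rewrite /e cmodM cmodV -ler_pdivlMr ?exprn_gt0// => H.
  rewrite ler_pdivrMl ?cmod_gt0//; apply: (le_trans H).
  by rewrite !mulrA expr2.
have fb : fbnd (Delta * d) (fun n k => e n * x i n k) (cmod h * (A / rho ^+ 2 * (1 - q)^-1)).
  exists (fun n => cmod h * (A / rho ^+ 2) * q ^+ n); last first.
    rewrite [X in nhs _ X]mulrA; apply: (nhsZ _ (nhs_geo q01)).
    by rewrite mulr_ge0 ?cmod_ge0// divr_ge0// exprn_ge0.
  move=> n; case: xP => _ _ xb.
  have en : forall k : int, cmod ((fun=> e n) k) <= cmod h * n%:R ^+ 2 * rho ^+ n / rho ^+ 2.
    by move=> _; exact: eE.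
  have rn0 : 0 <= cmod h * n%:R ^+ 2 * rho ^+ n / rho ^+ 2.
    by rewrite divr_ge0 ?exprn_ge0// !mulr_ge0 ?cmod_ge0 ?exprn_ge0.
  apply: wbnd_le (wbndZ rn0 en (xb d n i hd)).
  rewrite -/r /q expr_div_n exprVn.
  rewrite [leLHS](_ : _ = cmod h * (A / rho ^+ 2) * (rho ^+ n / r ^+ n) *
    (n%:R ^+ 2 * invsq n)); last by ring.
  rewrite ler_piMr//.
    by rewrite !mulr_ge0 ?cmod_ge0 ?invr_ge0 ?exprn_ge0// ltW.
  by rewrite /invsq ler_pdivrMr ?exprn_gt0// mul1r lerXn2r ?nnegrE// ler_nat.
have := wbnd_tot d0 fb; apply: eq_wbnd => k.
have col s : cmod s < r -> abnd (fun n => fscale s (x i) n k)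
    (A * (1 - cmod s / r)^-1).
  by move=> sr; exact: (abnd_col k (fbnd_pair0 d0 (fbnd_fscale i hd sr))).
have [N [hN ->]] := rhs_evalt i k hd ht.
rewrite /evalt /tot -(csumB (col _ thr) (col _ ht)).
rewrite -(csumZ _ (abndB (col _ thr) (col _ ht))).
rewrite -(csumB (abndZ (lexx _) (abndB (col _ thr) (col _ ht))) hN).
apply: eq_csum => n; rewrite /e /fscale.
by field.
Qed.

End CubicSolution.

(** * Integration of bounds in time *)

Section RealVariable.
Context {R : realType}.

(** Componentwise, so that the real mean value theorem applies to each part. *)
Definition cderiv (w : R -> R[i]) (tau : R) (w' : R[i]) : Prop :=
  is_derive tau 1 (fun s => complex.Re (w s)) (complex.Re w') /\
  is_derive tau 1 (fun s => complex.Im (w s)) (complex.Im w').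

Lemma is_derive_fun (f g : R -> R) (t f' g' : R) :
  f =1 g -> f' = g' -> is_derive t 1 f f' -> is_derive t 1 g g'.
Proof. by move=> /funext -> ->. Qed.

Lemma is_derive_bigsum (J : eqType) (s : seq J) (h : J -> R -> R) (h' : J -> R) (t : R) :
  (forall j, is_derive t 1 (h j) (h' j)) ->
  is_derive t 1 (fun u => \sum_(j <- s) h j u) (\sum_(j <- s) h' j).
Proof.
move=> hj; elim: s => [|j s IH].
  apply: is_derive_fun (is_derive_cst (0 : R) t 1) => [u|]; first by rewrite big_nil.
  by rewrite big_nil.
apply: is_derive_fun (is_deriveD (hj j) IH) => [u|]; last by rewrite big_cons.
by rewrite big_cons.
Qed.

Lemma is_derive_scale (f : R -> R) (t c f' : R) :
  is_derive t 1 f f' -> is_derive t 1 (fun u => c * f u) (c * f').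
Proof.
move=> h; apply: is_derive_fun (is_deriveZ c h) => [u|]; last by [].
by [].
Qed.

Lemma cderivB w1 w2 t d1 d2 : cderiv w1 t d1 -> cderiv w2 t d2 ->
  cderiv (fun s => w1 s - w2 s) t (d1 - d2).
Proof.
move=> [h1 h2] [h3 h4]; split; rewrite ?cReD ?cImD ?cReN ?cImN.
  by apply: is_derive_fun (is_deriveB h1 h3) => // u; rewrite cReD cReN.
by apply: is_derive_fun (is_deriveB h2 h4) => // u; rewrite cImD cImN.
Qed.

Lemma is_derive_continuous (f : R -> R) (t f' : R) :
  is_derive t 1 f f' -> {for t, continuous f}.
Proof. by move=> [fd _]; apply/differentiable_continuous/derivable1_diffP. Qed.

Lemma le_of_deriv (f f' : R -> R) (a b : R) : a <= b ->
  (forall t, a <= t <= b -> is_derive t 1 f (f' t)) ->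
  (forall t, a <= t <= b -> f' t <= 0) -> f b <= f a.
Proof.
move=> ab df f'0.
have [|c|c cab e] := @MVT_segment R f f' a b ab.
- by move=> x /itvP xab; apply: df; rewrite !xab.
- apply: continuous_in_subspaceT => x; rewrite inE/= => /itvP xab.
  by apply: is_derive_continuous (df x _); rewrite !xab.
rewrite -subr_le0 e mulr_le0_ge0 ?subr_ge0//.
by apply: f'0; rewrite !(itvP cab).
Qed.

(** The bound is tested on finite sets of indices, where each modulus at the
   final time is made real by a fixed rotation; the resulting finite sum of real
   functions, minus the claimed bound, is nonincreasing. *)
Lemma wbnd_integrate (delta a b G : R) n (w w' : R -> int -> R[i]) : a <= b -> 0 <= G ->
  (forall t k, a <= t <= b -> cderiv (fun s => w s k) t (w' t k)) ->
  (forall k, w a k = 0) ->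
  (forall t, a <= t <= b -> wbnd delta (w' t) (G * (t - a) ^+ n)) ->
  forall t, a <= t <= b -> wbnd delta (w t) (G * ((t - a) ^+ n.+1 / n.+1%:R)).
Proof.
move=> ab G0 dw wa w'G t /andP[at' tb].
apply/abnd_seqP => s us.
have /choice[th thP] := fun k => cmod_rotate (w t k).
pose f u := \sum_(k <- s) wt delta k * complex.Re (th k * w u k)
   - G * ((u - a) ^+ n.+1 / n.+1%:R).
pose f' u := \sum_(k <- s) wt delta k * complex.Re (th k * w' u k)
   - G * (u - a) ^+ n.
have : f t <= f a.
  apply: (@le_of_deriv f f') => // u /andP[au ut].
    have uab : a <= u <= b by rewrite au (le_trans ut).
    have h1 : is_derive u 1 (fun u => \sum_(k <- s) wt delta k * complex.Re (th k * w u k))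
        (\sum_(k <- s) wt delta k * complex.Re (th k * w' u k)).
      apply: is_derive_bigsum => k; apply: is_derive_scale.
      have [dr di] := dw u k uab.
      apply: is_derive_fun (is_deriveB (is_derive_scale (complex.Re (th k)) dr)
        (is_derive_scale (complex.Im (th k)) di)); last by rewrite cReM.
      by move=> v; rewrite cReM.
    have h2 : is_derive u 1 (fun u => (u - a) ^+ n.+1 / n.+1%:R) ((u - a) ^+ n).
      have h : is_derive u 1 (fun v : R => v - a) 1.
        by apply: is_derive_fun (is_deriveB (is_derive_id u 1) (is_derive_cst a u 1)) => [v|]; rewrite ?subr0//.
      apply: is_derive_fun (is_derive_scale (n.+1%:R^-1) (is_deriveX n.+1 h)).
        by move=> v; rewrite [LHS]mulrC exprfctE.
      by rewrite /= /GRing.scale/= mulr1 mulrA mulVf ?mul1r ?pnatr_eq0.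
    by apply: is_derive_fun (is_deriveB h1 (is_derive_scale G h2)).
  have uab : a <= u <= b by rewrite au (le_trans ut).
  rewrite subr_le0 (le_trans _ (proj1 (abnd_seqP _ _) (w'G u uab) s us))//.
  apply: ler_sum => k _; rewrite cmod_wt ler_wpM2l ?wt_ge0//.
  by rewrite (le_trans (ler_norm _))// (le_trans (Re_le_cmod _))// cmodM (proj1 (thP k)) mul1r.
rewrite /f subrr expr0n/= mul0r mulr0 subr0 [leRHS]big1; last first.
  by move=> k _; rewrite wa mulr0 mulr0.
rewrite subr_le0; apply: le_trans.
apply: ler_sum => k _; rewrite cmod_wt ler_wpM2l ?wt_ge0//.
by rewrite (proj2 (thP k)).
Qed.

End RealVariable.

(** * Uniqueness for the cubic system along a ray *)

Section CubicUniqueness.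
Context {R : realType} (I : finType).
Variables (al : I -> I * I * I -> int -> R[i]) (be : I -> int -> R[i]).
Variables (C0 g0 : R).
Hypothesis C0_ge0 : 0 <= C0.
Hypothesis g0_ge0 : 0 <= g0.
Hypothesis alP : forall i p k, cmod (al i p k) <= C0 * (1 + 2 * pi * `|k%:~R|).
Hypothesis beP : forall i k, cmod (be i k) <= g0.

Local Notation P := (ntriples (R := R) I).

(** The factors are exchanged one at a time. *)
Lemma conv3_telescope (delta : R) c d e c' d' e' M E : 0 <= delta ->
  wbnd delta c M -> wbnd delta d M -> wbnd delta e M ->
  wbnd delta c' M -> wbnd delta d' M -> wbnd delta e' M ->
  wbnd delta (fun k => c k - c' k) E -> wbnd delta (fun k => d k - d' k) E ->
  wbnd delta (fun k => e k - e' k) E ->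
  wbnd delta (fun k => conv3 c d e k - conv3 c' d' e' k) (3 * M ^+ 2 * E).
Proof.
move=> d0 cM dM eM cM' dM' eM' cE dE eE.
have ab u N : wbnd delta u N -> abnd u N by exact: wbnd_abnd.
have e1 : (fun k => conv3 c d e k - conv3 c' d' e' k) =
   (fun k => conv (conv (fun k => c k - c' k) d) e k +
    (conv (conv c' (fun k => d k - d' k)) e k + conv (conv c' d') (fun k => e k - e' k) k)).
  rewrite (convBl (ab _ _ cM) (ab _ _ cM') (ab _ _ dM)).
  rewrite (convBr (ab _ _ cM') (ab _ _ dM) (ab _ _ dM')).
  have cd := ab _ _ (wbnd_conv d0 cM dM); have cd' := ab _ _ (wbnd_conv d0 cM' dM).
  have cd'' := ab _ _ (wbnd_conv d0 cM' dM').
  rewrite (convBl cd cd' (ab _ _ eM)) (convBl cd' cd'' (ab _ _ eM)).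
  rewrite (convBr cd'' (ab _ _ eM) (ab _ _ eM')).
  by apply/funext => k; rewrite /conv3; ring.
have -> : 3 * M ^+ 2 * E = E * M * M + (M * E * M + M * M * E) by ring.
by rewrite e1; apply: wbndD; [|apply: wbndD]; apply: wbnd_conv => //; apply: wbnd_conv.
Qed.

Lemma rhs_lip (delta delta' : R) x y M E i : 0 <= delta -> delta' < delta -> 0 <= E ->
  (forall j, wbnd delta (x j) M) -> (forall j, wbnd delta (y j) M) ->
  (forall j, wbnd delta (fun k => x j k - y j k) E) ->
  wbnd delta' (fun k => rhs al be x i k - rhs al be y i k)
    (P * (C0 * (1 + (delta - delta')^-1) * (3 * M ^+ 2 * E)) + g0 * E).
Proof.
move=> d0 dd E0 xM yM xyE.
have tri (p : I * I * I) : wbnd delta (fun k => conv3 (x p.1.1) (x p.1.2) (x p.2) k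
    - conv3 (y p.1.1) (y p.1.2) (y p.2) k) (3 * M ^+ 2 * E).
  exact: conv3_telescope.
have := @wbnd_multipliers R I al be C0 g0 C0_ge0 g0_ge0 alP beP delta delta' _ _ i _ _ dd E0 tri (xyE i).
apply: eq_wbnd => k; rewrite /rhs.
rewrite opprD addrACA -sumrB -mulrBr; congr (_ + _).
by apply: eq_bigr => p _; rewrite mulrBr.
Qed.

Variables (delta M Z : R) (z : R[i]).
Hypothesis delta_gt0 : 0 < delta.
Hypothesis M_ge0 : 0 <= M.
Hypothesis zZ : cmod z <= Z.

(** Dominates the Lipschitz constant of the vector field times the lost width; the
   factor 2 e pays for the loss of width at each integration. *)
Definition lipconst :=
  2 * expR 1 * Z * (P * C0 * (delta + 1) * (3 * M ^+ 2) + g0 * delta).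

Lemma Z_ge0 : 0 <= Z.
Proof. by rewrite (le_trans _ zZ)// cmod_ge0. Qed.

Lemma lipconst_ge0 : 0 <= lipconst.
Proof.
rewrite mulr_ge0//; first by rewrite !mulr_ge0 ?expR_ge0 ?Z_ge0.
have d0 := ltW delta_gt0; rewrite addr_ge0 ?mulr_ge0 ?ntriples_ge0 ?exprn_ge0 ?addr_ge0//.
Qed.

Section Interval.
Variables (x y : R -> I -> int -> R[i]) (a b : R).
Hypothesis ab : a <= b.
Hypothesis xM : forall t i, a <= t <= b -> wbnd delta (x t i) M.
Hypothesis yM : forall t i, a <= t <= b -> wbnd delta (y t i) M.
Hypothesis dx : forall t i k, a <= t <= b ->
  cderiv (fun s => x s i k) t (z * rhs al be (x t) i k).
Hypothesis dy : forall t i k, a <= t <= b ->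
  cderiv (fun s => y s i k) t (z * rhs al be (y t) i k).
Hypothesis xya : x a = y a.

(** Each integration in time gains a power of t - a over a factorial, and the
   vector field loses a fraction 1 / (n + 2) of the remaining width. The two
   factors nearly cancel, leaving a geometric sequence. *)
Lemma difference_bound n : forall delta', 0 <= delta' < delta ->
  forall t i, a <= t <= b ->
  wbnd delta' (fun k => x t i k - y t i k)
    (2 * M * (lipconst / (delta - delta')) ^+ n * (t - a) ^+ n).
Proof.
have L0 := lipconst_ge0.
elim: n => [|n IH] delta' /andP[d'0 d'd] t i tab.
  rewrite !expr0 !mulr1 mulr_natl mulr2n.
  by apply: wbnd_wt (ltW d'd) _; apply: wbndB; [exact: xM|exact: yM].
have n1 : 0 < n.+1%:R :> R by rewrite ltr0n.
have n2 : 0 < n.+2%:R :> R by rewrite ltr0n.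
have e0 : 0 < delta - delta' by rewrite subr_gt0.
pose d2 := delta' + (delta - delta') / n.+2%:R.
have g2 : d2 - delta' = (delta - delta') / n.+2%:R by rewrite /d2; ring.
have g1 : delta - d2 = (delta - delta') * (n.+1%:R / n.+2%:R).
  rewrite /d2 -(natr1 n.+1); move: n1; set N : R := n.+1%:R => N0.
  by field; apply: lt0r_neq0; lra.
have gt2 : 0 < d2 - delta' by rewrite g2 divr_gt0.
have gt1 : 0 < delta - d2 by rewrite g1 mulr_gt0// divr_gt0.
have d20 : 0 <= d2 by lra.
have hd2 : 0 <= d2 < delta by lra.
set q := lipconst / (delta - delta').
have q0 : 0 <= q by rewrite divr_ge0// ltW.
pose q2 := lipconst / (delta - d2).
have q20 : 0 <= q2 by rewrite divr_ge0// ltW.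
have q2n : q2 ^+ n <= expR 1 * q ^+ n.
  have -> : q2 = n.+2%:R / n.+1%:R * q.
    by rewrite /q2 g1 /q; field; rewrite !gt_eqF.
  by rewrite exprMn ler_wpM2r ?succ_ratio_pow// exprn_ge0.
pose K := P * (C0 * (1 + (d2 - delta')^-1) * (3 * M ^+ 2)) + g0.
have K0 : 0 <= K.
  by rewrite addr_ge0// !mulr_ge0 ?ntriples_ge0 ?exprn_ge0// addr_ge0// invr_ge0 ltW.
pose G := Z * K * (2 * M * q2 ^+ n).
have G0 : 0 <= G by rewrite !mulr_ge0 ?Z_ge0 ?exprn_ge0.
have h : wbnd delta' (fun k => x t i k - y t i k) (G * ((t - a) ^+ n.+1 / n.+1%:R)).
  apply: (@wbnd_integrate _ _ a b G n (fun t k => x t i k - y t i k)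
    (fun t k => z * (rhs al be (x t) i k - rhs al be (y t) i k))) => //.
  - by move=> u k uab; rewrite mulrBr; apply: cderivB; [exact: dx|exact: dy].
  - by move=> k; rewrite xya subrr.
  move=> u uab.
  have ua0 : 0 <= u - a by rewrite subr_ge0; case/andP: uab.
  have E0 : 0 <= 2 * M * q2 ^+ n * (u - a) ^+ n by rewrite !mulr_ge0 ?exprn_ge0.
  have d2M w N : wbnd delta w N -> wbnd d2 w N by apply: wbnd_wt; lra.
  have := @rhs_lip d2 delta' (x u) (y u) M _ i d20 _ E0
    (fun j => d2M _ _ (xM j uab)) (fun j => d2M _ _ (yM j uab))
    (fun j => IH d2 hd2 u j uab).
  rewrite -subr_gt0 => /(_ gt2) hr.
  have zc (k : int) : cmod ((fun=> z) k) <= Z by [].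
  have := wbndZ Z_ge0 zc hr; apply: wbnd_le.
  by rewrite /G /K le_eqVlt; apply/orP; left; apply/eqP; ring.
apply: wbnd_le h.
have ta0 : 0 <= t - a by rewrite subr_ge0; case/andP: tab.
rewrite [leLHS](_ : _ = G / n.+1%:R * (t - a) ^+ n.+1); last by ring.
rewrite ler_wpM2r ?exprn_ge0//.
have D0 : 0 <= delta by exact: ltW.
have KL : Z * K <= n.+2%:R / (delta - delta') * (lipconst / (2 * expR 1)).
  rewrite /lipconst.
  rewrite [leRHS](_ : _ = Z * (P * (C0 * ((delta + 1) * (n.+2%:R / (delta - delta'))) * (3 * M ^+ 2))
    + g0 * (delta * (n.+2%:R / (delta - delta'))))); last first.
    by field; rewrite !gt_eqF ?expR_gt0.
  have hN : 1 <= n.+2%:R :> R by rewrite ler1n.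
  have hdd : 1 <= delta * (n.+2%:R / (delta - delta')).
    rewrite mulrA ler_pdivlMr// mul1r; apply: (@le_trans _ _ delta); first by lra.
    by rewrite ler_peMr.
  rewrite ler_wpM2l ?Z_ge0// /K lerD//; last by rewrite ler_peMr.
  rewrite ler_wpM2l ?ntriples_ge0// ler_wpM2r ?mulr_ge0 ?exprn_ge0//.
  rewrite ler_wpM2l// mulrDl mul1r lerD// g2.
  by rewrite invf_div.
rewrite /G.
apply: (@le_trans _ _ (n.+2%:R / (delta - delta') * (lipconst / (2 * expR 1)) *
   (2 * M * (expR 1 * q ^+ n)) / n.+1%:R)).
  rewrite ler_wpM2r ?invr_ge0 ?(ltW n1)//.
  apply: ler_pM => //; first by rewrite mulr_ge0 ?Z_ge0.
    by rewrite !mulr_ge0 ?exprn_ge0.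
  by rewrite ler_wpM2l// mulr_ge0.
rewrite (exprS q n) {2}/q.
rewrite [leLHS](_ : _ = 2 * M * (lipconst / (delta - delta') * q ^+ n) * (n.+2%:R / n.+1%:R / 2)); last first.
  by field; rewrite !gt_eqF ?expR_gt0.
rewrite ler_piMr//.
  have qn0 : 0 <= q ^+ n by exact: exprn_ge0.
  by apply: mulr_ge0; [exact: mulr_ge0|exact: (mulr_ge0 q0 qn0)].
rewrite ler_pdivrMr// mul1r ler_pdivrMr// -(natr1 n.+1).
have : 1 <= n.+1%:R :> R by rewrite ler1n.
by lra.
Qed.

(** On a short interval the geometric bounds at width 0 tend to 0. *)
Lemma local_uniqueness : lipconst * (b - a) < delta ->
  forall t i, a <= t <= b -> x t i = y t i.
Proof.
move=> small t i tab; apply/funext => k.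
have L0 := lipconst_ge0; have D0 := ltW delta_gt0.
set q := lipconst / delta * (t - a).
have ta0 : 0 <= t - a by rewrite subr_ge0; case/andP: tab.
have q0 : 0 <= q by rewrite mulr_ge0 ?divr_ge0.
have q1 : q < 1.
  rewrite /q mulrAC ltr_pdivrMr// mul1r (le_lt_trans _ small)//.
  by rewrite ler_wpM2l// lerD2r; case/andP: tab.
have h n : cmod (x t i k - y t i k) <= 2 * M * q ^+ n.
  have d0 : 0 <= (0 : R) < delta by apply/andP; split.
  have := difference_bound n d0 i tab.
  rewrite subr0 -mulrA -exprMn => /(wbnd_abnd (lexx _)).
  by move=> /(@abnd_term _ _ _ _ k).
have lim : (fun n => 2 * M * q ^+ n) @ \oo --> (2 * M * 0 : R).
  by apply: cvgMr; apply: cvg_expr; rewrite ger0_norm.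
have : cmod (x t i k - y t i k) <= 0.
  rewrite -[leRHS](mulr0 (2 * M)).
  apply: (@ler_cvg_to _ _ _ _ (fun=> cmod (x t i k - y t i k)) _ _ _ _ lim); first exact: cvg_cst.
  by apply: nearW => n; exact: h.
move=> le0; apply/eqP; rewrite -subr_eq0; apply/eqP/cmod_eq0/eqP.
by rewrite eq_le le0 cmod_ge0.
Qed.

End Interval.

(** The length of the interval of local uniqueness depends only on the bound M
   and on the width, so finitely many steps cover [0, 1]. *)
Lemma ray_uniqueness (x y : R -> I -> int -> R[i]) :
  (forall t i, 0 <= t <= 1 -> wbnd delta (x t i) M) ->
  (forall t i, 0 <= t <= 1 -> wbnd delta (y t i) M) ->
  (forall t i k, 0 <= t <= 1 ->
    cderiv (fun s => x s i k) t (z * rhs al be (x t) i k)) ->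
  (forall t i k, 0 <= t <= 1 ->
    cderiv (fun s => y s i k) t (z * rhs al be (y t) i k)) ->
  x 0 = y 0 -> forall t, 0 <= t <= 1 -> x t = y t.
Proof.
move=> xM yM dx dy xy0.
have L0 := lipconst_ge0.
pose N := (Num.trunc (lipconst / delta)).+1.
have N0 : 0 < N%:R :> R by rewrite ltr0n.
have LN : lipconst / N%:R < delta.
  by rewrite ltr_pdivrMr// mulrC -ltr_pdivrMr// truncnS_gt.
have step j : (j <= N)%N -> forall t, 0 <= t <= j%:R / N%:R -> x t = y t.
  elim: j => [_ t|j IH jN t /andP[t0 tj]].
    rewrite mul0r => /andP[t0 t1].
    by have -> : t = 0 by apply/eqP; rewrite eq_le t0 t1.
  have jN1 : j.+1%:R / N%:R <= 1 :> R by rewrite ler_pdivrMr// mul1r ler_nat.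
  have j0 : 0 <= j%:R / N%:R :> R by rewrite divr_ge0.
  have jj : j%:R / N%:R <= j.+1%:R / N%:R :> R.
    by rewrite ler_wpM2r ?invr_ge0 ?(ltW N0)// ler_nat.
  have [tle|tgt] := leP t (j%:R / N%:R); first by apply: IH; [exact: ltnW|rewrite t0].
  have sub (u : R) : j%:R / N%:R <= u <= j.+1%:R / N%:R -> 0 <= u <= 1.
    by move=> /andP[h1 h2]; rewrite (le_trans j0 h1) (le_trans h2 jN1).
  apply/funext => i.
  apply: (@local_uniqueness x y (j%:R / N%:R) (j.+1%:R / N%:R)) => //.
  - by move=> u l /sub; exact: xM.
  - by move=> u l /sub; exact: yM.
  - by move=> u l k /sub; exact: dx.
  - by move=> u l k /sub; exact: dy.
  - by apply: IH; [exact: ltnW|rewrite j0 lexx].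
  - by rewrite -mulrBl -(natr1 j) addrAC subrr add0r mul1r.
  - by rewrite (ltW tgt).
by move=> t t01; apply: (step N (leqnn _)); rewrite divff ?gt_eqF.
Qed.

End CubicUniqueness.

(** * The complex exponential *)

Section ComplexExponential.
Context {R : realType}.
Implicit Types (w z : R[i]) (s t : R).

Definition cexp w : R[i] := (expR (complex.Re w))%:C%C * expi (complex.Im w).

Lemma expiD s t : expi (s + t) = expi s * expi t.
Proof.
apply: complexP; rewrite ?cReM ?cImM /=; first exact: cosD.
by rewrite sinD addrC.
Qed.

Lemma cmod_expi t : cmod (expi t) = 1.
Proof. by rewrite cmodE /= cos2Dsin2 sqrtr1. Qed.

Lemma expi0 : expi (0 : R) = 1.
Proof. by rewrite /expi cos0 sin0. Qed.

Lemma cexpD w z : cexp (w + z) = cexp w * cexp z.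
Proof. by rewrite /cexp cReD cImD expRD expiD rmorphM mulrACA. Qed.

Lemma cexp0 : cexp 0 = 1.
Proof. by rewrite /cexp /= expR0 expi0 mulr1. Qed.

Lemma cmod_cexp w : cmod (cexp w) = expR (complex.Re w).
Proof. by rewrite cmodM cmod_expi mulr1 cmodR ger0_norm// expR_ge0. Qed.

Lemma cexp_i t : cexp (0 +i* t)%C = expi t.
Proof. by rewrite /cexp /= expR0 mul1r. Qed.

Lemma cderiv_cexp w t :
  cderiv (fun s => cexp (s%:C%C * w)) t (w * cexp (t%:C%C * w)).
Proof.
case: w => a b.
have e1 s : complex.Re (s%:C%C * (a +i* b)%C) = a * s by rewrite cReM /=; ring.
have e2 s : complex.Im (s%:C%C * (a +i* b)%C) = b * s by rewrite cImM /=; ring.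
have rE s : complex.Re (cexp (s%:C%C * (a +i* b)%C)) = expR (a * s) * cos (b * s).
  by rewrite /cexp e1 e2 cReM /= mul0r subr0.
have iE s : complex.Im (cexp (s%:C%C * (a +i* b)%C)) = expR (a * s) * sin (b * s).
  by rewrite /cexp e1 e2 cImM /= mul0r addr0.
have lin (c : R) : is_derive t 1 (fun s => c * s) (c * 1).
  exact: is_derive_scale (is_derive_id t 1).
have de : is_derive t 1 (fun s => expR (a * s)) (a * expR (a * t)).
  by apply: is_derive_eq; rewrite /GRing.scale/=; ring.
have dc : is_derive t 1 (fun s => cos (b * s)) (- (b * sin (b * t))).
  by apply: is_derive_eq; rewrite /GRing.scale/=; ring.
have ds : is_derive t 1 (fun s => sin (b * s)) (b * cos (b * t)).
  by apply: is_derive_eq; rewrite /GRing.scale/=; ring.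
split.
  apply: is_derive_fun (is_deriveM de dc) => [s|]; first by rewrite rE.
  rewrite cReM rE iE /GRing.scale/=; ring.
apply: is_derive_fun (is_deriveM de ds) => [s|]; first by rewrite iE.
rewrite cImM rE iE /GRing.scale/=; ring.
Qed.

(** A number is seen as a sequence supported at 0. *)
Lemma cmod_integrate (a b G : R) n (f f' : R -> R[i]) : a <= b -> 0 <= G ->
  (forall t, a <= t <= b -> cderiv f t (f' t)) -> f a = 0 ->
  (forall t, a <= t <= b -> cmod (f' t) <= G * (t - a) ^+ n) ->
  forall t, a <= t <= b -> cmod (f t) <= G * ((t - a) ^+ n.+1 / n.+1%:R).
Proof.
move=> ab G0 df fa f'G t tab.
pose one (c : R[i]) (k : int) : R[i] := if k == 0 then c else 0.
have oneb c N : cmod c <= N -> wbnd 0 (one c) N.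
  move=> cN; apply: abnd_le cN _; apply: abnd_dom (nhs1 (0 : int) (cmod_ge0 c)) => k.
  rewrite cmod_wt /wt mulr0 mul0r expR0 mul1r /one; case: ifP => //.
  by rewrite cmod0.
have := @wbnd_integrate R 0 a b G n (fun t => one (f t)) (fun t => one (f' t)) ab G0 _ _ _ t tab.
move=> h; have {}h := h _ _ _; apply: le_trans (abnd_term 0 (wbnd_abnd (lexx 0) (h _ _ _))).
- by rewrite /one eqxx.
- move=> u k uab; rewrite /one; case: ifP => _; first exact: df.
  by split; exact: is_derive_cst.
- by move=> k; rewrite /one fa; case: ifP.
- by move=> u uab; apply: oneb; exact: f'G.
Qed.

Lemma cderiv_lin w t : cderiv (fun s => s%:C%C * w) t w.
Proof.
case: w => a b; split.
  apply: is_derive_fun (is_derive_scale a (is_derive_id t 1)) => [s|]; rewrite ?mulr1//.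
  by rewrite cReM /= mul0r subr0 mulrC.
apply: is_derive_fun (is_derive_scale b (is_derive_id t 1)) => [s|]; rewrite ?mulr1//.
by rewrite cImM /= mul0r addr0 mulrC.
Qed.

Lemma cderiv_cst w t : cderiv (fun=> w) t 0.
Proof. by split; exact: is_derive_cst. Qed.

(** Two integrations along the segment from 0 to w. *)
Lemma cexp_taylor w : cmod (cexp w - 1 - w) <= cmod w ^+ 2 * expR (cmod w).
Proof.
have W0 := cmod_ge0 w; have E0 := expR_ge0 (cmod w).
have small t : 0 <= t <= 1 -> cmod (cexp (t%:C%C * w)) <= expR (cmod w).
  move=> /andP[t0 t1]; rewrite cmod_cexp ler_expR (le_trans (ler_norm _))//.
  by rewrite (le_trans (Re_le_cmod _))// cmodM cmodR ger0_norm// ler_piMl.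
have first t : 0 <= t <= 1 ->
    cmod (cexp (t%:C%C * w) - 1) <= cmod w * expR (cmod w) * (t - 0) ^+ 1.
  move=> t01.
  have h := @cmod_integrate 0 1 (cmod w * expR (cmod w)) 0
    (fun t => cexp (t%:C%C * w) - 1) (fun t => w * cexp (t%:C%C * w) - 0) ler01.
  rewrite -(divr1 ((t - 0) ^+ 1)); apply: h => //.
  - by rewrite mulr_ge0.
  - by move=> u _; apply: cderivB; [exact: cderiv_cexp|exact: cderiv_cst].
  - by rewrite mul0r cexp0 subrr.
  - by move=> u u01; rewrite subr0 expr0 mulr1 cmodM ler_wpM2l// small.
have h := @cmod_integrate 0 1 (cmod w ^+ 2 * expR (cmod w)) 1
    (fun t => cexp (t%:C%C * w) - 1 - t%:C%C * w) (fun t => w * cexp (t%:C%C * w) - 0 - w) ler01.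
have : cmod (cexp (1%:C%C * w) - 1 - 1%:C%C * w) <=
    cmod w ^+ 2 * expR (cmod w) * ((1 - 0) ^+ 2 / 2%:R).
  apply: h => //.
  - by rewrite mulr_ge0// exprn_ge0.
  - move=> u _; apply: cderivB; last exact: cderiv_lin.
    by apply: cderivB; [exact: cderiv_cexp|exact: cderiv_cst].
  - by rewrite !mul0r cexp0 !subrr.
  - move=> u u01; rewrite subr0 (_ : _ - w = w * (cexp (u%:C%C * w) - 1)); last by ring.
    by rewrite cmodM expr2 -!mulrA ler_wpM2l// mulrA first.
  - by rewrite lexx ler01.
rewrite mul1r => /le_trans; apply.
rewrite subr0 expr1n ler_piMr ?mulr_ge0 ?exprn_ge0//.
by rewrite div1r invf_le1 ?ltr0n// ler1n.
Qed.

End ComplexExponential.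

(** * Fourier series on a strip *)

Section TrigonometricSeries.
Context {R : realType}.
Implicit Types (c d : int -> R[i]) (k : int) (z h : R[i]) (x : R).

Definition freq k : R := 2 * pi * k%:~R.

Definition ek k x : R[i] := expi (2 * k%:~R * pi * x).

Definition fser c x : R[i] := csum (fun k => c k * ek k x).

Definition cser c z : R[i] := csum (fun k => c k * cexp ((0 +i* freq k)%C * z)).

Definition Dx c k : R[i] := (0 +i* freq k)%C * c k.

Lemma ekE k x : ek k x = cexp ((0 +i* freq k)%C * x%:C%C).
Proof.
rewrite /ek -cexp_i; congr cexp; apply: complexP; rewrite ?cReM ?cImM /=.
  by rewrite mul0r mulr0 subr0.
by rewrite mul0r add0r /freq; ring.
Qed.

Lemma fserE c x : fser c x = cser c x%:C%C.
Proof. by apply: eq_csum => k; rewrite ekE. Qed.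

Lemma cmod_ek k x : cmod (ek k x) = 1.
Proof. exact: cmod_expi. Qed.

Lemma ekD k j x : ek (k + j) x = ek k x * ek j x.
Proof. by rewrite /ek -expiD intrD; congr expi; ring. Qed.

Lemma abnd_fser c M x : abnd c M -> abnd (fun k => c k * ek k x) M.
Proof. by apply: abnd_mono => k; rewrite cmodM cmod_ek mulr1. Qed.

Lemma cmod_fser c M x : abnd c M -> cmod (fser c x) <= M.
Proof. by move=> cM; apply/cmod_csum/abnd_fser. Qed.

Lemma cmod_freq k : cmod (0 +i* freq k)%C = 2 * pi * `|k%:~R|.
Proof. by rewrite cmodE /= expr0n add0r sqrtr_sqr /freq normrM ger0_norm// mulr_ge0// pi_ge0. Qed.

Lemma Dx_order1 k : cmod (0 +i* freq k)%C <= 1 * (1 + 2 * pi * `|k%:~R|).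
Proof. by rewrite mul1r cmod_freq lerDr. Qed.

Lemma wbnd_Dx (delta delta' : R) c M : delta' < delta -> wbnd delta c M ->
  wbnd delta' (Dx c) (1 * (1 + (delta - delta')^-1) * M).
Proof. by move=> dd; apply: wbnd_loss => //; exact: Dx_order1. Qed.

Lemma cmod_cexp_freq k z :
  cmod (cexp ((0 +i* freq k)%C * z)) <= wt `|complex.Im z| k.
Proof.
rewrite cmod_cexp cReM /= mul0r sub0r ler_expR (le_trans (ler_norm _))//.
rewrite normrN normrM /freq normrM [`|2 * pi|]ger0_norm ?mulr_ge0 ?pi_ge0//.
by rewrite -!mulrA [`|_| * `|complex.Im z|]mulrC.
Qed.

Lemma abnd_cser (delta : R) c M z : wbnd delta c M -> `|complex.Im z| <= delta ->
  abnd (fun k => c k * cexp ((0 +i* freq k)%C * z)) M.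
Proof.
move=> cM zd; apply: abnd_mono cM => k; rewrite cmod_wt cmodM mulrC.
rewrite ler_wpM2r ?cmod_ge0// (le_trans (cmod_cexp_freq _ _))//.
exact: wt_le.
Qed.

(** The quadratic error |k|^2 |h|^2 of each exponential is absorbed by the
   weights between |Im z| and delta. One quarter of this room is used for each of
   the two factors |k|, and one for the growth of the exponential itself. *)
Lemma cser_taylor (delta : R) c M z : wbnd delta c M -> `|complex.Im z| < delta ->
  exists K rho, [/\ 0 <= K, 0 < rho & forall h, cmod h < rho ->
    cmod (cser c (z + h) - cser c z - h * cser (Dx c) z) <= K * cmod h ^+ 2].
Proof.
move=> cM zd; pose a := (delta - `|complex.Im z|) / 4.
have a0 : 0 < a by rewrite divr_gt0// subr_gt0.
have M0 := wbnd_ge0 cM.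
have K0 : 0 <= (a^-1) ^+ 2 * M by rewrite mulr_ge0// exprn_ge0// invr_ge0 ltW.
exists ((a^-1) ^+ 2 * M), a; split => // h ha.
have zh : `|complex.Im (z + h)| <= delta.
  rewrite cImD (le_trans (ler_normD _ _))//.
  have : `|complex.Im h| < a by exact: le_lt_trans (Im_le_cmod _) ha.
  by rewrite /a; lra.
have D1 := wbnd_Dx zd cM.
have h1 := abnd_cser cM zh; have h2 := abnd_cser cM (ltW zd).
have h3 := abnd_cser D1 (lexx _).
rewrite /cser -(csumB h1 h2) -(csumZ h h3) -(csumB (abndB h1 h2) (abndZ (lexx _) h3)).
apply: cmod_csum.
have r0 : 0 <= (a^-1) ^+ 2 * cmod h ^+ 2 by rewrite mulr_ge0 ?exprn_ge0 ?cmod_ge0// invr_ge0 ltW.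
have -> : (a^-1) ^+ 2 * M * cmod h ^+ 2 = (a^-1) ^+ 2 * cmod h ^+ 2 * M by ring.
have rr (k : int) : cmod ((fun=> ((a^-1) ^+ 2 * cmod h ^+ 2)%:C%C) k) <= (a^-1) ^+ 2 * cmod h ^+ 2.
  by rewrite cmodR ger0_norm.
apply: abnd_mono (wbndZ r0 rr cM) => k /=.
rewrite cmod_wt cmodM cmodR ger0_norm//.
set u := (0 +i* freq k)%C.
rewrite mulrDr cexpD (_ : _ - _ = c k * (cexp (u * z) * (cexp (u * h) - 1 - u * h))); last first.
  by rewrite /Dx -/u; ring.
rewrite cmodM [leRHS](_ : _ = cmod (c k) * ((a^-1) ^+ 2 * cmod h ^+ 2 * wt delta k)); last by ring.
rewrite ler_wpM2l ?cmod_ge0// cmodM.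
have hc := cexp_taylor (u * h).
have hz := cmod_cexp_freq k z.
apply: (le_trans (ler_pM (cmod_ge0 _) (cmod_ge0 _) hz hc)).
rewrite cmodM cmod_freq; set X := 2 * pi * `|k%:~R|.
have X0 : 0 <= X by rewrite !mulr_ge0// pi_ge0.
have Xa : X <= a^-1 * expR (a * X).
  rewrite -ler_pdivrMl ?invr_gt0// invrK (le_trans _ (expR_ge1Dx _))//.
  by rewrite lerDr.
have Xh : expR (X * cmod h) <= expR (a * X) by rewrite ler_expR mulrC ler_wpM2r// ltW.
apply: (@le_trans _ _ (wt `|complex.Im z| k * ((a^-1 * expR (a * X) * cmod h) ^+ 2 * expR (a * X)))).
  have H0 := cmod_ge0 h.
  have Xh0 : 0 <= X * cmod h by exact: mulr_ge0.
  rewrite ler_wpM2l ?wt_ge0//; apply: ler_pM => //; rewrite ?exprn_ge0 ?expR_ge0//.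
  have le : X * cmod h <= a^-1 * expR (a * X) * cmod h by rewrite ler_wpM2r.
  by rewrite lerXn2r// nnegrE// (le_trans Xh0 le).
rewrite [leLHS](_ : _ = (a^-1) ^+ 2 * cmod h ^+ 2 * (wt `|complex.Im z| k * expR (a * X) ^+ 3)); last by ring.
rewrite ler_wpM2l//.
rewrite /wt -expRM_natl -expRD ler_expR.
have -> : 2 * pi * `|complex.Im z| * `|k%:~R| = X * `|complex.Im z| by rewrite /X; ring.
have -> : 2 * pi * delta * `|k%:~R| = X * delta by rewrite /X; ring.
rewrite (_ : 3%:R * (a * X) = X * (3 * a)); last by ring.
by rewrite -mulrDr ler_wpM2l// /a; move: zd; clear; lra.
Qed.

Lemma is_derive_small (f : R -> R) (x d : R) :
  (forall e : R, 0 < e -> exists rho : R, 0 < rho /\ forall h : R, h != 0 ->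
     `|h| < rho -> `|f (x + h) - f x - h * d| <= e * `|h|) ->
  is_derive x 1 f d.
Proof.
move=> hf.
have lim : h^-1 *: (f (h *: 1 + x) - f x) @[h --> 0^'] --> d.
  apply/cvgrPdist_le => e /hf[rho [rho0 hr]].
  near=> h.
  have h0 : h != 0 by near: h; exact: nbhs_dnbhs_neq.
  have hrho : `|h| < rho by near: h; exact: dnbhs0_lt.
  rewrite /GRing.scale/= mulr1 (addrC h x).
  have -> : d - h^-1 * (f (x + h) - f x) = - (h^-1 * (f (x + h) - f x - h * d)).
    by field.
  rewrite normrN normrM normfV ler_pdivrMl ?normr_gt0// [leRHS]mulrC.
  exact: hr.
apply: DeriveDef; first by apply/cvg_ex; exists d.
exact/cvg_lim.
Unshelve. all: by end_near.
Qed.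

Lemma is_derive_quad (f : R -> R) (x d K rho : R) : 0 < rho ->
  (forall h : R, `|h| < rho -> `|f (x + h) - f x - h * d| <= K * h ^+ 2) ->
  is_derive x 1 f d.
Proof.
move=> rho0 hK; apply: is_derive_small => e e0.
have K1 : 0 < `|K| + 1 by rewrite ltr_wpDl.
exists (Num.min rho (e / (`|K| + 1))); split; first by rewrite lt_min rho0 divr_gt0.
move=> h _; rewrite lt_min ltr_pdivlMr// => /andP[hr he].
apply: (le_trans (hK h hr)); rewrite -real_normK ?num_real// expr2 mulrA.
rewrite ler_wpM2r//; apply: le_trans (ltW he); rewrite mulrC ler_wpM2l//.
by rewrite (le_trans (ler_norm _))// lerDl.
Qed.

Lemma fser_deriv (delta : R) c M x : 0 < delta -> wbnd delta c M ->
  cderiv (fser c) x (fser (Dx c) x).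
Proof.
move=> d0 cM.
have zd : `|complex.Im (x%:C%C : R[i])| < delta by rewrite /= normr0.
have [K [rho [K0 rho0 hK]]] := cser_taylor cM zd.
have key (h : R) : `|h| < rho -> cmod (fser c (x + h) - fser c x - h%:C%C * fser (Dx c) x) <= K * h ^+ 2.
  move=> hr; rewrite !fserE rmorphD /= -[h ^+ 2]real_normK ?num_real// -cmodR.
  by apply: hK; rewrite cmodR.
split; apply: (is_derive_quad rho0) => h hr; apply: le_trans (key h hr).
  rewrite (_ : _ - _ = complex.Re (fser c (x + h) - fser c x - h%:C%C * fser (Dx c) x)).
    exact: Re_le_cmod.
  by rewrite !cReD !cReN cReM /= mul0r subr0.
rewrite (_ : _ - _ = complex.Im (fser c (x + h) - fser c x - h%:C%C * fser (Dx c) x)).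
  exact: Im_le_cmod.
by rewrite !cImD !cImN cImM /= mul0r addr0.
Qed.

Lemma fser_conv c d M N x : abnd c M -> abnd d N ->
  fser (conv c d) x = fser c x * fser d x.
Proof.
move=> cM dN.
have h := abnd_conv_fam cM dN.
have h' : abnd (fun p : int * int => (ek p.1 x) * (c p.2 * d (p.1 - p.2))) (M * N).
  by apply: abnd_mono h => p; rewrite cmodM cmod_ek mul1r.
rewrite /fser /conv.
have -> : (fun k => csum (fun j => c j * d (k - j)) * ek k x) =
    (fun k => csum (fun j => ek k x * (c j * d (k - j)))).
  by apply/funext => k; rewrite (csumZ _ (abnd_conv_row k cM dN)) mulrC.
rewrite (csum_swap h') mulrC -(csumZ _ (abnd_fser x cM)).
apply: eq_csum => j.
have shift_bij : bijective (fun k : int => k + j).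
  by exists (fun k => k - j) => k; rewrite ?addrK ?subrK.
have hj : abnd (fun k => ek k x * (c j * d (k - j))) (M * N) := abnd_col j h'.
rewrite (csum_bij shift_bij hj) mulrC -(csumZ _ (abnd_fser x dN)).
apply: eq_csum => k; rewrite addrK ekD.
by ring.
Qed.

End TrigonometricSeries.

(** * Integrals of classes of functions *)

Section IntegralAE.
Import HBNNSimple.
Local Open Scope ereal_scope.
Context d (T : measurableType d) (R : realType) (mu : {measure set T -> \bar R}).

(** The simple functions below f are multiplied by the indicator of the
   complement of N, which makes them lie below g. *)
Lemma ge0_le_ae_integral (f g : T -> \bar R) (N : set T) :
  (forall x, 0 <= f x) -> (forall x, 0 <= g x) -> measurable N -> mu N = 0 ->
  (forall x, ~ N x -> f x = g x) ->
  \int[mu]_x f x <= \int[mu]_x g x.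
Proof.
move=> f0 g0 mN N0 fg; rewrite !ge0_integralTE//.
apply: ge_ereal_sup => /= _ [h /= hf <-].
have mNc : measurable (~` N) by exact: measurableC.
have e : sintegral mu h = sintegral mu (proj_nnsfun h mNc).
  have -> : sintegral mu h = \int[mu]_x (h x)%:E by rewrite integral_nnsfun// patch_setT.
  have mh : measurable_fun setT (EFin \o (h : T -> R)) by exact/measurable_EFinP.
  have h0 : forall x, setT x -> 0 <= (EFin \o (h : T -> R)) x.
    by move=> x _; rewrite /= lee_fin fun_ge0.
  rewrite (ge0_negligible_integral mN measurableT mh h0 N0).
  rewrite setTD integral_nnsfun//; congr sintegral.
  by rewrite -mrestrict.
rewrite e; apply: ereal_sup_ubound => /=; exists (proj_nnsfun h mNc) => // x.
rewrite -mrestrict patchE; case: ifPn => // xN.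
by rewrite -fg//; exact: (set_mem xN).
Qed.

(** The classes of a solution may have non-measurable representatives, but the
   integral only sees the measurable simple functions below its argument. *)
Lemma ae_integral (D : set T) (f g : T -> \bar R) :
  {ae mu, forall x, f x = g x} -> \int[mu]_(x in D) f x = \int[mu]_(x in D) g x.
Proof.
move=> [N [mN N0 fgN]].
have fg x : ~ N x -> f x = g x by move=> Nx; apply: contrapT => h; apply: Nx; exact: fgN.
have pos (p q : T -> \bar R) : (forall x, 0 <= p x) -> (forall x, 0 <= q x) ->
    (forall x, ~ N x -> p x = q x) -> \int[mu]_(x in D) p x = \int[mu]_(x in D) q x.
  move=> p0 q0 e; rewrite integral_mkcond [RHS]integral_mkcond.
  have r0 (h : T -> \bar R) : (forall x, 0 <= h x) -> forall x, 0 <= (h \_ D) x.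
    by move=> h0 x; rewrite patchE; case: ifP.
  by apply/eqP; rewrite eq_le; apply/andP; split; apply: (ge0_le_ae_integral _ _ mN N0);
    try exact: r0; move=> x Nx; rewrite !patchE e.
rewrite integralE [RHS]integralE; congr (_ - _); apply: pos => //.
- by move=> x Nx; rewrite !funeposE fg.
- by move=> x Nx; rewrite !funenegE fg.
Qed.

End IntegralAE.

(** * Periodicity and almost everywhere equality *)

Section Translation.
Context {R : realType}.
Local Notation mu := (@lebesgue_measure R).

Lemma ae_mono (P Q : R -> Prop) : (forall x, P x -> Q x) ->
  {ae mu, forall x, P x} -> {ae mu, forall x, Q x}.
Proof. by move=> PQ; apply: negligibleS => x /= nQ /PQ. Qed.

Lemma ae_mono2 (P1 P2 Q : R -> Prop) : (forall x, P1 x -> P2 x -> Q x) ->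
  {ae mu, forall x, P1 x} -> {ae mu, forall x, P2 x} -> {ae mu, forall x, Q x}.
Proof.
move=> PQ h1 h2; apply: negligibleS (negligibleU h1 h2) => x /= nQ.
have [p1|] := pselect (P1 x); [right => p2|by left].
exact/nQ/PQ.
Qed.

Lemma lebesgue_measure_shift (a : R) (A : set R) : measurable A ->
  mu [set x | A (x + a)] = mu A.
Proof.
move=> mA.
have mS : measurable_fun setT (fun x : measurableTypeR R => (x + a : measurableTypeR R)).
  exact: measurable_funD.
rewrite [RHS](@lebesgue_measure_unique R (pushforward mu (fun x : measurableTypeR R => (x + a : measurableTypeR R))))//.
move=> _ [[b c] _ <-].
transitivity (mu `](b - a), (c - a)]%classic); last first.
  by congr (mu _); apply/seteqP; split => x /=; rewrite !in_itv/= ltrBlDr lerBrDr.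
rewrite /= !lebesgue_measure_itv/= !lte_fin ltrD2r; case: ifP => // _.
by rewrite -!EFinB; congr (_%:E); ring.
Qed.

Lemma negligible_shift (a : R) (A : set R) : mu.-negligible A ->
  mu.-negligible [set x | A (x + a)].
Proof.
move=> [N [mN N0 AN]]; exists [set x | N (x + a)]; split.
- have mS : measurable_fun setT (fun x : measurableTypeR R => (x + a : measurableTypeR R)).
    exact: measurable_funD.
  by rewrite -[X in measurable X]setTI; exact: mS.
- by rewrite -[RHS]N0; exact: lebesgue_measure_shift.
- by move=> x /= /AN.
Qed.

Lemma periodic_int (T : Type) (f : R -> T) (n : int) x : (forall x, f (x + 1) = f x) ->
  f (x + n%:~R) = f x.
Proof.
move=> fp.
have pos (m : nat) y : f (y + m%:R) = f y.
  by elim: m y => [|m IH] y; rewrite ?addr0// -natr1 addrA fp IH.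
case: n => n; first by rewrite -pmulrn pos.
by rewrite NegzE mulrNz -(pos n.+1 (x - _)) -pmulrn subrK.
Qed.

(** The line is a countable union of translates of [0, 1]. *)
Lemma ae_periodic (P : R -> Prop) : (forall x, P (x + 1) = P x) ->
  {ae mu, forall x, `[0, 1]%classic x -> P x} -> {ae mu, forall x, P x}.
Proof.
move=> Pp aeP.
have : mu.-negligible (\bigcup_(n in setT) [set x | ~ (`[0, 1]%classic (x + n%:R) -> P (x + n%:R))] `|`
    \bigcup_(n in setT) [set x | ~ (`[0, 1]%classic (x + (- n%:R)) -> P (x + (- n%:R)))]).
  apply: negligibleU; apply: negligible_bigcup => n; exact: (negligible_shift _ aeP).
apply: negligibleS => x /= nPx.
have e (n : int) : P (x + n%:~R) = P x := periodic_int n x Pp.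
have h01 : `[0, 1]%classic (x + (- Num.floor x)%:~R).
  rewrite /= in_itv/= mulrNz subr_ge0 ge_floor/= lerBlDl.
  by rewrite -[X in _ + X]/(1%:~R) -intrD ltW// lt_succ_floor.
case E : (- Num.floor x) => [n|n]; rewrite E in h01.
  left; exists n => //= h; apply: nPx; rewrite -(e n%:Z); apply: h.
  by rewrite -[n%:R]/(n%:Z%:~R) in h01 *.
right; exists n.+1 => //= h; apply: nPx; rewrite -(e (Negz n)).
by move: h01; rewrite NegzE mulrNz; apply: h.
Qed.

Lemma ae_eq_continuous (f g : R -> R) : continuous f -> continuous g ->
  {ae mu, forall x, f x = g x} -> f = g.
Proof.
move=> cf cg [N [mN N0 fgN]]; apply/funext => x; apply: contrapT => fgx.
have ch : {for x, continuous (fun y => f y - g y)}.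
  by apply: cvgB; [exact: cf|exact: cg].
have hx : f x - g x != 0 by rewrite subr_eq0; apply/eqP.
have [e /= e0 he] : \forall y \near x, f y - g y != 0.
  exact: (cvgr_neq0 (f x - g x) ch hx).
have sub : ball x e `<=` N.
  by move=> y /he fgy; apply: fgN => /= fgy'; rewrite fgy' subrr eqxx in fgy.
have : (mu (ball x e) <= mu N)%E by apply: le_measure; rewrite ?inE//; exact: measurable_ball.
by rewrite N0 (lebesgue_measure_ball _ (ltW e0)) lee_fin leNgt pmulrn_lgt0// e0.
Qed.

End Translation.

(** * Mean over the circle *)

Section MeanValue.
Context {R : realType}.
Implicit Types (f g : R -> R[i]).
Local Notation mu := (@lebesgue_measure R).
Local Notation I01 := (`[0%R, 1%R]%classic : set R).

Definition rint (f : R -> R) := mu.-integrable I01 (EFin \o f).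

Definition pint f := rint (reF f) /\ rint (imF f).

Lemma ae_mean f g : ae_equal f g -> mean f = mean g.
Proof.
move=> fg; rewrite /mean; congr (_ +i* _)%C; congr fine; apply: ae_integral;
  by apply: ae_mono fg => x; rewrite /reF /imF => ->.
Qed.

Lemma ae_fourier f g : ae_equal f g -> fourier f = fourier g.
Proof.
move=> fg; apply/funext => k; apply: ae_mean.
by apply: ae_mono fg => x ->.
Qed.

Lemma eq_mean f g : f =1 g -> mean f = mean g.
Proof. by move=> /funext ->. Qed.

Lemma measurable_01 : measurable (`[0%R, 1%R]%classic : set (measurableTypeR R)).
Proof. exact: measurable_itv. Qed.

Lemma lebesgue_01 : mu I01 = 1%E.
Proof. by rewrite lebesgue_measure_itv/= lte_fin ltr01 oppr0 adde0. Qed.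

Lemma rintD (f g : R -> R) : rint f -> rint g -> rint (fun x => f x + g x).
Proof. by move=> hf hg; exact: (integrableD measurable_01 hf hg). Qed.

Lemma rintZ (c : R) (f : R -> R) : rint f -> rint (fun x => c * f x).
Proof. by move=> hf; exact: (integrableZl measurable_01 c hf). Qed.

Lemma rintN (f : R -> R) : rint f -> rint (fun x => - f x).
Proof.
move=> /(rintZ (-1)); rewrite /rint; congr (mu.-integrable _ (EFin \o _)).
by apply/funext => x; rewrite mulN1r.
Qed.

Lemma pintD f g : pint f -> pint g -> pint (fun x => f x + g x).
Proof.
move=> [f1 f2] [g1 g2]; split.
- have := rintD f1 g1; rewrite /rint; congr (mu.-integrable _ (EFin \o _)).
  by apply/funext => x; rewrite /reF cReD.
- have := rintD f2 g2; rewrite /rint; congr (mu.-integrable _ (EFin \o _)).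
  by apply/funext => x; rewrite /imF cImD.
Qed.

Lemma pintZ (c : R[i]) f : pint f -> pint (fun x => c * f x).
Proof.
move=> [f1 f2]; split.
- have := rintD (rintZ (complex.Re c) f1) (rintN (rintZ (complex.Im c) f2)).
  rewrite /rint; congr (mu.-integrable _ (EFin \o _)).
  by apply/funext => x; rewrite /reF cReM.
- have := rintD (rintZ (complex.Re c) f2) (rintZ (complex.Im c) f1).
  rewrite /rint; congr (mu.-integrable _ (EFin \o _)).
  by apply/funext => x; rewrite /imF cImM.
Qed.

Lemma meanD f g : pint f -> pint g -> mean (fun x => f x + g x) = mean f + mean g.
Proof.
move=> [f1 f2] [g1 g2]; apply: complexP; rewrite ?cReD ?cImD /=.
  rewrite -(RintegralD measurable_01 f1 g1); apply: eq_Rintegral => x _.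
  by rewrite /reF cReD.
rewrite -(RintegralD measurable_01 f2 g2); apply: eq_Rintegral => x _.
by rewrite /imF cImD.
Qed.

Lemma meanZ (c : R[i]) f : pint f -> mean (fun x => c * f x) = c * mean f.
Proof.
move=> [f1 f2]; apply: complexP; rewrite ?cReM ?cImM /=.
  rewrite -(RintegralZl _ measurable_01 f1) -(RintegralZl _ measurable_01 f2).
  rewrite -(RintegralB measurable_01 (rintZ _ f1) (rintZ _ f2)).
  by apply: eq_Rintegral => x _; rewrite /reF cReM.
rewrite -(RintegralZl _ measurable_01 f1) -(RintegralZl _ measurable_01 f2).
rewrite -(RintegralD measurable_01 (rintZ _ f2) (rintZ _ f1)).
by apply: eq_Rintegral => x _; rewrite /imF cImM.
Qed.

Lemma pintN f : pint f -> pint (fun x => - f x).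
Proof. by move=> /(pintZ (-1)); congr pint; apply/funext => x; rewrite mulN1r. Qed.

Lemma pintB f g : pint f -> pint g -> pint (fun x => f x - g x).
Proof. by move=> pf /pintN; exact: pintD. Qed.

Lemma meanB f g : pint f -> pint g -> mean (fun x => f x - g x) = mean f - mean g.
Proof.
move=> pf pg; rewrite (meanD pf (pintN pg)); congr (_ + _).
by rewrite -mulN1r -(meanZ (-1) pg); apply: eq_mean => x; rewrite mulN1r.
Qed.

Lemma le_Rint_bound (f : R -> R) M : rint f -> (forall x, `|f x| <= M) ->
  `|Rintegral mu I01 f| <= M.
Proof.
move=> fi fM; apply: (le_trans (le_normr_Rintegral measurable_01 fi)).
have e : Rintegral mu I01 (fun=> M) = M.
  transitivity (M * fine (mu I01)); first exact: (@Rintegral_cst _ _ _ mu _ measurable_01 M).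
  by rewrite lebesgue_01 mulr1.
rewrite -[leRHS]e.
apply: (le_Rintegral measurable_01) => //.
- by apply: (integrable_norm fi).
- apply: continuous_compact_integrable; first exact: segment_compact.
  by apply: continuous_subspaceT => x; exact: cvg_cst.
Qed.

(** The factor 2 comes from bounding the real and imaginary parts separately. *)
Lemma cmod_mean f M : pint f -> (forall x, cmod (f x) <= M) -> cmod (mean f) <= 2 * M.
Proof.
move=> [f1 f2] fM; apply: (le_trans (cmod_le_ReIm _)).
rewrite mulr_natl mulr2n; apply: lerD; apply: le_Rint_bound => // x.
- exact: le_trans (Re_le_cmod _) (fM x).
- exact: le_trans (Im_le_cmod _) (fM x).
Qed.

Definition ccont f := continuous (reF f) /\ continuous (imF f).

Lemma ccont_pint f : ccont f -> pint f.
Proof.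
move=> [c1 c2]; split; apply: continuous_compact_integrable.
- exact: segment_compact.
- by apply: continuous_subspaceT => x; exact: c1.
- exact: segment_compact.
- by apply: continuous_subspaceT => x; exact: c2.
Qed.

Lemma cderiv_ccont f f' : (forall x, cderiv f x (f' x)) -> ccont f.
Proof.
by move=> df; split=> x; have [d1 d2] := df x; exact: (is_derive_continuous d1) || exact: (is_derive_continuous d2).
Qed.

Lemma ccontM f g : ccont f -> ccont g -> ccont (fun x => f x * g x).
Proof.
move=> [f1 f2] [g1 g2]; split => x.
- have -> : reF (fun x => f x * g x) = (fun x => reF f x * reF g x - imF f x * imF g x).
    by apply/funext => y; rewrite /reF cReM.
  by apply: cvgB; apply: cvgM; [exact: f1|exact: g1|exact: f2|exact: g2].
- have -> : imF (fun x => f x * g x) = (fun x => reF f x * imF g x + imF f x * reF g x).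
    by apply/funext => y; rewrite /imF cImM.
  by apply: cvgD; apply: cvgM; [exact: f1|exact: g2|exact: f2|exact: g1].
Qed.

Lemma mean_deriv f f' : (forall x, cderiv f x (f' x)) -> ccont f' ->
  mean f' = f 1 - f 0.
Proof.
move=> df [c1 c2].
have ftc (h h' : R -> R) : (forall x : R, is_derive x 1 h (h' x)) -> continuous h' ->
    Rintegral mu I01 h' = h 1 - h 0.
  move=> dh ch; rewrite /Rintegral (@continuous_FTC2 _ h' h)//.
  - exact: continuous_subspaceT.
  - split.
    + by move=> x _; have [] := dh x.
    + by apply: cvg_at_right_filter; exact: (is_derive_continuous (dh 0)).
    + by apply: cvg_at_left_filter; exact: (is_derive_continuous (dh 1)).
  - by move=> x _; rewrite derive1E; have [_ ->] := dh x.
apply: complexP; rewrite ?cReD ?cImD ?cReN ?cImN /=.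
- exact: (ftc (fun s => complex.Re (f s)) (reF f') (fun x => proj1 (df x)) c1).
- exact: (ftc (fun s => complex.Im (f s)) (imF f') (fun x => proj2 (df x)) c2).
Qed.

End MeanValue.

(** * Fourier coefficients *)

Section FourierCoefficients.
Context {R : realType}.
Implicit Types (f g : R -> R[i]) (k m : int).
Local Notation mu := (@lebesgue_measure R).
Local Notation I01 := (`[0%R, 1%R]%classic : set R).

Lemma rint_mul (f h : R -> R) M : rint f -> continuous h -> (forall x, `|h x| <= M) ->
  rint (fun x => f x * h x).
Proof.
move=> fi hc hM.
have mh : measurable_fun I01 h.
  by apply: subspace_continuous_measurable_fun; [exact: measurable_01|exact: continuous_subspaceT].
have bh : [bounded h x | x in I01].
  exists M; split; first exact: num_real.
  by move=> N MN x _; exact: le_trans (hM x) (ltW MN).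
exact: (integrableMl measurable_01 fi mh bh).
Qed.

Lemma pint_mul f g M : pint f -> ccont g -> (forall x, cmod (g x) <= M) ->
  pint (fun x => f x * g x).
Proof.
move=> [f1 f2] [g1 g2] gM.
have r x : `|reF g x| <= M by exact: le_trans (Re_le_cmod _) (gM x).
have i x : `|imF g x| <= M by exact: le_trans (Im_le_cmod _) (gM x).
split.
- have := rintD (rint_mul f1 g1 r) (rintN (rint_mul f2 g2 i)).
  rewrite /rint; congr (mu.-integrable _ (EFin \o _)).
  by apply/funext => x; rewrite /reF cReM.
- have := rintD (rint_mul f1 g2 i) (rint_mul f2 g1 r).
  rewrite /rint; congr (mu.-integrable _ (EFin \o _)).
  by apply/funext => x; rewrite /imF cImM.
Qed.

Lemma cderiv_ek k (x : R) : cderiv (ek k) x ((0 +i* freq k)%C * ek k x).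
Proof.
have -> : ek k = (fun s : R => cexp (s%:C%C * (0 +i* freq k)%C)).
  by apply/funext => s; rewrite ekE mulrC.
exact: cderiv_cexp.
Qed.

Lemma ccont_ek k : ccont (@ek R k).
Proof. exact: cderiv_ccont (cderiv_ek k). Qed.

Lemma ek0 (x : R) : ek 0 x = 1.
Proof. by rewrite /ek mulr0 !mul0r expi0. Qed.

Lemma expi_2pi k : expi (2 * pi * k%:~R : R) = 1.
Proof.
rewrite /expi.
have c (n : nat) : cos (2 * pi * n%:R : R) = 1 /\ sin (2 * pi * n%:R : R) = 0.
  elim: n => [|n [IH1 IH2]]; first by rewrite mulr0 cos0 sin0.
  have -> : 2 * pi * n.+1%:R = 2 * pi * n%:R + pi *+ 2 :> R by rewrite -natr1; ring.
  split.
    by rewrite cosD IH1 IH2 cos2pi mul0r subr0 mulr1.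
  by rewrite sinD IH1 IH2 cos2pi mul0r add0r mul1r mulr2n sinDpi sinpi oppr0.
case: k => n; first by rewrite -pmulrn; have [-> ->] := c n.
rewrite NegzE mulrNz mulrN cosN sinN -pmulrn; have [-> ->] := c n.+1.
by rewrite oppr0.
Qed.

Lemma ek_periodic k (x : R) : ek k (x + 1) = ek k x.
Proof.
rewrite /ek (_ : 2 * k%:~R * pi * (x + 1) = 2 * k%:~R * pi * x + 2 * pi * k%:~R).
  by rewrite expiD expi_2pi mulr1.
by ring.
Qed.

Lemma freq_eq0 k : (freq k == 0 :> R) = (k == 0).
Proof.
rewrite /freq mulf_eq0 intr_eq0 mulf_eq0 pnatr_eq0 /=.
by rewrite gt_eqF// pi_gt0.
Qed.

Lemma mean_ek k : mean (@ek R k) = if k == 0 then 1 else 0.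
Proof.
case: ifPn => [/eqP ->|k0].
  have -> : @ek R 0 = (fun x => cst 1 x) by apply/funext => x; rewrite ek0.
  apply: complexP.
    transitivity (Rintegral mu I01 (cst 1)); first by [].
    transitivity (1 * fine (mu I01)); first exact: (@Rintegral_cst _ _ _ mu _ measurable_01 1).
    by rewrite lebesgue_01 mulr1.
  transitivity (Rintegral mu I01 (cst 0)); first by [].
  transitivity (0 * fine (mu I01)); first exact: (@Rintegral_cst _ _ _ mu _ measurable_01 0).
  by rewrite mul0r.
have f0 : (0 +i* freq k)%C != 0 :> R[i].
  by rewrite eq_complex /= eqxx /= freq_eq0.
have pe := ccont_pint (ccont_ek k).
have h : mean (fun x : R => (0 +i* freq k)%C * ek k x) = 0.
  have cc : ccont (fun x : R => (0 +i* freq k)%C * ek k x).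
    apply: (@ccontM _ (fun=> (0 +i* freq k)%C) _ _ (ccont_ek k)).
    by split => x; exact: cvg_cst.
  transitivity (@ek R k 1 - ek k 0); first exact: mean_deriv (cderiv_ek k) cc.
  by rewrite -[1 in X in X - _]add0r ek_periodic subrr.
by move: h; rewrite (meanZ _ pe) => /eqP; rewrite mulf_eq0 (negPf f0) => /eqP.
Qed.

Lemma fourierE f k : fourier f k = mean (fun x => f x * ek (- k) x).
Proof.
apply: eq_mean => x; congr (_ * _); rewrite /ek; congr expi.
by rewrite mulrNz; ring.
Qed.

Lemma mean_fourier f : mean f = fourier f 0.
Proof. by rewrite fourierE; apply: eq_mean => x; rewrite oppr0 ek0 mulr1. Qed.

Lemma pint_ek f k : pint f -> pint (fun x => f x * ek k x).
Proof.
move=> pf; apply: (pint_mul pf (ccont_ek k) (M := 1)) => x.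
by rewrite cmod_ek.
Qed.

Lemma fourierD f g k : pint f -> pint g ->
  fourier (fun x => f x + g x) k = fourier f k + fourier g k.
Proof.
move=> pf pg; rewrite !fourierE -(meanD (pint_ek _ pf) (pint_ek _ pg)).
by apply: eq_mean => x; rewrite mulrDl.
Qed.

Lemma fourierZ (c : R[i]) f k : pint f -> fourier (fun x => c * f x) k = c * fourier f k.
Proof.
move=> pf; rewrite !fourierE -(meanZ _ (pint_ek _ pf)).
by apply: eq_mean => x; rewrite mulrA.
Qed.

Lemma fourierB f g k : pint f -> pint g ->
  fourier (fun x => f x - g x) k = fourier f k - fourier g k.
Proof.
move=> pf pg; rewrite !fourierE -(meanB (pint_ek _ pf) (pint_ek _ pg)).
by apply: eq_mean => x; rewrite mulrBl.
Qed.

Lemma ccont_fser (delta : R) c M : 0 < delta -> wbnd delta c M -> ccont (fser c).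
Proof. by move=> d0 cM; exact: cderiv_ccont (fun x => fser_deriv x d0 cM). Qed.

Lemma fser_periodic c (x : R) : fser c (x + 1) = fser c x.
Proof. by apply: eq_csum => k; rewrite ek_periodic. Qed.

Lemma pint_sum (s : seq int) (F : int -> R -> R[i]) : (forall j, pint (F j)) ->
  pint (fun x => \sum_(j <- s) F j x) /\
  mean (fun x => \sum_(j <- s) F j x) = \sum_(j <- s) mean (F j).
Proof.
move=> pF; elim: s => [|j s [IH1 IH2]].
  have -> : (fun x : R => \sum_(j <- [::]) F j x) = (fun x => 0 * ek 0 x).
    by apply/funext => x; rewrite big_nil mul0r.
  have pe := ccont_pint (ccont_ek 0).
  by split; [exact: pintZ|rewrite big_nil (meanZ _ pe) mul0r].
have -> : (fun x : R => \sum_(j <- j :: s) F j x) = (fun x => F j x + \sum_(j <- s) F j x).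
  by apply/funext => x; rewrite big_cons.
by split; [exact: pintD|rewrite big_cons (meanD (pF j) IH1) IH2].
Qed.

(** Integrating finite partial sums against the characters is exact; the
   remaining tail is uniformly small. *)
Lemma fourier_fser (delta : R) c M k : 0 < delta -> wbnd delta c M ->
  fourier (fser c) k = c k.
Proof.
move=> d0 cM; have cA := wbnd_abnd (ltW d0) cM.
have pc := ccont_pint (ccont_fser d0 cM).
apply/eqP; rewrite -subr_eq0; apply/eqP/cmod_eq0/eqP; rewrite eq_le cmod_ge0 andbT.
apply/ler_addgt0Pl => e e0; rewrite addr0.
have e20 : 0 < e / 2 by rewrite divr_gt0.
have [s0 hs] := abnd_tail cA e20.
pose s := undup (k :: s0).
have us : uniq s by exact: undup_uniq.
have tail : abnd (fun j => if j \in s then 0 else c j) (e / 2).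
  by apply: hs => // j js; rewrite mem_undup inE js orbT.
pose F j x := c j * (ek j x * ek (- k) x).
have pF j : pint (F j) by apply/pintZ/pint_ek/ccont_pint/ccont_ek.
have mF j : mean (F j) = if j == k then c j else 0.
  rewrite (meanZ _ (pint_ek _ (ccont_pint (ccont_ek j)))).
  have -> : (fun x => ek j x * ek (- k) x) = @ek R (j - k) by apply/funext => x; rewrite ekD.
  by rewrite mean_ek subr_eq0; case: ifP; rewrite ?mulr1 ?mulr0.
have [pS mS] := pint_sum s pF.
have cE : c k = mean (fun x => \sum_(j <- s) F j x).
  rewrite mS (bigD1_seq k)//=; last by rewrite mem_undup mem_head.
  rewrite mF eqxx big1 ?addr0// => j /negPf jk.
  by rewrite mF jk.
rewrite cE fourierE -(meanB (pint_ek _ pc) pS).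
apply: (le_trans (cmod_mean (M := e / 2) _ _)).
- exact: pintB (pint_ek _ pc) pS.
- move=> x.
  have -> : fser c x * ek (- k) x - \sum_(j <- s) F j x =
     (fser c x - \sum_(j <- s) c j * ek j x) * ek (- k) x.
    by rewrite mulrBl mulr_suml; congr (_ - _); apply: eq_bigr => j _; rewrite /F mulrA.
  rewrite cmodM cmod_ek mulr1 /fser (csum_off us (abnd_fser x cA)).
  apply: cmod_csum; apply: abnd_mono tail => j.
  by case: ifP; rewrite ?cmod0// cmodM cmod_ek mulr1.
- by rewrite mulrC divfK// pnatr_eq0.
Qed.

Lemma circle_integral (g : R -> \bar R) : measurable_fun setT g -> (forall x, 0 <= g x)%E ->
  (\int[circle_measure]_x g x = \int[mu]_(x in I01) g x)%E.
Proof.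
move=> mg g0.
have mC : measurable (~` (I01 : set (measurableTypeR R))) by apply: measurableC; exact: measurable_01.
rewrite (@ge0_negligible_integral _ _ _ circle_measure setT (~` I01))//.
  rewrite setTD setCK; apply: eq_measure_integral => A mA AI.
  by rewrite /circle_measure /mrestr /=; congr (mu _); apply/setIidPl.
transitivity (mu set0); last exact: measure0.
by rewrite /circle_measure /mrestr /=; congr (mu _); exact: setICl.
Qed.

Lemma circle_measureT : (circle_measure [set: R] = 1 :> \bar R)%E.
Proof.
transitivity (mu I01); last exact: lebesgue_01.
by rewrite /circle_measure /mrestr /=; congr (mu _); exact: setTI.
Qed.

Lemma L2_pint f : L2 f -> pint f.
Proof.
have key (h : R -> R) : h \in Lfun circle_measure 2%:E -> rint h.
  move=> hL.
  have := Lfun_subset12 _ hL; rewrite circle_measureT => /(_ isT)/Lfun1_integrable.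
  move=> /integrableP[mh ih]; apply/integrableP; split.
    exact: measurable_funS mh.
  rewrite -circle_integral//.
  exact: measurableT_comp.
by move=> [_ /key h1 /key h2].
Qed.

Lemma L2_bounded f M : (forall x, f (x + 1) = f x) -> ccont f ->
  (forall x, cmod (f x) <= M) -> L2 f.
Proof.
move=> fp [c1 c2] fM.
have key (h : R -> R) : continuous h -> (forall x, `|h x| <= M) ->
    h \in Lfun circle_measure 2%:E.
  move=> ch hM; rewrite inE; apply/andP; split.
    by rewrite inE/=; exact: continuous_measurable_fun.
  rewrite inE/= /finite_norm unlock /Lnorm poweR_lty//.
  have mh : measurable_fun setT (fun x : measurableTypeR R => (`|h x| `^ 2)%:E).
    apply: measurableT_comp => //; apply: (measurableT_comp (measurable_powR _)) => //.
    by apply: measurableT_comp => //; exact: continuous_measurable_fun.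
  apply: (@le_lt_trans _ _ (\int[circle_measure]_(x in setT) (M `^ 2)%:E)%E).
    apply: ge0_le_integral => //.
      by move=> x _; rewrite lee_fin powR_ge0.
    move=> x _; rewrite lee_fin; apply: ge0_ler_powR => //.
    by rewrite nnegrE (le_trans (normr_ge0 (h 0)) (hM 0)).
  by rewrite integral_cst// circle_measureT mule1 ltry.
split.
- by move=> x; rewrite fp.
- by apply: key => // x; exact: le_trans (Re_le_cmod _) (fM x).
- by apply: key => // x; exact: le_trans (Im_le_cmod _) (fM x).
Qed.

Lemma L2_fser (delta : R) c M : 0 < delta -> wbnd delta c M -> L2 (fser c).
Proof.
move=> d0 cM; apply: (@L2_bounded _ M).
- by move=> x; rewrite fser_periodic.
- exact: ccont_fser cM.
- by move=> x; apply: cmod_fser; exact: wbnd_abnd (ltW d0) cM.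
Qed.

Lemma Lfun2_lin (a : R) (u v : R -> R) : u \in Lfun circle_measure 2%:E ->
  v \in Lfun circle_measure 2%:E -> (fun x => a * u x + v x) \in Lfun circle_measure 2%:E.
Proof.
move=> hu hv.
have p1 : (1 <= 2%:E :> \bar R)%E by rewrite lee_fin ler1n.
exact: (proj2 (Lfun_submod_closed circle_measure p1) a _ _ hu hv).
Qed.

Lemma L2_lin (c : R[i]) f g : L2 f -> L2 g -> L2 (fun x => c * f x + g x).
Proof.
move=> [pf f1 f2] [pg g1 g2]; split.
- by move=> x; rewrite pf pg.
- rewrite (_ : reF _ = fun x => complex.Re c * reF f x + (- complex.Im c * imF f x + reF g x)).
    exact: Lfun2_lin f1 (Lfun2_lin _ f2 g1).
  by apply/funext => x; rewrite /reF cReD cReM mulNr addrA.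
- rewrite (_ : imF _ = fun x => complex.Re c * imF f x + (complex.Im c * reF f x + imF g x)).
    exact: Lfun2_lin f2 (Lfun2_lin _ f1 g2).
  by apply/funext => x; rewrite /imF cImD cImM addrA.
Qed.

Lemma L2_0 : L2 (fun=> 0 : R[i]).
Proof.
apply: (@L2_bounded _ 0) => //; last by move=> x; rewrite cmod0.
by split => x; exact: cvg_cst.
Qed.

End FourierCoefficients.

(** * Functions with vanishing Fourier coefficients *)

Section FourierUniqueness.
Context {R : realType}.
Implicit Types (f g : R -> R[i]) (k : int) (x y : R).
Local Notation mu := (@lebesgue_measure R).
Local Notation I01 := (`[0%R, 1%R]%classic : set R).

(** By the product formula for sines this is a trigonometric polynomial in x,
   and its sign changes make it exceed 1/2 on ]0, y[ and fall below 1/2 on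
   ]y, 1[. *)
Definition bump y x : R := 2^-1 + 2^-1 * (sin (pi * x) * sin (pi * (y - x))).

Lemma bump01 y x : 0 <= bump y x <= 1.
Proof.
have h : `|sin (pi * x) * sin (pi * (y - x))| <= 1.
  by rewrite normrM mulr_ile1// ler_norml sin_geN1 sin_le1.
move: h; rewrite ler_norml /bump => /andP[]; set s := sin _ * _ => h1 h2.
by apply/andP; split; lra.
Qed.

Lemma bump_trig y x : (bump y x)%:C%C = (2^-1 - 4^-1 * cos (pi * y))%:C%C
  + (8^-1)%:C%C * expi (- (pi * y)) * ek 1 x + (8^-1)%:C%C * expi (pi * y) * ek (- 1) x.
Proof.
have e1 : 2 * 1%:~R * pi * x = pi * x + pi * x :> R by rewrite mulr1; ring.
have e2 : 2 * (-1)%:~R * pi * x = - (pi * x + pi * x) :> R by rewrite mulrN1z; ring.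
rewrite /bump /ek e1 e2 mulrBr sinB.
have := cos2Dsin2 (pi * x); have := cos2Dsin2 (pi * y).
set a := pi * x; set b := pi * y => hb ha.
apply: complexP; rewrite ?cReD ?cImD !(cReM, cImM) /= ?cosN ?sinN !(cosD, sinD).
  move: (cos a) (sin a) (cos b) (sin b) ha => ca sa cb sb ha.
  have h : cb * ca ^+ 2 = cb - cb * sa ^+ 2.
    have -> : ca ^+ 2 = 1 - sa ^+ 2 by lra.
    by ring.
  by rewrite !mul0r; lra.
by ring.
Qed.

(** Stable under multiplication by trigonometric polynomials. *)
Definition fnull g := pint g /\ forall k, fourier g k = 0.

Lemma fnull_lin (a b : R[i]) f g : fnull f -> fnull g -> fnull (fun x => a * f x + b * g x).
Proof.
move=> [pf f0] [pg g0]; split; first by apply: pintD; exact: pintZ.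
by move=> k; rewrite (fourierD _ (pintZ a pf) (pintZ b pg)) !fourierZ// f0 g0 !mulr0 addr0.
Qed.

Lemma fnull_ek g j : fnull g -> fnull (fun x => ek j x * g x).
Proof.
move=> [pg g0]; split.
  have := pint_ek j pg; congr pint; apply/funext => x; exact: mulrC.
move=> k; rewrite fourierE -(g0 (k - j)) fourierE; apply: eq_mean => x.
by rewrite opprB addrC ekD; ring.
Qed.

Lemma fnull_bump g y : fnull g -> fnull (fun x => (bump y x)%:C%C * g x).
Proof.
move=> hg.
have h1 := fnull_lin 1 ((8^-1)%:C%C * expi (- (pi * y)))
  (fnull_lin (2^-1 - 4^-1 * cos (pi * y))%:C%C 0 hg hg) (fnull_ek 1 hg).
have := fnull_lin 1 ((8^-1)%:C%C * expi (pi * y)) h1 (fnull_ek (-1) hg).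
congr fnull; apply/funext => x; rewrite bump_trig.
by ring.
Qed.

(** By the two Bernoulli inequalities this polynomial in Y tends to 1 for
   Y < 1/2 and to 0 for Y > 1/2. *)
Definition stepper n (Y : R) : R := (1 - Y ^+ n) ^+ (2 ^ n)%N.

Lemma fnull_stepper g y n : fnull g -> fnull (fun x => (stepper n (bump y x))%:C%C * g x).
Proof.
move=> hg; rewrite /stepper.
have pw m g' : fnull g' -> fnull (fun x => (bump y x ^+ m)%:C%C * g' x).
  move=> hg'; elim: m => [|m IH].
    by move: hg'; congr fnull; apply/funext => x; rewrite expr0 mul1r.
  have := fnull_bump y IH; congr fnull; apply/funext => x.
  by rewrite exprS rmorphM /= mulrA.
elim: (2 ^ n)%N => [|m IH].
  by move: hg; congr fnull; apply/funext => x; rewrite expr0 mul1r.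
have := fnull_lin 1 (-1) IH (pw n _ IH); congr fnull; apply/funext => x.
by rewrite exprS !rmorphM /= rmorphB /= rmorph1; ring.
Qed.

Lemma bernoulli_sub (a : R) m : 0 <= a <= 1 -> 1 - m%:R * a <= (1 - a) ^+ m.
Proof.
move=> /andP[a0 a1]; elim: m => [|m IH]; first by rewrite mul0r subr0 expr0.
rewrite exprS -natr1; apply: (@le_trans _ _ ((1 - a) * (1 - m%:R * a))).
  have : 0 <= m%:R * a * a by rewrite !mulr_ge0.
  by nra.
by rewrite ler_wpM2l// subr_ge0.
Qed.

Lemma bernoulli_add (a : R) m : 0 <= a -> 1 + m%:R * a <= (1 + a) ^+ m.
Proof.
move=> a0; elim: m => [|m IH]; first by rewrite mul0r addr0 expr0.
rewrite exprS -natr1; apply: (@le_trans _ _ ((1 + a) * (1 + m%:R * a))).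
  have : 0 <= m%:R * a * a by rewrite !mulr_ge0.
  by nra.
by rewrite ler_wpM2l// addr_ge0.
Qed.

Lemma stepper01 n Y : 0 <= Y <= 1 -> 0 <= stepper n Y <= 1.
Proof.
move=> /andP[Y0 Y1]; have h0 : 0 <= Y ^+ n by exact: exprn_ge0.
have h1 : Y ^+ n <= 1 by exact: exprn_ile1.
by rewrite /stepper exprn_ge0 ?subr_ge0//= exprn_ile1 ?subr_ge0// gerBl.
Qed.

Lemma stepper_low n Y : 0 <= Y <= 1 -> 1 - (2 * Y) ^+ n <= stepper n Y.
Proof.
move=> /andP[Y0 Y1].
have h : 0 <= Y ^+ n <= 1 by rewrite exprn_ge0// exprn_ile1.
by have := bernoulli_sub (2 ^ n) h; rewrite natrX exprMn.
Qed.

(** From (1 - Y^n) (1 + Y^n) <= 1, which bounds the stepper by the inverse of a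
   power of 1 + Y^n. *)
Lemma stepper_high n Y : 0 < Y <= 1 -> stepper n Y <= (2 * Y)^-1 ^+ n.
Proof.
move=> /andP[Y0 Y1].
have h : 0 <= Y ^+ n <= 1 by rewrite exprn_ge0 ?exprn_ile1// ltW.
have [h0 h1] := andP h.
have b := bernoulli_add (2 ^ n) h0.
rewrite natrX -exprMn in b.
have p0 : 0 < (2 * Y) ^+ n by rewrite exprn_gt0// mulr_gt0.
rewrite exprVn -[leRHS]mul1r ler_pdivlMr//.
apply: (@le_trans _ _ (stepper n Y * (1 + Y ^+ n) ^+ (2 ^ n)%N)).
  apply: ler_wpM2l; first by rewrite exprn_ge0// subr_ge0.
  by apply: le_trans b; rewrite lerDr.
rewrite /stepper -exprMn -subr_sqr expr1n exprn_ile1 ?gerBl ?sqr_ge0// subr_ge0.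
by rewrite exprn_ile1.
Qed.

Lemma stepper_cvg Y : 0 <= Y <= 1 -> Y != 2^-1 ->
  (fun n => stepper n Y) @ \oo --> (if Y < 2^-1 then 1 else 0 : R).
Proof.
move=> hY Yh; have [Y0 Y1] := andP hY; case: ifPn => lt.
  have q : `|2 * Y| < 1 by rewrite ger0_norm ?mulr_ge0//; lra.
  apply: (@squeeze_cvgr _ _ _ _ (fun n => 1 - (2 * Y) ^+ n) (fun=> 1)).
  - by apply: nearW => n; rewrite stepper_low//; case/andP: (stepper01 n hY).
  - rewrite -[X in _ --> X]subr0; apply: cvgB; first exact: cvg_cst.
    exact: cvg_expr.
  - exact: cvg_cst.
have gt : 2^-1 < Y by rewrite lt_neqAle eq_sym Yh leNgt.
have q : `|(2 * Y)^-1| < 1.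
  rewrite ger0_norm ?invr_ge0 ?mulr_ge0// invf_lt1; lra.
apply: (@squeeze_cvgr _ _ _ _ (fun=> 0) (fun n => (2 * Y)^-1 ^+ n)).
- apply: nearW => n; case/andP: (stepper01 n hY) => -> _ /=.
  by apply: stepper_high; rewrite Y1 andbT; lra.
- exact: cvg_cst.
- exact: cvg_expr.
Qed.

Lemma bump_lt y x : 0 < y < 1 -> 0 < x < 1 -> x != y ->
  bump y x != 2^-1 /\ (bump y x < 2^-1) = (y < x).
Proof.
move=> /andP[y0 y1] /andP[x0 x1] xy.
have p0 := pi_gt0 R.
have sx : 0 < sin (pi * x).
  by apply: sin_gt0_pi; rewrite mulr_gt0//= gtr_pMr.
have [lt|lt|e] := ltgtP y x; last by rewrite e eqxx in xy.
  have s : 0 < sin (pi * (x - y)).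
    by apply: sin_gt0_pi; rewrite mulr_gt0 ?subr_gt0//= gtr_pMr//; lra.
  have : bump y x < 2^-1.
    rewrite /bump -(opprB x y) mulrN sinN mulrN.
    have := mulr_gt0 sx s; lra.
  by move=> h; rewrite h; split => //; rewrite lt_eqF.
have s : 0 < sin (pi * (y - x)).
  by apply: sin_gt0_pi; rewrite mulr_gt0 ?subr_gt0//= gtr_pMr//; lra.
have h : 2^-1 < bump y x.
  by rewrite /bump; have := mulr_gt0 sx s; lra.
by rewrite gt_eqF//; split => //; rewrite ltNge ltW.
Qed.

Lemma continuous_bump y : continuous (bump y).
Proof.
move=> x; apply: cvgD; first exact: cvg_cst.
apply: cvgM; first exact: cvg_cst.
apply: cvgM.
  apply: (@continuous_comp _ _ _ (fun x => pi * x) sin); last exact: continuous_sin.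
  by apply: cvgM; [exact: cvg_cst|exact: cvg_id].
apply: (@continuous_comp _ _ _ (fun x => pi * (y - x)) sin); last exact: continuous_sin.
apply: cvgM; first exact: cvg_cst.
by apply: cvgB; [exact: cvg_cst|exact: cvg_id].
Qed.

Lemma continuous_stepper n y : continuous (fun x => stepper n (bump y x)).
Proof.
move=> x; rewrite /stepper.
have c m (h : R -> R) : {for x, continuous h} -> {for x, continuous (fun x => h x ^+ m)}.
  by move=> hc; apply: (@continuous_comp _ _ _ h (fun z => z ^+ m)) => //; exact: exprn_continuous.
apply: (c _ _); apply: cvgB; first exact: cvg_cst.
by apply: (c _ _); exact: continuous_bump.
Qed.

(** The steppers converge boundedly to the indicator of ]y, 1]. *)
Lemma integral_tail (h : R -> R) y : rint h -> 0 < y < 1 ->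
  (forall n, Rintegral mu I01 (fun x => stepper n (bump y x) * h x) = 0) ->
  Rintegral mu I01 h = 0 ->
  Rintegral mu `[0, y]%classic h = 0.
Proof.
move=> hi y01 hn h0; have [y0 y1] := andP y01.
pose chi x : R := if y < x then 1 else 0.
have mh : measurable_fun I01 h by apply/measurable_EFinP; case/integrableP: hi.
have step_int n : rint (fun x => stepper n (bump y x) * h x).
  have sb x : `|stepper n (bump y x)| <= 1.
    by have /andP[s0 s1] := stepper01 n (bump01 y x); rewrite ger0_norm.
  have := rint_mul hi (@continuous_stepper n y) sb.
  rewrite /rint; congr (mu.-integrable _ (EFin \o _)).
  by apply/funext => x; rewrite mulrC.
have mchi : measurable_fun setT chi.
  by apply: measurable_fun_if => //; exact: measurable_fun_ltr.
have [chi_int _ lim] : [/\ mu.-integrable I01 (fun x => (chi x * h x)%:E),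
  [sequence (\int[mu]_(x in I01) `|(stepper n (bump y x) * h x)%:E - (chi x * h x)%:E|)%E]_n @ \oo --> 0%E &
  [sequence (\int[mu]_(x in I01) (stepper n (bump y x) * h x)%:E)%E]_n @ \oo --> (\int[mu]_(x in I01) (chi x * h x)%:E)%E].
  apply: (@dominated_convergence _ _ _ mu I01 measurable_01 (fun n x => (stepper n (bump y x) * h x)%:E)
     (fun x => (chi x * h x)%:E) (fun x => (`|h x|)%:E)).
  - by move=> n; case/integrableP: (step_int n).
  - by apply/measurable_EFinP/measurable_funM => //; exact: measurable_funTS.
  - have neg : mu.-negligible ([set 0] `|` ([set y] `|` [set 1]) : set R).
      apply: negligibleU; last apply: negligibleU;
      apply/negligibleP => //; exact: lebesgue_measure_set1.
    apply: negligibleS neg => x /= /not_implyP[]; rewrite in_itv/= => /andP[x0 x1].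
    apply: contra_notP => /not_orP[nx0 /not_orP[nxy nx1]].
    have hx : 0 < x < 1 by rewrite !lt_neqAle x0 x1 !andbT; apply/andP; split; apply/eqP => // e; apply: nx0.
    have xy : x != y by apply/eqP.
    have [b1 b2] := bump_lt y01 hx xy.
    apply: cvg_EFin; first exact: nearW.
    apply: cvgM; last exact: cvg_cst.
    by have := stepper_cvg (bump01 y x) b1; rewrite b2.
  - exact: (integrable_norm hi).
  - apply: aeW => x n _; rewrite lee_fin normrM ler_piMl//.
    by have /andP[s0 s1] := stepper01 n (bump01 y x); rewrite ger0_norm.
have chi0 : (\int[mu]_(x in I01) (chi x * h x)%:E = 0)%E.
  apply/esym; move/cvg_lim : lim => <- //.
  rewrite (_ : (fun n => _) = cst 0%E) ?lim_cst//.
  apply/funext => n /=; rewrite -(fineK (integrable_fin_num measurable_01 (step_int n))).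
  by rewrite -[fine _]/(Rintegral _ _ _) hn.
have e : `[0, y]%classic = I01 `&` `[0, y]%classic.
  apply/esym/setIidPr => x /=; rewrite !in_itv/= => /andP[-> xy].
  exact: le_trans xy (ltW y1).
rewrite e Rintegral_mkcondr.
transitivity (Rintegral mu I01 (fun x => h x - chi x * h x)).
  apply: eq_Rintegral => x; rewrite inE/= in_itv/= => /andP[x0 x1].
  rewrite patchE /chi; case: ifPn.
    by rewrite inE/= in_itv/= => /andP[_ xy]; rewrite ltNge xy /= mul0r subr0.
  rewrite notin_setE/= in_itv/= x0/= => /negP; rewrite -ltNge => ->.
  by rewrite mul1r subrr.
rewrite (RintegralB measurable_01 hi chi_int) h0 sub0r.
by rewrite /Rintegral chi0 /= oppr0.
Qed.

(** Lebesgue differentiation of the vanishing indefinite integral. *)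
Lemma ae_zero_of_integral (h : R -> R) : rint h ->
  (forall y, 0 < y < 1 -> Rintegral mu `[0, y]%classic h = 0) ->
  {ae mu, forall x, I01 x -> h x = 0}.
Proof.
move=> hi h0.
have loc := integrable_locally_restrict measurable_01 hi.
have leb := lebesgue_differentiation loc.
have neg : mu.-negligible ([set 0] `|` [set 1] : set R).
  by apply: negligibleU; apply/negligibleP => //; exact: lebesgue_measure_set1.
apply: negligibleS (negligibleU leb neg) => x /= /not_implyP[].
rewrite in_itv/= => /andP[x0 x1] hx.
have [->|xn0] := eqVneq x 0; first by right; left.
have [->|xn1] := eqVneq x 1; first by right; right.
left => lx; apply: hx.
have x0' : 0 < x by rewrite lt_neqAle eq_sym xn0.
have x1' : x < 1 by rewrite lt_neqAle xn1.
pose ht := h \_ I01.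
have hti : mu.-integrable [set` Interval (BLeft 0) (BRight (1:R))] (EFin \o ht).
  apply: (@eq_integrable _ _ _ mu _ measurable_01 (EFin \o h)) hi => z zI.
  by rewrite /ht /= patchE zI.
have ax : (BLeft (0%R : R) < BRight x)%E by [].
have [dF FE] := FTC1_lebesgue_pt x1' hti ax lx.
pose F y := Rintegral mu [set` Interval (BLeft 0) (BRight y)] ht.
have F0 : \near x, F x = cst 0 x.
  have : \forall z \near x, z \in `]0, 1[ by apply: near_in_itvoo; rewrite in_itv/= x0' x1'.
  apply: filterS => z; rewrite in_itv/= => /andP[z0 z1].
  rewrite /F /= -[RHS](h0 z); last by rewrite z0 z1.
  apply: eq_Rintegral => w; rewrite inE/= in_itv/= => /andP[w0 wz].
  rewrite mem_set//= in_itv/= w0 (le_trans wz)//; exact: ltW.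
have : ht x = 0.
  rewrite -FE derive1E -/F (near_eq_derive _ F0).
  by rewrite derive_cst.
by rewrite /ht patchE mem_set//= in_itv/= x0 x1.
Qed.

Lemma fnull_ae g : (forall x, g (x + 1) = g x) -> fnull g -> ae_equal g (fun=> 0).
Proof.
move=> gp hg; have [[g1 g2] _] := hg.
have mz n y : mean (fun x => (stepper n (bump y x))%:C%C * g x) = 0.
  by have [_ h] := fnull_stepper y n hg; rewrite mean_fourier h.
have m0 : mean g = 0 by rewrite mean_fourier; case: hg.
have re0 : {ae mu, forall x, I01 x -> reF g x = 0}.
  apply: ae_zero_of_integral => // y y01; apply: integral_tail => //.
    move=> n; have := congr1 (@complex.Re R) (mz n y); apply: etrans.
    by apply: eq_Rintegral => x _; rewrite /reF cReM /= mul0r subr0.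
  exact: (congr1 (@complex.Re R) m0).
have im0 : {ae mu, forall x, I01 x -> imF g x = 0}.
  apply: ae_zero_of_integral => // y y01; apply: integral_tail => //.
    move=> n; have := congr1 (@complex.Im R) (mz n y); apply: etrans.
    by apply: eq_Rintegral => x _; rewrite /imF cImM /= mul0r addr0.
  exact: (congr1 (@complex.Im R) m0).
apply: ae_periodic; first by move=> x; rewrite gp.
apply: ae_mono2 re0 im0 => x h1 h2 xI.
by apply: complexP; [exact: h1|exact: h2].
Qed.

(** Both sides have the same coefficients, so that their difference is null. *)
Lemma fourier_inversion (delta : R) f M : 0 < delta -> L2 f ->
  wbnd delta (fourier f) M -> ae_equal f (fser (fourier f)).
Proof.
move=> d0 fL fM.
have pf := L2_pint fL; have cf := ccont_fser d0 fM; have pc := ccont_pint cf.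
have : ae_equal (fun x => f x - fser (fourier f) x) (fun=> 0).
  apply: fnull_ae.
    by move=> x; have [fp _ _] := fL; rewrite fp fser_periodic.
  split; first exact: pintB.
  by move=> k; rewrite (fourierB _ pf pc) (fourier_fser _ d0 fM) subrr.
by apply: ae_mono => x /eqP; rewrite subr_eq0 => /eqP.
Qed.

End FourierUniqueness.

(** * Gevrey norms and weighted sums of moduli *)

Section GevreyNorms.
Context {R : realType}.
Implicit Types (f g : R -> R[i]) (k : int) (x : R).

Definition gterm (delta s : R) f k : R :=
  japanese k `^ (2 * s) * expR (4 * pi * delta * `|k%:~R|) * cmod (fourier f k) ^+ 2.

Lemma gterm_ge0 delta s f k : 0 <= gterm delta s f k.
Proof. by rewrite !mulr_ge0 ?powR_ge0 ?expR_ge0 ?exprn_ge0 ?cmod_ge0. Qed.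

Lemma gevrey_norm_ge0 delta s f : 0 <= gevrey_norm delta s f.
Proof. exact: sqrtr_ge0. Qed.

Lemma gevrey_nhs delta s f : (gevrey_sqnorm delta s f < +oo)%E ->
  nhs (gterm delta s f) (gevrey_norm delta s f ^+ 2).
Proof.
move=> fin.
have ge : (0 <= gevrey_sqnorm delta s f)%E.
  by apply: esum_ge0 => k _; rewrite lee_fin gterm_ge0.
split; first exact: gterm_ge0.
rewrite sqr_sqrtr; last exact: fine_ge0.
by rewrite fineK// ge0_fin_numE.
Qed.

Lemma gevrey_le delta s f N : 0 <= N ->
  (gevrey_sqnorm delta s f <= (N ^+ 2)%:E)%E ->
  (gevrey_sqnorm delta s f < +oo)%E /\ gevrey_norm delta s f <= N.
Proof.
move=> N0 h; have fin : (gevrey_sqnorm delta s f < +oo)%E by rewrite (le_lt_trans h)// ltry.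
split => //; have ge : (0 <= gevrey_sqnorm delta s f)%E.
  by apply: esum_ge0 => k _; rewrite lee_fin gterm_ge0.
rewrite -(ger0_norm N0) -sqrtr_sqr ler_sqrt ?sqr_ge0//.
by rewrite -lee_fin fineK// ge0_fin_numE.
Qed.

Lemma japanese_ge1 k : 1 <= japanese k :> R.
Proof. by rewrite /japanese -[leLHS]sqrtr1 ler_sqrt ?lerDl ?sqr_ge0// addr_ge0 ?sqr_ge0. Qed.

Lemma sqr_japanese k : japanese k ^+ 2 = 1 + k%:~R ^+ 2 :> R.
Proof. by rewrite sqr_sqrtr// addr_ge0// sqr_ge0. Qed.

Lemma nhs_invsq : exists A, nhs (@invsq R) A.
Proof.
have bnd (s : seq nat) : uniq s -> \sum_(n <- s) invsq n <= 2 :> R.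
  move=> us; pose m := \max_(n <- s) n.
  have sm n : n \in s -> (n < m.+1)%N by move=> ns; rewrite ltnS; exact: leq_bigmax_seq.
  apply: (@le_trans _ _ (\sum_(n < m.+1) invsq n)); last first.
    by apply: (le_trans (sum_invsq m)); rewrite gerBl invr_ge0.
  rewrite -(big_mkord xpredT (@invsq R)) [leRHS](bigID [in s])/= -[X in _ <= X + _]big_filter.
  have pe : perm_eq s [seq n <- index_iota 0 m.+1 | n \in s].
    apply: uniq_perm; rewrite ?filter_uniq ?iota_uniq// => n.
    rewrite mem_filter mem_index_iota /=.
    by case: (boolP (n \in s)) => //= /sm ->.
  by rewrite (perm_big _ pe)/= lerDl sumr_ge0// => n _; exact: invsq_ge0.
have fin : (\esum_(n in [set: nat]) (invsq n)%:E <= 2%:E :> \bar R)%E.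
  apply: ge_ereal_sup => _ [X [fX _] <-].
  rewrite fsbig_finite//= sumEFin lee_fin; apply: bnd; exact: finmap.fset_uniq.
have ge : (0 <= \esum_(n in [set: nat]) (invsq n)%:E :> \bar R)%E.
  by apply: esum_ge0 => n _; rewrite lee_fin invsq_ge0.
exists (fine (\esum_(n in [set: nat]) (invsq n)%:E)); split; first exact: invsq_ge0.
by rewrite fineK// ge0_fin_numE// (le_lt_trans fin)// ltry.
Qed.

(** Both halves of the integers are compared with the sequence invsq. *)
Lemma nhs_japanese : exists kappa, nhs (fun k => (1 + k%:~R ^+ 2)^-1 : R) kappa.
Proof.
have [A hA] := nhs_invsq.
have c0 : 0 <= 2 :> R by [].
have h2 := nhsZ c0 hA.
pose a (n : nat) := 2 * @invsq R n.
pose p k := if k is Posz n then a n else 0.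
pose q k := if k is Negz n then a n else 0.
have a0 n : 0 <= a n by rewrite mulr_ge0// invsq_ge0.
have hp : nhs p (2 * A).
  apply: (@nhs_inj _ _ _ Posz) => //; first by move=> ? ? [].
  - by case=> n //; exact: a0.
  - by case=> n // /(_ n).
have hq : nhs q (2 * A).
  apply: (@nhs_inj _ _ _ Negz) => //; first by move=> ? ? [].
  - by case=> n //; exact: a0.
  - by case=> n // /(_ n).
have [|B [hB _]] := @nhs_dom _ _ (fun k => p k + q k) (fun k => (1 + k%:~R ^+ 2)^-1) _ _ (nhsD hp hq).
  move=> k; rewrite invr_ge0 addr_ge0 ?sqr_ge0//=.
  case: k => n; rewrite /p /q ?addr0 ?add0r /a /invsq.
    rewrite -pmulrn -[leLHS]div1r ler_pdivrMr; last by rewrite ltr_pwDl ?sqr_ge0.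
    rewrite mulrAC ler_pdivlMr ?exprn_gt0// mul1r -natr1.
    by set N : R := n%:R; have := sqr_ge0 (N - 1); rewrite sqrrB sqrrD !mulr1 expr1n; lra.
  rewrite NegzE mulrNz sqrrN -pmulrn; set N : R := n.+1%:R.
  have N0 : 0 < N ^+ 2 by rewrite exprn_gt0// ltr0n.
  apply: (@le_trans _ _ (N ^+ 2)^-1); last by rewrite ler_peMl ?invr_ge0 ?(ltW N0)// ler1n.
  by rewrite lef_pV2 ?posrE// ?lerDr// addr_gt0.
by exists B.
Qed.

(** Cauchy-Schwarz against the square summable weights <k>^-1, in the form
   2 a j <= a^2 / N + N j^2; the constant is the same for all widths and all
   s >= 1. *)
Lemma gevrey_wbnd : exists C, 0 < C /\ forall delta s f, 1 <= s ->
  (gevrey_sqnorm delta s f < +oo)%E ->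
  wbnd delta (fourier f) (C * gevrey_norm delta s f).
Proof.
have [kappa hk] := nhs_japanese.
have k0 := nhs_ge0 hk.
exists (1 + kappa); split; first by rewrite ltr_pwDl.
move=> delta s f s1 fin.
have hN := gevrey_nhs fin.
set N := gevrey_norm delta s f in hN *.
have N0 : 0 <= N by exact: gevrey_norm_ge0.
pose A k := japanese k `^ s * wt delta k * cmod (fourier f k).
have A0 k : 0 <= A k by rewrite !mulr_ge0 ?powR_ge0 ?expR_ge0 ?cmod_ge0.
have AE k : A k ^+ 2 = gterm delta s f k.
  rewrite /A /gterm !exprMn; congr (_ * _ * _).
    by rewrite -powR_mulrn ?powR_ge0// -powRrM mulrC.
  rewrite /wt -expRM_natl; congr expR; ring.
have lower k : wt delta k * cmod (fourier f k) <= A k * (japanese k)^-1.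
  have j1 := japanese_ge1 k; have j0 : 0 < japanese k :> R by rewrite (lt_le_trans ltr01 j1).
  rewrite ler_pdivlMr// /A -mulrA [leRHS]mulrC ler_wpM2l ?mulr_ge0 ?wt_ge0 ?cmod_ge0//.
  by rewrite -[leLHS]powRr1 ?(ltW j0)// ler_powR.
have [Npos|Nz] := ltP 0 N.
  have hs := nhsD (nhsZ (_ : 0 <= N^-1) hN) (nhsZ N0 hk).
  have {}hs := hs _; have N1 : 0 <= N^-1 by rewrite invr_ge0.
  apply: abnd_le (abnd_dom _ (hs N1)).
    by rewrite expr2 mulrA mulVf ?gt_eqF// mul1r; nra.
  move=> k; rewrite cmod_wt (le_trans (lower k))//.
  rewrite -AE -sqr_japanese -exprVn.
  set a := A k; set j := (japanese k)^-1.
  have : 0 <= N^-1 * (a - N * j) ^+ 2 by rewrite mulr_ge0// sqr_ge0.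
  have -> : N^-1 * (a - N * j) ^+ 2 = N^-1 * a ^+ 2 + N * j ^+ 2 - 2 * (a * j).
    by field; rewrite gt_eqF.
  have aj0 : 0 <= a * j by rewrite mulr_ge0 ?A0// invr_ge0 sqrtr_ge0.
  by move: (N^-1 * a ^+ 2) (N * j ^+ 2) aj0 => u v; lra.
have NE : N = 0 by apply/eqP; rewrite eq_le Nz N0.
have Ak0 k : A k = 0.
  have := nhs_le_sum hN (isT : uniq [:: k]); rewrite big_seq1 -AE NE expr0n/= => h.
  by apply/eqP; rewrite -sqrf_eq0 eq_le h sqr_ge0.
rewrite NE mulr0; apply/abnd_seqP => t _; apply: sumr_le0 => k _.
by rewrite cmod_wt (le_trans (lower k))// Ak0 mul0r.
Qed.

Lemma japanese_le (a : R) k : 0 < a ->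
  japanese k <= (1 + a^-1) * expR (a * `|k%:~R|) :> R.
Proof.
move=> a0; set x := `|k%:~R|; have x0 : 0 <= x by exact: normr_ge0.
have h1 : 1 <= expR (a * x) by rewrite -expR0 ler_expR mulr_ge0// ltW.
have h2 : x <= a^-1 * expR (a * x).
  rewrite -ler_pdivrMl ?invr_gt0// invrK (le_trans _ (expR_ge1Dx _))//.
  by rewrite lerDr.
apply: (@le_trans _ _ (1 + x)); last by rewrite mulrDl mul1r lerD.
rewrite -[leRHS]ger0_norm ?addr_ge0// -sqrtr_sqr ler_sqrt ?sqr_ge0//.
rewrite -(real_normK (num_real k%:~R)) -/x sqrrD expr1n mul1r lerD2r lerDl.
by rewrite mulrn_wge0.
Qed.

(** The polynomial weight <k>^(2 s) is absorbed by the exponential weights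
   between the two widths. *)
Lemma wbnd_gevrey delta delta' s : delta < delta' ->
  exists K, 0 <= K /\ forall f M, wbnd delta' (fourier f) M ->
    (gevrey_sqnorm delta s f < +oo)%E /\ gevrey_norm delta s f <= K * M.
Proof.
move=> dd.
pose n := (Num.trunc (2 * s)).+1.
have sn : 2 * s <= n%:R by rewrite ltW// truncnS_gt.
pose a := 4 * pi * (delta' - delta) / n%:R.
have n0 : 0 < n%:R :> R by rewrite ltr0n.
have e0 : 0 < delta' - delta by rewrite subr_gt0.
have a0 : 0 < a by rewrite divr_gt0// !mulr_gt0// pi_gt0.
have K0 : 0 <= (1 + a^-1) ^+ n by rewrite exprn_ge0// addr_ge0// invr_ge0 ltW.
exists (Num.sqrt ((1 + a^-1) ^+ n)); split; first exact: sqrtr_ge0.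
move=> f M fM; have M0 := wbnd_ge0 fM.
have term k : gterm delta s f k <= (1 + a^-1) ^+ n * (wt delta' k * cmod (fourier f k)) ^+ 2.
  rewrite /gterm exprMn [leRHS]mulrA; apply: ler_wpM2r; first by rewrite exprn_ge0// cmod_ge0.
  apply: (@le_trans _ _ (japanese k ^+ n * expR (4 * pi * delta * `|k%:~R|))).
    rewrite ler_wpM2r ?expR_ge0// -powR_mulrn; last by rewrite sqrtr_ge0.
    by rewrite ler_powR// japanese_ge1.
  apply: (@le_trans _ _ (((1 + a^-1) * expR (a * `|k%:~R|)) ^+ n * expR (4 * pi * delta * `|k%:~R|))).
    rewrite ler_wpM2r ?expR_ge0// lerXn2r ?nnegrE ?sqrtr_ge0//; last exact: japanese_le.
    by rewrite mulr_ge0 ?expR_ge0// addr_ge0// invr_ge0 ltW.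
  rewrite exprMn -[leLHS]mulrA ler_wpM2l//.
  rewrite -expRM_natl -expRD /wt -expRM_natl ler_expR.
  rewrite le_eqVlt; apply/orP; left; apply/eqP; rewrite /a.
  by field; rewrite gt_eqF.
have [B fB BM] := proj1 (abndP _ _) fM.
have fB' : nhs (fun k => wt delta' k * cmod (fourier f k)) B.
  by apply: eq_nhs fB => k; rewrite cmod_wt.
have term2 k : gterm delta s f k <= (1 + a^-1) ^+ n * (M * (wt delta' k * cmod (fourier f k))).
  rewrite (le_trans (term k))// ler_wpM2l// expr2 ler_wpM2r ?mulr_ge0 ?wt_ge0 ?cmod_ge0//.
  exact: wbnd_term.
have [|B2 [hB2 B2le]] := @nhs_dom _ _ _ (gterm delta s f) _ _ (nhsZ K0 (nhsZ M0 fB')).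
  by move=> k; rewrite gterm_ge0 term2.
apply: gevrey_le; first by rewrite mulr_ge0// sqrtr_ge0.
case: hB2 => _; rewrite /gevrey_sqnorm /gterm => ->; rewrite lee_fin.
rewrite exprMn sqr_sqrtr// (le_trans B2le)// ler_wpM2l// expr2.
by rewrite ler_wpM2l.
Qed.

End GevreyNorms.

(** * Differential operators on Fourier series *)

Section Derivatives.
Context {R : realType}.
Implicit Types (f g : R -> R[i]) (k : int) (x : R).

Lemma ae_eq_ccont f g : ccont f -> ccont g -> ae_equal f g -> f = g.
Proof.
move=> [f1 f2] [g1 g2] fg.
have e1 : reF f = reF g.
  by apply: ae_eq_continuous => //; apply: ae_mono fg => x; rewrite /reF => ->.
have e2 : imF f = imF g.
  by apply: ae_eq_continuous => //; apply: ae_mono fg => x; rewrite /imF => ->.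
apply/funext => x; apply: complexP.
  exact: (congr1 (fun h => h x) e1).
exact: (congr1 (fun h => h x) e2).
Qed.

Lemma derive1_cderiv f x d : cderiv f x d ->
  (derive1 (reF f) x +i* derive1 (imF f) x)%C = d.
Proof.
move=> [[_ h1] [_ h2]]; rewrite !derive1E.
apply: complexP => /=; [exact: h1|exact: h2].
Qed.

(** The differentiable representative in the definition is unique by
   continuity, hence is the sum of the series, which may be differentiated
   termwise. *)
Lemma is_dx_fser (delta : R) c M f g : 0 < delta -> wbnd delta c M ->
  ae_equal f (fser c) -> is_dx f g <-> ae_equal g (fser (Dx c)).
Proof.
move=> d0 cM fc; have dc x := fser_deriv x d0 cM; split.
  move=> [F [fF dF gF]].
  have cF : ccont F.
    by split=> x; apply/differentiable_continuous/derivable1_diffP; case: (dF x).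
  have e : F = fser c.
    apply: ae_eq_ccont => //; first exact: ccont_fser cM.
    by apply: ae_mono2 fF fc => x <-.
  by apply: ae_mono gF => x ->; rewrite e; exact: derive1_cderiv.
move=> gc; exists (fser c); split => //.
  by move=> x; have [[h1 _] [h2 _]] := dc x.
by apply: ae_mono gc => x ->; symmetry; exact: derive1_cderiv.
Qed.

Lemma freq_ge1 k : k != 0 -> 1 <= `|freq k : R|.
Proof.
move=> k0; rewrite /freq normrM ger0_norm ?mulr_ge0 ?pi_ge0//.
have h1 : 1 <= `|k%:~R : R|.
  by rewrite -intr_norm -abszE -pmulrn ler1n absz_gt0.
have h2 := pi_ge2 R.
by rewrite (le_trans h1)// ler_peMl//; lra.
Qed.

Definition invop c k : R[i] := if k == 0 then c 0 else c k / ((freq k ^+ 2)%:C)%C.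

(** Symmetric partial sums exhaust the integers, and the sum is unconditional. *)
Lemma csum_symmetric (f : int -> R[i]) M : abnd f M ->
  (fun N : nat => (\sum_(1 <= n < N.+1) (f n%:Z + f (- n%:Z)) : R[i]^o)) @ \oo
    --> (csum f - f 0 : R[i]^o).
Proof.
move=> fM; apply/cvgrPdist_le => /= e e0.
have [eR eI] : 0 < complex.Re e /\ complex.Im e = 0.
  by move: e0; rewrite ltcE /= => /andP[/eqP -> ->].
have [s0 hs] := abnd_tail fM eR.
pose sN (N : nat) : seq int := 0 :: flatten [seq [:: n%:Z; - n%:Z] | n <- index_iota 1 N.+1].
have sE N : \sum_(k <- sN N) f k = f 0 + \sum_(1 <= n < N.+1) (f n%:Z + f (- n%:Z)).
  rewrite /sN big_cons; congr (_ + _); elim: (index_iota _ _) => [|n t IH].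
    by rewrite !big_nil.
  by rewrite /= !big_cons IH addrA.
have mem N k : (k \in sN N) = (`|k| <= N)%N.
  rewrite /sN inE; apply/orP/idP => [[/eqP ->//|/flattenP[/= _ /mapP[n + ->]]]|kN].
    rewrite mem_index_iota !inE ltnS => /andP[_ nN] /orP[] /eqP ->//.
    by rewrite abszN.
  have [->|k0] := eqVneq k 0; [by left|right].
  apply/flattenP; exists [:: `|k|%N%:Z; - `|k|%N%:Z].
    by apply/mapP; exists `|k|%N => //; rewrite mem_index_iota ltnS kN absz_gt0 k0.
  rewrite !inE; case: (k) => n /=; first by rewrite eqxx.
  by rewrite NegzE eqxx.
have uN N : uniq (sN N).
  have flat0 (t : seq nat) k : k \in flatten [seq [:: n%:Z; - n%:Z] | n <- t] ->
      `|k|%N \in t.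
    move=> /flattenP[_ /mapP[n nt ->]]; rewrite !inE => /orP[] /eqP ->//.
    by rewrite abszN.
  rewrite /sN /= ; apply/andP; split.
    by apply/negP => /flat0; rewrite mem_index_iota.
  have : uniq (index_iota 1 N.+1) by exact: iota_uniq.
  have : 0%N \notin index_iota 1 N.+1 by rewrite mem_index_iota.
  elim: (index_iota _ _) => //= n t IH; rewrite inE negb_or eq_sym => /andP[n0 t0] /andP[nt ut].
  rewrite !inE negb_or (IH t0 ut) andbT.
  have -> : (n%:Z == - n%:Z) = false.
    by apply/negbTE; case: n n0 {nt} => // n _; rewrite -NegzE.
  rewrite /=; apply/andP; split; apply/negP => /flat0; rewrite ?abszN (negPf nt)//.
pose N0 := \max_(k <- s0) `|k|%N.
exists N0 => //= N NN0.
rewrite normcmod lecE /= eI eqxx /=.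
have -> : csum f - f 0 - \sum_(1 <= n < N.+1) (f n%:Z + f (- n%:Z)) =
   csum f - \sum_(k <- sN N) f k by rewrite sE opprD addrA.
rewrite (csum_off (uN N) fM); apply: cmod_csum; apply: hs => // k ks.
rewrite mem (leq_trans _ NN0)//.
exact: leq_bigmax_seq.
Qed.

Lemma Ainv_fser (delta : R) c M f : 0 < delta -> wbnd delta c M ->
  ae_equal f (fser c) -> Ainv f = fser (invop c).
Proof.
move=> d0 cM fc; apply/funext => x; rewrite /Ainv.
have fE k : fourier f k = c k by rewrite (ae_fourier fc) (fourier_fser _ d0 cM).
pose term k := invop c k * ek k x.
have tb : exists M', abnd term M'.
  have cA := wbnd_abnd (ltW d0) cM.
  exists M; apply: abnd_mono (cA) => k; rewrite /term cmodM cmod_ek mulr1 /invop.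
  case: ifPn => [/eqP ->//|k0]; rewrite cmodM ler_piMr ?cmod_ge0// cmodV.
  rewrite cmodR ger0_norm ?sqr_ge0// -real_normK ?num_real//.
  have h := freq_ge1 k0; rewrite invf_le1 ?exprn_ege1//.
  by rewrite exprn_gt0// (lt_le_trans ltr01 h).
have [M' hM'] := tb.
rewrite [RHS](_ : _ = fourier f 0 + (csum term - term 0)); last first.
  by rewrite /term /invop eqxx ek0 mulr1 fE addrC subrK.
congr (_ + _); apply: (@cvg_lim R[i]^o); first exact: norm_hausdorff.
rewrite (_ : (fun N : nat => _) =
  (fun N : nat => (\sum_(1 <= n < N.+1) (term n%:Z + term (- n%:Z)) : R[i]^o))).
  exact: csum_symmetric hM'.
apply/funext => N; apply: eq_big_nat => n /andP[n1 _].
have n0 : n%:Z != 0 by case: n n1.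
have n0' : - n%:Z != 0 by rewrite oppr_eq0.
by rewrite /term /invop (negPf n0) (negPf n0') !fE.
Qed.

End Derivatives.

(** * Sequences of positive width *)

Section AnalyticSequences.
Context {R : realType}.
Implicit Types (c d : int -> R[i]) (k : int) (x : R).

(** The width is left free, since each derivative shrinks it. *)
Definition anseq c := exists delta M : R, 0 < delta /\ wbnd delta c M.

Lemma anseq_abnd c : anseq c -> exists M, abnd c M.
Proof. by move=> [delta [M [d0 cM]]]; exists M; exact: wbnd_abnd (ltW d0) cM. Qed.

Lemma anseq2 c d : anseq c -> anseq d -> exists delta M N : R,
  [/\ 0 < delta, wbnd delta c M & wbnd delta d N].
Proof.
move=> [d1 [M [d10 cM]]] [d2 [N [d20 dN]]].
exists (Num.min d1 d2), M, N; split; first by rewrite lt_min d10.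
- by apply: wbnd_wt cM; rewrite ge_min lexx.
- by apply: wbnd_wt dN; rewrite ge_min lexx orbT.
Qed.

Lemma eq_anseq c d : c =1 d -> anseq c -> anseq d.
Proof. by move=> /funext ->. Qed.

Lemma anseqD c d : anseq c -> anseq d -> anseq (fun k => c k + d k).
Proof.
move=> hc /(anseq2 hc) [delta [M [N [d0 cM dN]]]].
by exists delta, (M + N); split => //; exact: wbndD.
Qed.

Lemma anseqM (a : int -> R[i]) (r : R) c : 0 <= r -> (forall k, cmod (a k) <= r) ->
  anseq c -> anseq (fun k => a k * c k).
Proof.
move=> r0 ar [delta [M [d0 cM]]]; exists delta, (r * M); split => //.
exact: wbndZ.
Qed.

Lemma anseqZ (a : R[i]) c : anseq c -> anseq (fun k => a * c k).
Proof. by apply: (anseqM (a := fun=> a) (cmod_ge0 a)). Qed.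

Lemma anseq_conv c d : anseq c -> anseq d -> anseq (conv c d).
Proof.
move=> hc /(anseq2 hc) [delta [M [N [d0 cM dN]]]].
by exists delta, (M * N); split => //; apply: wbnd_conv (ltW d0) cM dN.
Qed.

Lemma anseq_Dx c : anseq c -> anseq (Dx c).
Proof.
move=> [delta [M [d0 cM]]]; have h : delta / 2 < delta by lra.
by exists (delta / 2); eexists; split; [lra|exact: (wbnd_Dx h cM)].
Qed.

Lemma fourier_fser_an c : anseq c -> fourier (fser c) = c.
Proof. by move=> [delta [M [d0 cM]]]; apply/funext => k; exact: fourier_fser cM. Qed.

Lemma is_dx_an c (f g : R -> R[i]) : anseq c -> ae_equal f (fser c) ->
  is_dx f g <-> ae_equal g (fser (Dx c)).
Proof. by move=> [delta [M [d0 cM]]]; exact: is_dx_fser cM. Qed.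

Lemma Ainv_an c (f : R -> R[i]) : anseq c -> ae_equal f (fser c) ->
  Ainv f = fser (invop c).
Proof. by move=> [delta [M [d0 cM]]]; exact: Ainv_fser cM. Qed.

Lemma fserD_an c d x : anseq c -> anseq d ->
  fser (fun k => c k + d k) x = fser c x + fser d x.
Proof.
move=> /anseq_abnd[M cM] /anseq_abnd[N dN].
rewrite /fser -(csumD (abnd_fser x cM) (abnd_fser x dN)).
by apply: eq_csum => k; rewrite mulrDl.
Qed.

Lemma fserZ_an (a : R[i]) c x : anseq c -> fser (fun k => a * c k) x = a * fser c x.
Proof.
move=> /anseq_abnd[M cM]; rewrite /fser -(csumZ a (abnd_fser x cM)).
by apply: eq_csum => k; rewrite mulrA.
Qed.

Lemma fser_conv_an c d x : anseq c -> anseq d -> fser (conv c d) x = fser c x * fser d x.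
Proof. by move=> /anseq_abnd[M cM] /anseq_abnd[N dN]; exact: fser_conv cM dN. Qed.

Definition zmode c k : R[i] := if k == 0 then c 0 else 0.

Lemma fser_zmode c x : fser (zmode c) x = c 0.
Proof.
rewrite /fser (csum1 (i0 := 0)) ?/zmode ?eqxx ?ek0 ?mulr1// => k /negPf k0.
by rewrite /zmode k0 mul0r.
Qed.

Lemma zmode_le c k : cmod (zmode c k) <= cmod (c k).
Proof. by rewrite /zmode; case: eqP => [->//|_]; rewrite cmod0 cmod_ge0. Qed.

Lemma anseq_zmode c : anseq c -> anseq (zmode c).
Proof.
move=> [delta [M [d0 cM]]]; exists delta, M; split => //.
exact: wbnd_mono (zmode_le c) cM.
Qed.

Lemma conv_zmode c d : conv (zmode c) d = fun k => c 0 * d k.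
Proof.
apply/funext => k; rewrite /conv (csum1 (i0 := 0)) ?subr0 => [|j /negPf j0].
  by rewrite /zmode eqxx.
by rewrite /zmode j0 mul0r.
Qed.

Lemma conv_scale (a : R[i]) c d : anseq c -> anseq d ->
  conv (fun k => a * c k) d = fun k => a * conv c d k.
Proof.
move=> /anseq_abnd[M cM] /anseq_abnd[N dN]; apply/funext => k.
rewrite /conv -(csumZ a (abnd_conv_row k cM dN)).
by apply: eq_csum => j; rewrite mulrA.
Qed.

Lemma conv3_zmode1 c d e : anseq d -> anseq e ->
  conv3 (zmode c) d e = fun k => c 0 * conv d e k.
Proof. by move=> hd he; rewrite /conv3 conv_zmode conv_scale. Qed.

Lemma conv3_zmode2 c d : anseq c -> anseq d ->
  conv3 (zmode c) (zmode c) d = fun k => c 0 ^+ 2 * d k.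
Proof.
move=> hc hd; rewrite conv3_zmode1//; last exact: anseq_zmode.
by rewrite conv_zmode; apply/funext => k; rewrite mulrA expr2.
Qed.

End AnalyticSequences.

(** * The system on Fourier coefficients *)

Section SystemInstance.
Context {R : realType}.
Variable gamma : R.
Implicit Types (U V c : int -> R[i]) (k : int) (x : R).

(** The mean of the first component, seen as a sequence supported at 0, is an
   unknown of its own. A product with it is then a convolution, and every
   nonlinear term of the system becomes cubic. *)
Definition unk := option bool.
Definition iu : unk := Some false.
Definition iv : unk := Some true.
Definition im : unk := None.

Definition dsym k : R[i] := (0 +i* freq k)%C.

(** The symbol of d/dx A^-1, with value 0 at 0. *)
Definition bsym k : R[i] := dsym k / ((freq k ^+ 2)%:C)%C.

Definition coef (q p : unk * unk * unk) (z : R[i]) : R[i] := if p == q then z else 0.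

(** The coefficient of (iv, iv, iv) combines v^3 / 3 with - mu(v^3) / 3, which only
   concerns the mode 0. *)
Definition alu (p : unk * unk * unk) k : R[i] :=
  coef (im, iu, iv) p (- 2) + coef (iv, iv, iv) p (3^-1 - (if k == 0 then 3^-1 else 0))
  + coef (im, im, iu) p (- (2 * bsym k)) + coef (im, iv, iv) p (- bsym k).

Definition alv (p : unk * unk * unk) k : R[i] :=
  coef (im, iu, iv) p (- (2 * dsym k)) + coef (iv, iv, iv) p (3^-1 * dsym k)
  + coef (im, im, iv) p (- (2 * bsym k)) + coef (im, iv, iv) p (- (bsym k * dsym k)).

(** The equation for the mean is the mode 0 of the first equation. *)
Definition sysal (i : unk) (p : unk * unk * unk) k : R[i] :=
  match i with
  | Some false => alu p k
  | Some true => alv p k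
  | None => if k == 0 then alu p k else 0
  end.

Definition sysbe (i : unk) k : R[i] :=
  if i is Some _ then - (gamma%:C%C * bsym k) else 0.

(** The third sequence is a function of the first: the solutions of interest of
   the cubic system are those that satisfy this constraint. *)
Definition trip U V (i : unk) : int -> R[i] :=
  match i with Some false => U | Some true => V | None => zmode U end.

Lemma bsym0 : bsym 0 = 0.
Proof. by rewrite /bsym /dsym /freq mulr0 mul0r. Qed.

Lemma cmod_bsym k : cmod (bsym k) <= 1.
Proof.
have [->|k0] := eqVneq k 0; first by rewrite bsym0 cmod0.
have h : 1 <= `|freq k : R| by exact: freq_ge1.
have h0 : 0 < `|freq k : R| by exact: lt_le_trans ltr01 h.
rewrite /bsym cmodM cmodV cmodR normrX cmodE /= expr0n add0r sqrtr_sqr.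
by rewrite ler_pdivrMr ?exprn_gt0// mul1r expr2 ler_peMr// ltW.
Qed.

Lemma bsym_dsym k : cmod (bsym k * dsym k) <= 1.
Proof.
have [->|k0] := eqVneq k 0; first by rewrite bsym0 mul0r cmod0.
have h : 1 <= `|freq k : R| by exact: freq_ge1.
have h0 : 0 < `|freq k : R| by exact: lt_le_trans ltr01 h.
rewrite /bsym !cmodM cmodV cmodR normrX cmodE /= expr0n add0r sqrtr_sqr.
by rewrite mulrAC -expr2 divff// gt_eqF// exprn_gt0.
Qed.

Lemma cmod_coef q p z r : cmod z <= r -> cmod (coef q p z) <= r.
Proof. by move=> zr; rewrite /coef; case: ifP => // _; rewrite cmod0 (le_trans (cmod_ge0 z)). Qed.

Lemma cmodD4 (z1 z2 z3 z4 : R[i]) r1 r2 r3 r4 : cmod z1 <= r1 -> cmod z2 <= r2 ->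
  cmod z3 <= r3 -> cmod z4 <= r4 -> cmod (z1 + z2 + z3 + z4) <= r1 + r2 + r3 + r4.
Proof.
move=> h1 h2 h3 h4.
by do 3! (apply: (le_trans (cmodD _ _)); apply: lerD => //).
Qed.

Lemma cmod3V : cmod (3^-1 : R[i]) = 3^-1.
Proof. by rewrite cmodV cmod_nat. Qed.

Lemma sysalP i p k : cmod (sysal i p k) <= 6 * (1 + 2 * pi * `|k%:~R|).
Proof.
have X0 : 0 <= 2 * pi * `|k%:~R : R| by rewrite !mulr_ge0// pi_ge0.
have b2 : cmod (- (2 * bsym k)) <= 2.
  by rewrite cmodN cmodM cmod_nat ler_piMr// cmod_bsym.
have hu : cmod (alu p k) <= 6 * (1 + 2 * pi * `|k%:~R|).
  apply: (@le_trans _ _ (2 + 1 + 2 + 1)); last by lra.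
  apply: cmodD4; apply: cmod_coef => //.
  - by rewrite cmodN cmod_nat.
  - case: ifP => _; rewrite ?subrr ?cmod0// subr0 cmod3V.
    by rewrite invf_le1// ler1n.
  - by rewrite cmodN cmod_bsym.
case: i => [[]|] //=.
- apply: (@le_trans _ _ (2 * (2 * pi * `|k%:~R|) + 2 * pi * `|k%:~R| + 2 + 1)); last by lra.
  apply: cmodD4; apply: cmod_coef => //.
  + by rewrite cmodN cmodM cmod_nat cmod_freq.
  + by rewrite cmodM cmod3V cmod_freq ler_piMl// invf_le1// ler1n.
  + by rewrite cmodN bsym_dsym.
- by case: ifP => // _; rewrite cmod0 mulr_ge0// addr_ge0.
Qed.

Lemma sysbeP i k : cmod (sysbe i k) <= `|gamma|.
Proof.
case: i => [b|]; last by rewrite /sysbe cmod0.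
rewrite /sysbe.
by rewrite cmodN cmodM cmodR ler_piMr// cmod_bsym.
Qed.

Lemma sum_coef q z (T : unk * unk * unk -> R[i]) :
  \sum_p coef q p z * T p = z * T q.
Proof.
rewrite (bigD1 q)//= big1 ?addr0 /coef ?eqxx// => p /negPf ->.
by rewrite mul0r.
Qed.

Lemma rhs_u U V k : anseq U -> anseq V ->
  rhs sysal sysbe (trip U V) iu k =
  - 2 * U 0 * conv U V k + 3^-1 * conv3 V V V k
  - bsym k * (2 * U 0 ^+ 2 * U k + U 0 * conv V V k + gamma%:C%C * U k)
  - 3^-1 * zmode (conv3 V V V) k.
Proof.
move=> hU hV; rewrite /rhs /=.
under eq_bigr do rewrite /alu !mulrDl.
rewrite !big_split /= !sum_coef /=.
rewrite (conv3_zmode1 _ hU hV) (conv3_zmode2 hU hU) (conv3_zmode1 _ hV hV).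
by rewrite /zmode; case: eqP => [->|_]; ring.
Qed.

Lemma rhs_v U V k : anseq U -> anseq V ->
  rhs sysal sysbe (trip U V) iv k =
  - 2 * U 0 * Dx (conv U V) k + 3^-1 * Dx (conv3 V V V) k
  - bsym k * (2 * U 0 ^+ 2 * V k + U 0 * Dx (conv V V) k + gamma%:C%C * V k).
Proof.
move=> hU hV; rewrite /rhs /=.
under eq_bigr do rewrite /alv !mulrDl.
rewrite !big_split /= !sum_coef /=.
rewrite (conv3_zmode1 _ hU hV) (conv3_zmode2 hU hV) (conv3_zmode1 _ hV hV).
by rewrite /Dx -/(dsym k); ring.
Qed.

Lemma rhs_m (y : unk -> int -> R[i]) k :
  rhs sysal sysbe y im k = zmode (rhs sysal sysbe y iu) k.
Proof.
rewrite /rhs /zmode /=; case: eqP => [->|_].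
  by rewrite bsym0 mulr0 oppr0 !mul0r.
by rewrite big1 ?mul0r ?addr0// => p _; rewrite mul0r.
Qed.

Definition Gu U V k : R[i] := 2 * U 0 ^+ 2 * U k + U 0 * conv V V k + gamma%:C%C * U k.
Definition Gv U V k : R[i] := 2 * U 0 ^+ 2 * V k + U 0 * Dx (conv V V) k + gamma%:C%C * V k.

Lemma anseq_Gu U V : anseq U -> anseq V -> anseq (Gu U V).
Proof.
move=> hU hV; apply: anseqD; last exact: anseqZ.
by apply: anseqD; apply: anseqZ => //; exact: anseq_conv.
Qed.

Lemma anseq_Gv U V : anseq U -> anseq V -> anseq (Gv U V).
Proof.
move=> hU hV; apply: anseqD; last exact: anseqZ.
by apply: anseqD; apply: anseqZ => //; apply: anseq_Dx; exact: anseq_conv.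
Qed.

Definition Bx c k : R[i] := bsym k * c k.

Lemma anseq_Bx c : anseq c -> anseq (Bx c).
Proof. by apply: anseqM ler01 _ => k; exact: cmod_bsym. Qed.

Lemma Dx_invop c : Dx (invop c) = Bx c.
Proof.
apply/funext => k; rewrite /Dx /invop /Bx; case: eqP => [->|_].
  by rewrite bsym0 mul0r /freq mulr0 mul0r.
by rewrite /bsym /dsym -mulrA [_^-1 * _]mulrC.
Qed.

Lemma anseq_invop c : anseq c -> anseq (invop c).
Proof.
move=> [delta [M [d0 cM]]]; exists delta, M; split => //.
apply: wbnd_mono cM => k; rewrite /invop; case: ifPn => [/eqP ->//|k0].
rewrite cmodM cmodV cmodR normrX ler_piMr ?cmod_ge0// invf_le1 ?exprn_ege1 ?freq_ge1//.
by rewrite exprn_gt0// (lt_le_trans ltr01 (freq_ge1 k0)).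
Qed.

(** The quotient by the square of the frequency in A^-1 is not defined at the
   mode 0, but this mode is killed by the derivative. *)
Lemma is_dx_Ainv c (f w : R -> R[i]) : anseq c -> ae_equal f (fser c) ->
  is_dx (Ainv f) w <-> ae_equal w (fser (Bx c)).
Proof.
move=> hc fc; rewrite (Ainv_an hc fc) -Dx_invop.
apply: is_dx_an; first exact: anseq_invop.
by apply: (ae_mono (P := fun=> True)) => //; exact: aeW.
Qed.

Lemma fser_rhs_u U V x : anseq U -> anseq V ->
  fser (rhs sysal sysbe (trip U V) iu) x =
  - 2 * U 0 * (fser U x * fser V x) + 3^-1 * fser V x ^+ 3 - fser (Bx (Gu U V)) x
  - 3^-1 * conv3 V V V 0.
Proof.
move=> hU hV.
have hUV := anseq_conv hU hV; have hV3 := anseq_conv (anseq_conv hV hV) hV.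
have hG := anseq_Bx (anseq_Gu hU hV).
have -> : rhs sysal sysbe (trip U V) iu = fun k =>
    (- 2 * U 0 * conv U V k + 3^-1 * conv3 V V V k)
    + (-1 * Bx (Gu U V) k + - 3^-1 * zmode (conv3 V V V) k).
  by apply/funext => k; rewrite rhs_u// /Bx /Gu; ring.
rewrite fserD_an; last 2 first.
- by apply: anseqD; exact: anseqZ.
- by apply: anseqD; apply: anseqZ => //; exact: anseq_zmode.
rewrite fserD_an; [|exact: anseqZ|exact: anseqZ].
rewrite fserD_an; [|exact: anseqZ|by apply: anseqZ; exact: anseq_zmode].
rewrite !fserZ_an//; last exact: anseq_zmode.
rewrite fser_zmode (fser_conv_an _ hU hV) (fser_conv_an _ (anseq_conv hV hV) hV).
by rewrite (fser_conv_an _ hV hV); ring.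
Qed.

Lemma fser_rhs_v U V x : anseq U -> anseq V ->
  fser (rhs sysal sysbe (trip U V) iv) x =
  - 2 * U 0 * fser (Dx (conv U V)) x + 3^-1 * fser (Dx (conv3 V V V)) x
  - fser (Bx (Gv U V)) x.
Proof.
move=> hU hV.
have hUV := anseq_Dx (anseq_conv hU hV).
have hV3 := anseq_Dx (anseq_conv (anseq_conv hV hV) hV).
have hG := anseq_Bx (anseq_Gv hU hV).
have -> : rhs sysal sysbe (trip U V) iv = fun k =>
    (- 2 * U 0 * Dx (conv U V) k + 3^-1 * Dx (conv3 V V V) k) + -1 * Bx (Gv U V) k.
  by apply/funext => k; rewrite rhs_v// /Bx /Gv; ring.
rewrite fserD_an; [|by apply: anseqD; exact: anseqZ|exact: anseqZ].
rewrite fserD_an; [|exact: anseqZ|exact: anseqZ].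
by rewrite !fserZ_an//; ring.
Qed.

Lemma anseq_rhs_u U V : anseq U -> anseq V -> anseq (rhs sysal sysbe (trip U V) iu).
Proof.
move=> hU hV.
have hUV := anseq_conv hU hV; have hV3 := anseq_conv (anseq_conv hV hV) hV.
have hG := anseq_Bx (anseq_Gu hU hV).
apply: (@eq_anseq _ (fun k => (- 2 * U 0 * conv U V k + 3^-1 * conv3 V V V k)
    + (-1 * Bx (Gu U V) k + - 3^-1 * zmode (conv3 V V V) k))).
  by move=> k; rewrite rhs_u// /Bx /Gu; ring.
by apply: anseqD; apply: anseqD; apply: anseqZ => //; exact: anseq_zmode.
Qed.

Lemma anseq_rhs_v U V : anseq U -> anseq V -> anseq (rhs sysal sysbe (trip U V) iv).
Proof.
move=> hU hV.
have hUV := anseq_Dx (anseq_conv hU hV).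
have hV3 := anseq_Dx (anseq_conv (anseq_conv hV hV) hV).
have hG := anseq_Bx (anseq_Gv hU hV).
apply: (@eq_anseq _ (fun k =>
    (- 2 * U 0 * Dx (conv U V) k + 3^-1 * Dx (conv3 V V V) k) + -1 * Bx (Gv U V) k)).
  by move=> k; rewrite rhs_v// /Bx /Gv; ring.
by apply: anseqD; [apply: anseqD|]; exact: anseqZ.
Qed.

Lemma ae_refl (f g : R -> R[i]) : f =1 g -> ae_equal f g.
Proof. by move=> fg; apply: aeW => x; exact: fg. Qed.

(** Absolute convergence turns products into convolutions, means into
   coefficients of index 0, and d/dx and A^-1 into multipliers, so each equation
   of the system may be read on coefficients. *)
Lemma system_fourier U V (u v ut vt : R -> R[i]) : anseq U -> anseq V ->
  ae_equal u (fser U) -> ae_equal v (fser V) ->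
  system gamma u v ut vt <->
  ae_equal ut (fser (rhs sysal sysbe (trip U V) iu)) /\
  ae_equal vt (fser (rhs sysal sysbe (trip U V) iv)).
Proof.
move=> hU hV uU vV.
have hVV := anseq_conv hV hV; have hUV := anseq_conv hU hV.
have hV3 : anseq (conv3 V V V) by exact: anseq_conv.
have mE : mean u = U 0 by rewrite (ae_mean uU) mean_fourier (fourier_fser_an hU).
have v2E : ae_equal (fun x => v x ^+ 2) (fser (conv V V)).
  by apply: ae_mono vV => x ->; rewrite (fser_conv_an _ hV hV) expr2.
have v3E : ae_equal (fun x => v x ^+ 3) (fser (conv3 V V V)).
  by apply: ae_mono vV => x ->; rewrite (fser_conv_an _ hVV hV) (fser_conv_an _ hV hV) !exprS expr0 mulr1 mulrA.
have uvE : ae_equal (fun x => u x * v x) (fser (conv U V)).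
  by apply: ae_mono2 uU vV => x -> ->; rewrite (fser_conv_an _ hU hV).
have mv3 : mean (fun x => v x ^+ 3) = conv3 V V V 0.
  by rewrite (ae_mean v3E) mean_fourier (fourier_fser_an hV3).
have guE : ae_equal (fun x => 2 * U 0 ^+ 2 * u x + U 0 * v x ^+ 2 + gamma%:C%C * u x)
    (fser (Gu U V)).
  apply: ae_mono2 uU v2E => x -> ->; rewrite /Gu.
  rewrite fserD_an; [|by apply: anseqD; exact: anseqZ|exact: anseqZ].
  by rewrite fserD_an; [rewrite !fserZ_an|exact: anseqZ|exact: anseqZ].
have gvE (v2x : R -> R[i]) : ae_equal v2x (fser (Dx (conv V V))) ->
    ae_equal (fun x => 2 * U 0 ^+ 2 * v x + U 0 * v2x x + gamma%:C%C * v x) (fser (Gv U V)).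
  apply: ae_mono2 vV => x -> ->; rewrite /Gv.
  have hD := anseq_Dx hVV.
  rewrite fserD_an; [|by apply: anseqD; exact: anseqZ|exact: anseqZ].
  by rewrite fserD_an; [rewrite !fserZ_an|exact: anseqZ|exact: anseqZ].
have hGu := anseq_Gu hU hV; have hGv := anseq_Gv hU hV.
rewrite /system mE mv3; split.
  move=> [[w [/(is_dx_Ainv _ hGu guE) hw e1]] [uvx [v2x [v3x [w' [h1 h2 h3 h4 e2]]]]]].
  have {}h1 := proj1 (is_dx_an _ hUV uvE) h1.
  have {}h2 := proj1 (is_dx_an _ hVV v2E) h2.
  have {}h3 := proj1 (is_dx_an _ hV3 v3E) h3.
  have {}h4 := proj1 (is_dx_Ainv _ hGv (gvE _ h2)) h4.
  split.
    have uvw := ae_mono2 (fun x a b => conj a b) uvE (ae_mono2 (fun x a b => conj a b) v3E hw).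
    apply: ae_mono2 e1 uvw => x e [a [b c]].
    rewrite fser_rhs_u// -c -(fser_conv_an _ hU hV) -a.
    rewrite (_ : fser V x ^+ 3 = v x ^+ 3); last first.
      by rewrite b (fser_conv_an _ hVV hV) (fser_conv_an _ hV hV) !exprS expr0 mulr1 mulrA.
    by apply/eqP; rewrite -subr_eq0 -e; apply/eqP; ring.
  have uvw := ae_mono2 (fun x a b => conj a b) h1 (ae_mono2 (fun x a b => conj a b) h3 h4).
  apply: ae_mono2 e2 uvw => x e [a [b c]].
  rewrite fser_rhs_v// -c -a -b.
  by apply/eqP; rewrite -subr_eq0 -e; apply/eqP; ring.
move=> [hut hvt]; split.
  exists (fser (Bx (Gu U V))); split; first by apply/(is_dx_Ainv _ hGu guE)/ae_refl.
  have uv := ae_mono2 (fun x a b => conj a b) uU vV.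
  apply: ae_mono2 hut uv => x -> [-> ->]; rewrite fser_rhs_u//.
  by ring.
exists (fser (Dx (conv U V))), (fser (Dx (conv V V))), (fser (Dx (conv3 V V V))), (fser (Bx (Gv U V))).
split.
- by apply/(is_dx_an _ hUV uvE)/ae_refl.
- by apply/(is_dx_an _ hVV v2E)/ae_refl.
- by apply/(is_dx_an _ hV3 v3E)/ae_refl.
- apply/(is_dx_Ainv _ hGv _); last exact: ae_refl.
  by apply: gvE; exact: ae_refl.
- apply: ae_mono hvt => x ->; rewrite fser_rhs_v//.
  by ring.
Qed.

End SystemInstance.

(** * Linear structure of the Gevrey classes *)

Section GevreyClasses.
Context {R : realType}.
Implicit Types (f g : R -> R[i]) (k : int) (delta s : R).

(** From |c a + b|^2 <= 2 |c a|^2 + 2 |b|^2 for the coefficients. *)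
Lemma inG_lin delta s (c : R[i]) f g : inG delta s f -> inG delta s g ->
  inG delta s (fun x => c * f x + g x).
Proof.
move=> [fL fs] [gL gs]; split; first exact: L2_lin.
have hf := gevrey_nhs fs; have hg := gevrey_nhs gs.
have c0 : 0 <= 2 * cmod c ^+ 2 by rewrite mulr_ge0// exprn_ge0// cmod_ge0.
have h2 : 0 <= 2 :> R by [].
have [|B [[_ hB] _]] := @nhs_dom _ _ _ (gterm delta s (fun x => c * f x + g x)) _ _
  (nhsD (nhsZ c0 hf) (nhsZ h2 hg)).
  move=> k; rewrite gterm_ge0 /gterm.
  have -> : fourier (fun x => c * f x + g x) k = c * fourier f k + fourier g k.
    rewrite -(fourierZ c k (L2_pint fL)).
    exact: (fourierD k (pintZ c (L2_pint fL)) (L2_pint gL)).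
  set W := _ * expR _; have W0 : 0 <= W by rewrite mulr_ge0 ?powR_ge0 ?expR_ge0.
  set a := fourier f k; set b := fourier g k.
  have h : cmod (c * a + b) ^+ 2 <= 2 * (cmod c * cmod a) ^+ 2 + 2 * cmod b ^+ 2.
    apply: (@le_trans _ _ ((cmod c * cmod a + cmod b) ^+ 2)).
      rewrite lerXn2r ?nnegrE ?addr_ge0 ?mulr_ge0 ?cmod_ge0//.
      by rewrite -cmodM cmodD.
    move: (cmod c * cmod a) (cmod b) => p q; have := sqr_ge0 (p - q).
    by rewrite sqrrB sqrrD !mulr2n; lra.
  apply: (le_trans (ler_wpM2l W0 h)).
  by rewrite le_eqVlt; apply/orP; left; apply/eqP; ring.
by rewrite /gevrey_sqnorm /=; move: hB; rewrite /gterm => ->; exact: ltry.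
Qed.

Lemma inG_B delta s f g : inG delta s f -> inG delta s g -> inG delta s (fun x => f x - g x).
Proof.
move=> hf hg; have := inG_lin (-1) hg hf; congr inG.
by apply/funext => x; rewrite mulN1r addrC.
Qed.

Lemma inG0 delta s : inG delta s (fun=> 0 : R[i]).
Proof.
split; first exact: L2_0.
apply: (@le_lt_trans _ _ 0%E); last by [].
rewrite /gevrey_sqnorm esum1// => k _.
rewrite fourierE (eq_mean (g := fun x => 0 * ek (- k) x)) => [|x]; last by [].
by rewrite (meanZ _ (ccont_pint (ccont_ek _))) mul0r cmod0 expr0n mulr0.
Qed.

Lemma inG_Z delta s (c : R[i]) f : inG delta s f -> inG delta s (fun x => c * f x).
Proof.
move=> hf; have := inG_lin c hf (inG0 delta s); congr inG.
by apply/funext => x; rewrite addr0.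
Qed.

Lemma inG_fser delta delta' s c M : 0 <= delta -> delta < delta' -> wbnd delta' c M ->
  inG delta s (fser c).
Proof.
move=> d0 dd cM; have d'0 : 0 < delta' by exact: le_lt_trans dd.
split; first exact: L2_fser cM.
have [K [_ hK]] := wbnd_gevrey s dd.
have e : fourier (fser c) = c by apply/funext => k; exact: fourier_fser cM.
by have [|//] := hK (fser c) M; rewrite e.
Qed.

End GevreyClasses.

(** * Existence of the holomorphic solution *)

Section Existence.
Context {R : realType}.
Variable gamma : R.

(** The Taylor coefficients preserve the constraint on the third unknown. *)
Lemma frhs_m (y : unk -> nat -> int -> R[i]) n k :
  frhs sysal (sysbe gamma) y im n k = zmode (frhs sysal (sysbe gamma) y iu n) k.
Proof.
rewrite /frhs /zmode /=; case: eqP => [->|_].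
  by rewrite bsym0 mulr0 oppr0 !mul0r.
by rewrite big1 ?mul0r ?addr0// => p _; rewrite mul0r.
Qed.

Lemma wbnd_trip (delta : R) (U V : int -> R[i]) M : wbnd delta U M -> wbnd delta V M ->
  forall i, wbnd delta (trip U V i) M.
Proof.
by move=> hU hV [[]|] //=; exact: wbnd_mono (zmode_le U) hU.
Qed.

Lemma wbnd_rhs (delta delta' : R) (y : unk -> int -> R[i]) M i : 0 <= delta ->
  delta' < delta -> 0 <= M -> (forall j, wbnd delta (y j) M) ->
  exists L, wbnd delta' (rhs sysal (sysbe gamma) y i) L.
Proof.
move=> d0 dd M0 yM; eexists.
apply: (@wbnd_multipliers _ _ _ _ 6 `|gamma| _ _ (@sysalP R) (sysbeP gamma) delta delta'
  (fun p => conv3 (y p.1.1) (y p.1.2) (y p.2)) (y i) i _ M dd M0) => //.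
by move=> p; exact: wbnd_conv3.
Qed.

(** The constant of the cubic terms in the smallness condition, 6 being the
   bound on the multipliers of the system. *)
Definition lifecst (Delta : R) : R :=
  8 * expR 1 * (64 * (ntriples unk * 6 * (1 + Delta^-1))).

(** The solution is the sum of the Taylor series in time. Every bound at scale d
   in the weighted l^1 norm is first obtained at a slightly larger scale, which
   gives the Gevrey norm of any order at scale d. *)
Lemma solution_exists (Delta s T C N : R) (u0 v0 : R -> R) : 0 < Delta -> 0 < T ->
  0 <= C -> 0 <= N ->
  inG Delta s (cplx u0) -> inG Delta s (cplx v0) ->
  wbnd Delta (fourier (cplx u0)) (C * N) -> wbnd Delta (fourier (cplx v0)) (C * N) ->
  T * (lifecst Delta * C ^+ 2 * N ^+ 2 + 8 * expR 1 * `|gamma|) <= 1 ->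
  forall d, 0 < d < 1 ->
  exists u v, holomorphic_solution gamma (Delta * d) s (T * (1 - d)) u0 v0 u v.
Proof.
move=> D0 T0 C0 N0 Gu0 Gv0 hu0 hv0 small d hd.
have [d0 d1] := andP hd.
pose a := trip (fourier (cplx u0)) (fourier (cplx v0)).
have A0 : 0 <= C * N by rewrite mulr_ge0.
have aA i : wbnd Delta (a i) (C * N) by exact: wbnd_trip.
have c6 : 0 <= 6 :> R by [].
have g0 : 0 <= `|gamma| by [].
have sm : smallness unk 6 `|gamma| (C * N) Delta T.
  move: small; rewrite /smallness /lifecst; congr (_ <= _).
  by rewrite exprMn; ring.
have [x xP] := @taylor_exists R unk _ _ 6 `|gamma| c6 g0 (@sysalP R) (sysbeP gamma)
  a (C * N) Delta T D0 T0 aA sm A0.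
have [x0 xrec _] := xP.
pose X t := evalt x t.
have xm n : x im n = zmode (x iu n).
  case: n => [|n]; first by rewrite !x0.
  apply/funext => k; have n0 : n.+1%:R != 0 :> R[i] by rewrite pnatr_eq0.
  apply: (mulfI n0); rewrite xrec frhs_m /zmode; case: ifP => _; last by rewrite mulr0.
  by rewrite xrec.
have XE t : X t = trip (X t iu) (X t iv).
  apply/funext => -[[]|] //; apply/funext => k.
  rewrite /X /evalt /= /zmode /tot /fscale; case: ifPn => [/eqP ->|k0].
    by apply: eq_csum => n; rewrite xm.
  rewrite -(csum0 nat); apply: eq_csum => n.
  by rewrite xm /zmode (negPf k0) mulr0.
(* A point of the open disk of scale d belongs to the disk of a larger scale. *)
have room t : cmod t < T * (1 - d) -> exists d1, [/\ 0 < d1 < 1, d < d1 & cmod t < T * (1 - d1)].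
  move=> ht; have ht' : cmod t / T < 1 - d by rewrite ltr_pdivrMr// mulrC.
  have t0 : 0 <= cmod t / T by rewrite divr_ge0 ?cmod_ge0// ltW.
  move: (cmod t / T) ht' t0 (divfK (lt0r_neq0 T0) (cmod t)) => q hq q0 <-.
  exists ((d + (1 - q)) / 2); split; first by apply/andP; split; lra.
    by lra.
  by rewrite mulrC ltr_pM2l//; lra.
have dDpos e : 0 < e < 1 -> 0 <= Delta * e by move=> /andP[/ltW e0 _]; rewrite mulr_ge0// ltW.
have anX t i : cmod t < T * (1 - d) -> anseq (X t i).
  move=> ht; exists (Delta * d), (C * N * (1 - cmod t / (T * (1 - d)))^-1).
  by split; [rewrite mulr_gt0|exact: (wbnd_evalt D0 T0 A0 xP i hd ht)].
have GX t i : cmod t < T * (1 - d) -> inG (Delta * d) s (fser (X t i)).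
  move=> /room[d1' [hd1 dd1 ht]].
  apply: (@inG_fser _ (Delta * d) (Delta * d1')); [exact: dDpos|by rewrite ltr_pM2l|].
  exact: (wbnd_evalt D0 T0 A0 xP i hd1 ht).
exists (fun t => fser (X t iu)), (fun t => fser (X t iv)); split.
- by move=> t ht; split; exact: GX.
- rewrite /X (evalt0 xP); apply: ae_mono (fourier_inversion D0 _ hu0); last by case: Gu0.
  by move=> y /= ->.
- rewrite /X (evalt0 xP); apply: ae_mono (fourier_inversion D0 _ hv0); last by case: Gv0.
  by move=> y /= ->.
move=> t ht.
exists (fser (rhs sysal (sysbe gamma) (X t) iu)), (fser (rhs sysal (sysbe gamma) (X t) iv)).
split; last first.
  apply/(system_fourier gamma _ _ (anX _ iu ht) (anX _ iv ht) (ae_refl (frefl _))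
    (ae_refl (frefl _))).
  by rewrite -XE; split; exact: ae_refl.
have [d2 [hd2 dd2 ht2]] := room t ht.
have [d20 d21] := andP hd2.
pose dm := (d + d2) / 2.
have hdm : 0 < dm < 1 by rewrite /dm; apply/andP; split; lra.
have dm2 : Delta * dm < Delta * d2 by rewrite ltr_pM2l// /dm; lra.
have dmd : Delta * d < Delta * dm by rewrite ltr_pM2l// /dm; lra.
have Grhs i : exists L, wbnd (Delta * dm) (rhs sysal (sysbe gamma) (X t) i) L.
  have M0 : 0 <= C * N * (1 - cmod t / (T * (1 - d2)))^-1.
    exact: wbnd_ge0 (wbnd_evalt D0 T0 A0 xP im hd2 ht2).
  apply: (wbnd_rhs i (dDpos _ hd2) dm2 M0) => j.
  exact: (wbnd_evalt D0 T0 A0 xP j hd2 ht2).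
have [Lu hLu] := Grhs iu; have [Lv hLv] := Grhs iv.
split.
- exact: (inG_fser s (dDpos _ hd) dmd hLu).
- exact: (inG_fser s (dDpos _ hd) dmd hLv).
have [L [rho [rho0 hL]]] := evalt_deriv D0 T0 A0 xP hd2 ht2.
have dd2d : Delta * d < Delta * d2 by rewrite ltr_pM2l.
have [K [K0 hK]] := wbnd_gevrey s dd2d.
have L0 h : h != 0 -> cmod h < rho -> 0 <= cmod h * L.
  by move=> h0 hr; have [_ w] := hL h iu h0 hr; exact: wbnd_ge0 w.
have thd h : h != 0 -> cmod h < rho -> cmod (t + h) < T * (1 - d).
  move=> h0 hr; have [w _] := hL h iu h0 hr; apply: (lt_trans w).
  by rewrite ltr_pM2l//; lra.
(* The error of the difference quotients, from the weighted l^1 norm at scale d2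
   to the Gevrey norm at scale d. *)
have est h i (L' : R) : wbnd (Delta * dm) (rhs sysal (sysbe gamma) (X t) i) L' ->
    h != 0 -> cmod h < rho ->
    gevrey_norm (Delta * d) s (fun y => h^-1 * (fser (X (t + h) i) y - fser (X t i) y)
      - fser (rhs sysal (sysbe gamma) (X t) i) y) <= K * (cmod h * L).
  move=> hL' h0 hr; have [_ w] := hL h i h0 hr.
  apply: (proj2 (hK _ _ _)); move: w; congr wbnd; apply/funext => k.
  have p1 := L2_pint (proj1 (GX (t + h) i (thd h h0 hr))).
  have p2 := L2_pint (proj1 (GX t i ht)).
  have dmpos : 0 < Delta * dm by rewrite mulr_gt0//; case/andP: hdm.
  have p3 := L2_pint (L2_fser dmpos hL').
  rewrite (fourierB k (pintZ h^-1 (pintB p1 p2)) p3) (fourierZ h^-1 k (pintB p1 p2)).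
  rewrite (fourierB k p1 p2) (fourier_fser k dmpos hL').
  have e1 := fourier_fser_an (anX _ i (thd h h0 hr)).
  have e2 := fourier_fser_an (anX _ i ht).
  by congr (_ * (_ - _) - _); [rewrite e1|rewrite e2].
apply/cvgrPdist_le => e e0.
pose B := 2 * K * `|L| + 1.
have B0 : 0 < B by rewrite ltr_wpDl// !mulr_ge0.
have near1 : \forall h \near (0 : R[i]^o)^', `|h| < (Num.min rho (e / B))%:C%C.
  apply: dnbhs0_lt; rewrite ltcR lt_min rho0/=; exact: divr_gt0.
have near0 : \forall h \near (0 : R[i]^o)^', h != 0 by exact: nbhs_dnbhs_neq.
near=> h.
have h0 : h != 0 by near: h; exact: near0.
have : `|h| < (Num.min rho (e / B))%:C%C by near: h; exact: near1.
rewrite normcmod ltcR lt_min => /andP[hr he].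
rewrite sub0r normrN ger0_norm; last by rewrite addr_ge0// gevrey_norm_ge0.
apply: (le_trans (lerD (est h iu Lu hLu h0 hr) (est h iv Lv hLv h0 hr))).
rewrite ltr_pdivlMr// in he.
apply: (le_trans _ (ltW he)).
have hc0 := cmod_ge0 h.
have hL1 : cmod h * L <= cmod h * `|L| by rewrite ler_wpM2l// ler_norm.
have hL2 : K * (cmod h * L) <= K * (cmod h * `|L|) by rewrite ler_wpM2l.
rewrite /B; apply: (le_trans (lerD hL2 hL2)).
rewrite mulrDr mulr1 -[leLHS]addr0; apply: lerD => //.
by rewrite le_eqVlt; apply/orP; left; apply/eqP; ring.
Unshelve. all: by end_near.
Qed.

End Existence.

(** * Local bounds on a compact interval *)

Section Compactness.
Context {R : realType}.

(** Compactness of [0, 1], for bounds that only improve as M grows. *)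
Lemma locally_uniform_bound (P : R -> R -> Prop) :
  (forall x M N, M <= N -> P M x -> P N x) ->
  (forall x, 0 <= x <= 1 -> exists M rho, 0 < rho /\
     forall y, `|y - x| < rho -> P M y) ->
  exists M, 0 <= M /\ forall x, 0 <= x <= 1 -> P M x.
Proof.
move=> Pmono Ploc.
have /compact_near_coveringP/(_ nat \oo (fun n x => P n%:R x) _) := @segment_compact R 0 1.
case=> [x /=|N _ hN].
  rewrite in_itv /= => /Ploc[M [rho [rho0 hM]]].
  exists (ball x rho, [set n | M <= n%:R]); first split => /=.
  - exact: nbhsx_ballx.
  - exact: nbhs_infty_ger.
  move=> [y n] /= [xy Mn]; apply: Pmono Mn _; apply: hM.
  by rewrite distrC.
exists N%:R; split => // x x01.
by apply: (hN N) => //=; rewrite in_itv.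
Qed.

End Compactness.

(** * Uniqueness of the holomorphic solution *)

Section Uniqueness.
Context {R : realType}.
Variable gamma : R.

Section OneSolution.
Variables (delta s r : R) (u0 v0 : R -> R) (u v : R[i] -> R -> R[i]).
Hypothesis delta_gt0 : 0 < delta.
Hypothesis s_ge1 : 1 <= s.
Hypothesis uv : holomorphic_solution gamma delta s r u0 v0 u v.

Let X z := trip (fourier (u z)) (fourier (v z)).
Let F z := rhs sysal (sysbe gamma) (X z).

Lemma solution_an z : cmod z < r -> exists M, forall i, wbnd delta (X z i) M.
Proof.
have [hG _ _ _] := uv; move=> /hG[[uL us] [vL vs]].
have [C [_ hC]] := @gevrey_wbnd R.
have hu := hC _ _ _ s_ge1 us; have hv := hC _ _ _ s_ge1 vs.
exists (C * gevrey_norm delta s (u z) + C * gevrey_norm delta s (v z)).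
have [u0' v0'] := (wbnd_ge0 hu, wbnd_ge0 hv).
apply: wbnd_trip; first by apply: wbnd_le hu; rewrite lerDl; exact: v0'.
by apply: wbnd_le hv; rewrite lerDr; exact: u0'.
Qed.

(** The l^1 norm is bounded by the Gevrey norm at the same width, so holomorphy in
   the latter gives differentiability in the former; the system identifies the
   derivative with the cubic vector field. *)
Lemma solution_deriv z : cmod z < r ->
  (exists L, forall i, wbnd delta (F z i) L) /\
  forall e : R, 0 < e -> exists rho : R, 0 < rho /\
    forall h, h != 0 -> cmod h < rho -> cmod (z + h) < r /\
      forall i, wbnd delta (fun k => h^-1 * (X (z + h) i k - X z i k) - F z i k) e.
Proof.
move=> zr; have [hG _ _ /(_ z zr)[ut [vt [[Gut Gvt lim] sys]]]] := uv.
have [Gu Gv] := hG z zr.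
have [C [C0 hC]] := @gevrey_wbnd R.
have an1 (f : R -> R[i]) : inG delta s f -> anseq (fourier f).
  by move=> [_ fs]; exists delta; eexists; split=> //; exact: hC fs.
have inv1 (f : R -> R[i]) : inG delta s f -> ae_equal f (fser (fourier f)).
  by move=> [fL fs]; apply: fourier_inversion delta_gt0 fL (hC _ _ _ s_ge1 fs).
have [eu ev] := iffLR (system_fourier gamma ut vt (an1 _ Gu) (an1 _ Gv) (inv1 _ Gu) (inv1 _ Gv)) sys.
have Eu : F z iu = fourier ut.
  by rewrite (ae_fourier eu) fourier_fser_an//; exact: anseq_rhs_u (an1 _ Gu) (an1 _ Gv).
have Ev : F z iv = fourier vt.
  by rewrite (ae_fourier ev) fourier_fser_an//; exact: anseq_rhs_v (an1 _ Gu) (an1 _ Gv).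
have Em : F z im = zmode (F z iu) by apply/funext => k; exact: rhs_m.
have FE : F z = trip (fourier ut) (fourier vt).
  by apply/funext => -[[]|] //; rewrite Em Eu.
split.
  have hu := hC _ _ _ s_ge1 (proj2 Gut); have hv := hC _ _ _ s_ge1 (proj2 Gvt).
  exists (C * gevrey_norm delta s ut + C * gevrey_norm delta s vt).
  have [u0' v0'] := (wbnd_ge0 hu, wbnd_ge0 hv).
  rewrite FE; apply: wbnd_trip; first by apply: wbnd_le hu; rewrite lerDl; exact: v0'.
  by apply: wbnd_le hv; rewrite lerDr; exact: u0'.
move=> e e0.
have eC : 0 < e / C by rewrite divr_gt0.
have /cvgrPdist_lt/(_ _ eC) := lim.
rewrite /prop_near1 /= => /nbhs_ballP[q /= q0 hq].
have [rho rho0 rhoq] : exists2 rho : R, 0 < rho & rho%:C%C <= q.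
  exists (complex.Re q); first by move: q0; rewrite ltcE /= => /andP[].
  by move: q0; rewrite ltcE lecE /= => /andP[/eqP -> _]; rewrite lexx eqxx.
exists (Num.min rho (r - cmod z)); split.
  by rewrite lt_min rho0 subr_gt0.
move=> h h0; rewrite lt_min => /andP[hrho hr].
have zhr : cmod (z + h) < r by apply: (le_lt_trans (cmodD _ _)); lra.
split=> //.
have [Gu' Gv'] := hG _ zhr.
have {hq} := hq h; rewrite /ball /= sub0r normrN normcmod.
move=> /(_ (lt_le_trans _ rhoq)); rewrite ltcR => /(_ hrho h0).
rewrite sub0r normrN ger0_norm; last by rewrite addr_ge0// gevrey_norm_ge0.
rewrite ltr_pdivlMr// mulrC /pair_norm mulrDr => small.
have err (f f' g : R -> R[i]) : inG delta s f -> inG delta s f' -> inG delta s g ->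
    wbnd delta (fun k => h^-1 * (fourier f' k - fourier f k) - fourier g k)
      (C * gevrey_norm delta s (fun x => h^-1 * (f' x - f x) - g x)).
  move=> Gf Gf' Gg; have GD := inG_Z h^-1 (inG_B Gf' Gf).
  have := hC _ _ _ s_ge1 (proj2 (inG_B GD Gg)); congr wbnd; apply/funext => k.
  have [pf pf' pg] := And3 (L2_pint (proj1 Gf)) (L2_pint (proj1 Gf')) (L2_pint (proj1 Gg)).
  rewrite (fourierB k (pintZ h^-1 (pintB pf' pf)) pg) (fourierZ h^-1 k (pintB pf' pf)).
  by rewrite (fourierB k pf' pf).
have hu := err _ _ _ Gu Gu' Gut; have hv := err _ _ _ Gv Gv' Gvt.
have [nu nv] := (wbnd_ge0 hu, wbnd_ge0 hv).
have hu' : wbnd delta (fun k => h^-1 * (X (z + h) iu k - X z iu k) - F z iu k) e.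
  by rewrite Eu; apply: wbnd_le hu; apply: ltW; apply: le_lt_trans small; rewrite lerDl; exact: nv.
move=> [[]|]; [|exact: hu'|].
  rewrite -/iv Ev; apply: wbnd_le hv.
  by apply: ltW; apply: le_lt_trans small; rewrite lerDr; exact: nu.
apply: wbnd_mono hu' => k; rewrite -/im Em /X /= /zmode.
case: eqP => [->|_]; first by [].
by rewrite !subrr mulr0 subr0 cmod0 cmod_ge0.
Qed.

(** Solutions are only known to be locally bounded; the segment from 0 to z is
   compact. *)
Lemma solution_ray_bound z : cmod z < r ->
  exists M, 0 <= M /\ forall (t : R) i, 0 <= t <= 1 -> wbnd delta (X (t%:C%C * z) i) M.
Proof.
move=> zr.
have ray t : 0 <= t <= 1 -> cmod (t%:C%C * z) < r.
  move=> /andP[t0 t1]; rewrite cmodM cmodR ger0_norm//.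
  by apply: le_lt_trans zr; rewrite ler_piMl// cmod_ge0.
have [|t t01|M [M0 hM]] := @locally_uniform_bound R
    (fun M t => forall i, wbnd delta (X (t%:C%C * z) i) M).
- by move=> t M N MN h i; exact: wbnd_le MN (h i).
- have zt := ray t t01; have [A hA] := solution_an zt.
  have [[L hL] /(_ 1 ltr01)[rho [rho0 hd]]] := solution_deriv zt.
  have [A0 L0] := (wbnd_ge0 (hA iu), wbnd_ge0 (hL iu)).
  have z1 : 0 < cmod z + 1 by rewrite ltr_wpDl// cmod_ge0.
  exists (A + rho * (1 + L)), (rho / (cmod z + 1)); split; first exact: divr_gt0.
  move=> t' ht'; pose h := ((t' - t)%:C * z)%C.
  have -> : t'%:C%C * z = t%:C%C * z + h by rewrite /h rmorphB /=; ring.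
  have hrho : cmod h < rho.
    rewrite /h cmodM cmodR; move: ht'; rewrite ltr_pdivlMr//; apply: le_lt_trans.
    by rewrite ler_wpM2l// lerDl.
  move=> i; have [->|h0] := eqVneq h 0.
    rewrite addr0; apply: wbnd_le (hA i); rewrite lerDl mulr_ge0 ?(ltW rho0)//.
    by rewrite addr_ge0.
  have [_ /(_ i) w] := hd h h0 hrho.
  have w2 := wbndD (hA i) (wbndZ (cmod_ge0 h) (fun=> lexx _) (wbndD w (hL i))).
  apply: wbnd_le (_ : A + cmod h * (1 + L) <= _) _.
    by rewrite lerD2l ler_wpM2r ?(ltW hrho)// addr_ge0.
  move: w2; congr wbnd; apply/funext => k; rewrite subrK.
  by field.
by exists M; split => // t i /hM.
Qed.

Lemma solution_ray_deriv z (t : R) i k : cmod z < r -> 0 <= t <= 1 ->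
  cderiv (fun t => X (t%:C%C * z) i k) t (z * F (t%:C%C * z) i k).
Proof.
move=> zr /andP[t0 t1].
have zt : cmod (t%:C%C * z) < r.
  rewrite cmodM cmodR ger0_norm//.
  by apply: le_lt_trans zr; rewrite ler_piMl// cmod_ge0.
have [_ hd] := solution_deriv zt.
have small : forall e : R, 0 < e -> exists rho : R, 0 < rho /\ forall h : R, h != 0 ->
    `|h| < rho -> cmod (X ((t + h)%:C%C * z) i k - X (t%:C%C * z) i k
      - h%:C%C * (z * F (t%:C%C * z) i k)) <= e * `|h|.
  move=> e e0; have z1 : 0 < cmod z + 1 by rewrite ltr_wpDl// cmod_ge0.
  have [rho [rho0 hr]] := hd (e / (cmod z + 1)) (divr_gt0 e0 z1).
  exists (rho / (cmod z + 1)); split; first exact: divr_gt0.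
  move=> h h0 hrho; pose w := h%:C%C * z.
  have -> : (t + h)%:C%C * z = t%:C%C * z + w by rewrite /w rmorphD /=; ring.
  have cw : cmod w = `|h| * cmod z by rewrite /w cmodM cmodR.
  have [w0|w0] := eqVneq w 0.
    rewrite w0 addr0 subrr sub0r cmodN mulrA -/w w0 mul0r cmod0.
    by rewrite mulr_ge0// ltW.
  have wr : cmod w < rho.
    rewrite cw; move: hrho; rewrite ltr_pdivlMr//; apply: le_lt_trans.
    by rewrite ler_wpM2l// lerDl.
  have [_ /(_ i)/(@wbnd_term _ _ _ _ k)] := hr w w0 wr.
  set E := _ - F _ i k => wE.
  have -> : X (t%:C%C * z + w) i k - X (t%:C%C * z) i k - h%:C%C * (z * F (t%:C%C * z) i k)
     = w * E.
    by rewrite /E mulrBr mulVKf// /w mulrA.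
  have Ee : cmod E <= e / (cmod z + 1).
    by apply: le_trans wE; rewrite ler_peMl ?cmod_ge0// wt_ge1// ltW.
  rewrite cmodM cw; apply: (@le_trans _ _ (`|h| * (cmod z + 1) * (e / (cmod z + 1)))).
    by apply: ler_pM => //; rewrite ?mulr_ge0 ?cmod_ge0// ler_wpM2l// lerDl.
  by rewrite le_eqVlt; apply/orP; left; apply/eqP; field; rewrite lt0r_neq0.
have realpart (w : R[i]) (h : R) : complex.Re (h%:C%C * w) = h * complex.Re w.
  by rewrite cReM /= mul0r subr0.
have imagpart (w : R[i]) (h : R) : complex.Im (h%:C%C * w) = h * complex.Im w.
  by rewrite cImM /= mul0r addr0.
split; apply: is_derive_small => e /small[rho [rho0 hr]]; exists rho; split => // h h0 hh;
  apply: le_trans (hr h h0 hh).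
- by rewrite -realpart -cReN -cReD -cReN -cReD Re_le_cmod.
- by rewrite -imagpart -cImN -cImD -cImN -cImD Im_le_cmod.
Qed.

End OneSolution.

(** The coefficients of both solutions solve the same differential equation
   along the segment from 0 to z, with the same initial value. *)
Lemma solution_unique (delta s r : R) (u0 v0 : R -> R) (u v u' v' : R[i] -> R -> R[i]) :
  0 < delta -> 1 <= s ->
  holomorphic_solution gamma delta s r u0 v0 u v ->
  holomorphic_solution gamma delta s r u0 v0 u' v' ->
  forall z, cmod z < r -> ae_equal (u z) (u' z) /\ ae_equal (v z) (v' z).
Proof.
move=> d0 s1 uv uv' z zr.
have [M [M0 hM]] := solution_ray_bound d0 s1 uv zr.
have [M' [M'0 hM']] := solution_ray_bound d0 s1 uv' zr.
have [hG hu hv _] := uv; have [hG' hu' hv' _] := uv'.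
have h01 : 0 <= (1 : R) <= 1 by rewrite ler01 lexx.
have MM0 : 0 <= M + M' by rewrite addr_ge0.
have e := @ray_uniqueness R unk _ _ 6 `|gamma| (ler0n _ _) (normr_ge0 _)
  (@sysalP R) (sysbeP gamma) delta (M + M') _ z d0 MM0 (lexx _)
  (fun t => trip (fourier (u (t%:C%C * z))) (fourier (v (t%:C%C * z))))
  (fun t => trip (fourier (u' (t%:C%C * z))) (fourier (v' (t%:C%C * z)))) _ _ _ _ _ 1 h01.
have {e} e : trip (fourier (u z)) (fourier (v z)) = trip (fourier (u' z)) (fourier (v' z)).
  move: e; rewrite !mul1r; apply.
  - by move=> t i ht; apply: wbnd_le (hM t i ht); rewrite lerDl.
  - by move=> t i ht; apply: wbnd_le (hM' t i ht); rewrite lerDr.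
  - by move=> t i k ht; exact: (solution_ray_deriv d0 s1 uv i k zr ht).
  - by move=> t i k ht; exact: (solution_ray_deriv d0 s1 uv' i k zr ht).
  by rewrite !mul0r (ae_fourier hu) (ae_fourier hv) (ae_fourier hu') (ae_fourier hv').
have [C [C0 hC]] := @gevrey_wbnd R.
have inv1 (f : R -> R[i]) : inG delta s f -> ae_equal f (fser (fourier f)).
  by move=> [fL fs]; apply: fourier_inversion d0 fL (hC _ _ _ s1 fs).
have [Gu Gv] := hG z zr; have [Gu' Gv'] := hG' z zr.
have eqf (f f' : R -> R[i]) : inG delta s f -> inG delta s f' -> fourier f = fourier f' ->
    ae_equal f f'.
  move=> Gf Gf' ff.
  by apply: ae_mono2 (inv1 _ Gf) (inv1 _ Gf') => x -> ->; rewrite ff.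
split; apply: eqf => //.
  exact: (congr1 (fun x => x iu) e).
exact: (congr1 (fun x => x iv) e).
Qed.

End Uniqueness.

(** * Cauchy estimates for real-analytic functions *)

Section RealAnalytic.
Context {R : realType}.
Implicit Types (f : R -> R) (a : nat -> R).

Lemma fact_add_le m n : ((m + n)`! <= 2 ^ (m + n) * (m`! * n`!))%N.
Proof.
have binle p q : ('C(p, q) <= 2 ^ p)%N.
  elim: p q => [[|q]//|p IH [|q]]; first by rewrite bin0 expn_gt0.
  by rewrite binS expnS mul2n -addnn leq_add.
rewrite -(bin_fact (leq_addl m n)) addnK [(n`! * _)%N]mulnC.
by rewrite leq_mul2r binle orbT.
Qed.

Lemma pseries_diffs_fact a n m :
  m`!%:R * iter n (@pseries_diffs R) a m = (m + n)`!%:R * a (m + n)%N.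
Proof.
elim: n m => [|n IH] m; first by rewrite addn0.
rewrite iterS /pseries_diffs -/(pseries_diffs _) mulrA -natrM mulnC -factS IH.
by rewrite addSnnS.
Qed.

(** By the binomial bound on (m + n)! / (m! n!), the n-th derived series has
   coefficients of size n! (2 / q)^n times a geometric sequence. *)
Lemma pseries_diffs_bound a (A q : R) n m : 0 < q -> (forall j, `|a j| * q ^+ j <= A) ->
  `|iter n (@pseries_diffs R) a m| <= A * n`!%:R * (2 / q) ^+ n * (2 / q) ^+ m.
Proof.
move=> q0 aA.
have m0 : 0 < m`!%:R :> R by rewrite ltr0n fact_gt0.
rewrite -(ler_pM2l m0) -[X in X * `|_|](ger0_norm (ltW m0)) -normrM.
rewrite pseries_diffs_fact normrM ger0_norm ?ler0n//.
have qj : 0 < q ^+ (m + n) by rewrite exprn_gt0.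
have h1 : `|a (m + n)%N| <= A / q ^+ (m + n) by rewrite ler_pdivlMr.
have h2 : (m + n)`!%:R <= 2 ^+ (m + n) * (m`!%:R * n`!%:R) :> R.
  by rewrite -natrX -!natrM ler_nat fact_add_le.
apply: (le_trans (ler_pM (ler0n _ _) (normr_ge0 _) h2 h1)).
rewrite !expr_div_n (exprD q) (exprD 2) invfM.
move: (q ^+ m)^-1 (q ^+ n)^-1 => p1 p2.
by rewrite le_eqVlt; apply/orP; left; apply/eqP; ring.
Qed.

Lemma pseries_geometric a (B p x : R) : 0 <= p -> (forall m, `|a m| <= B * p ^+ m) ->
  `|x| * p <= 2^-1 -> cvgn (pseries a x) /\ `|limn (pseries a x)| <= 2 * B.
Proof.
move=> p0 aB xp.
have B0 : 0 <= B by have := aB 0%N; rewrite expr0 mulr1; exact: le_trans.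
have half : `|2^-1 : R| < 1 by rewrite ger0_norm; lra.
have gc := @is_cvg_geometric_series R B _ half.
have tle n : `|a n * x ^+ n| <= geometric B 2^-1 n.
  rewrite /geometric /= normrM normrX.
  apply: (@le_trans _ _ (B * p ^+ n * `|x| ^+ n)); first by rewrite ler_wpM2r ?exprn_ge0.
  rewrite -mulrA -exprMn ler_wpM2l// lerXn2r ?nnegrE ?mulr_ge0 ?invr_ge0//.
  by rewrite mulrC.
have nc : cvgn [normed series (fun n => a n * x ^+ n)].
  by apply: series_le_cvg gc => n //=; rewrite mulr_ge0// exprn_ge0// invr_ge0.
split; first exact: normed_cvg nc.
apply: (le_trans (lim_series_norm nc)).
apply: (le_trans (lim_series_le nc gc tle)).
rewrite (cvg_lim _ (@cvg_geometric_series R B _ half))//.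
by rewrite le_eqVlt; apply/orP; left; apply/eqP; field.
Qed.

(** A single constant M plays the role of the bound and of the inverse radius, so
   that the estimates are monotone in M. *)
Definition cauchy_est f (M y : R) : Prop := 0 <= M /\ forall n,
  is_derive y 1 (derive1n n f) (derive1n n.+1 f y) /\
  `|derive1n n f y| <= M * n`!%:R * M ^+ n.

Lemma cauchy_est_mono f y M N : M <= N -> cauchy_est f M y -> cauchy_est f N y.
Proof.
move=> MN [M0 hM]; have N0 := le_trans M0 MN; split=> // n; have [h1 h2] := hM n.
split=> //; apply: (le_trans h2); apply: ler_pM; rewrite ?mulr_ge0 ?exprn_ge0//.
  by rewrite ler_wpM2r.
by rewrite lerXn2r ?nnegrE.
Qed.

(** On a quarter of a disk of convergence, the derivatives are the sums of the
   derived power series. *)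
Lemma cauchy_est_loc f x0 : real_analytic f -> exists M rho, 0 < rho /\
  forall y, `|y - x0| < rho -> cauchy_est f M y.
Proof.
move=> /(_ x0)[r [r0 [a ha]]].
have [q [q0 qr]] : exists q, 0 < q /\ q < r by exists (r / 2); split; lra.
have [A [A0 hA]] : exists A, 0 <= A /\ forall j, `|a j| * q ^+ j <= A.
  have /ha/cvgP/cvg_series_bounded[M [_ /(_ (`|M| + 1))]] : `|(x0 + q) - x0| < r.
    by rewrite addrC addKr gtr0_norm.
  rewrite (le_lt_trans (ler_norm _)) ?ltrDl// => /(_ isT) hM.
  exists (`|M| + 1); split; first by rewrite addr_ge0.
  move=> j; have := hM j I; rewrite /= [x0 + q]addrC addrK normrM normrX.
  by rewrite (ger0_norm (ltW q0)).
pose D n := iter n (@pseries_diffs R) a.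
have Dgeo n x : `|x| <= q / 4 -> cvgn (pseries (D n) x) /\
    `|limn (pseries (D n) x)| <= 2 * (A * n`!%:R * (2 / q) ^+ n).
  move=> hx; apply: (@pseries_geometric _ _ (2 / q)).
  - by rewrite divr_ge0// ltW.
  - by move=> m; exact: pseries_diffs_bound.
  rewrite mulrA ler_pdivrMr//; move: hx; clear; lra.
have Dder n y : `|y - x0| < q / 4 ->
    is_derive y 1 (fun y => limn (pseries (D n) (y - x0)))
      (limn (pseries (D n.+1) (y - x0))).
  move=> hy; have q4 : `|q / 4| <= q / 4 by rewrite ger0_norm// divr_ge0// ltW.
  have := @pseries_snd_diffs R (D n) (q / 4) (y - x0) (proj1 (Dgeo n _ q4))
     (proj1 (Dgeo n.+1 _ q4)) (proj1 (Dgeo n.+2 _ q4)).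
  rewrite [`|q / 4|]ger0_norm ?divr_ge0 ?(ltW q0)// => /(_ hy) h.
  have hs : is_derive y 1 (fun y : R => y - x0) 1 by exact: is_derive_shift.
  have := @is_derive1_comp R (fun x => limn (pseries (D n) x)) (fun y => y - x0) y _ _ h hs; apply: is_derive_fun => //.
  by rewrite mulr1.
pose G n y := limn (pseries (D n) (y - x0)).
have E0 n y : `|y - x0| < q / 4 ->
    (forall y, `|y - x0| < q / 4 -> derive1n n f y = G n y) ->
    is_derive y 1 (derive1n n f) (G n.+1 y).
  move=> hy IH; apply: near_eq_is_derive (Dder n y hy).
  have [eta [eta0 heta]] : exists eta : R, 0 < eta /\ `|y - x0| + eta <= q / 4.
    by exists (q / 4 - `|y - x0|); split; [rewrite subr_gt0|rewrite addrC subrK].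
  near=> y'; rewrite IH//.
  have y'y : `|y - y'| < eta by near: y'; exact: nbhsx_ballx.
  rewrite (_ : y' - x0 = (y - x0) - (y - y')); last by ring.
  apply: (le_lt_trans (ler_normB _ _)); apply: lt_le_trans heta.
  by rewrite ltrD2l.
have E n y : `|y - x0| < q / 4 -> derive1n n f y = G n y.
  elim: n y => [|n IH] y hy.
    rewrite derive1n0; apply/esym/cvg_lim => //.
    by apply: ha; apply: (lt_trans hy); move: q0 qr; clear; lra.
  rewrite derive1nS derive1E; apply: derive_val; exact: E0.
exists (Num.max (2 * A) (2 / q)), (q / 4); split; first exact: divr_gt0.
move=> y hy; set M := Num.max _ _.
have M1 : 2 * A <= M by rewrite le_max lexx.
have M2 : 2 / q <= M by rewrite le_max lexx orbT.
have A2 : 0 <= 2 * A by rewrite mulr_ge0.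
have q2 : 0 <= 2 / q by rewrite divr_ge0// ltW.
split; first exact: le_trans M1.
move=> n; split.
  by rewrite E//; apply: E0 => // z; exact: E.
rewrite E//; apply: (le_trans (proj2 (Dgeo n _ (ltW hy)))).
rewrite !mulrA; apply: ler_pM; rewrite ?mulr_ge0 ?exprn_ge0//.
  by rewrite ler_wpM2r.
by rewrite lerXn2r ?nnegrE// (le_trans q2).
Unshelve. all: by end_near.
Qed.

End RealAnalytic.

(** * Fourier coefficients of real-analytic functions *)

Section FourierDecay.
Context {R : realType}.
Implicit Types (f g : R -> R) (k : int) (x : R).

Lemma cderiv_realM g (w : R -> R[i]) x (g' : R) (w' : R[i]) : is_derive x 1 g g' -> cderiv w x w' ->
  cderiv (fun s => (g s)%:C%C * w s) x (g'%:C%C * w x + (g x)%:C%C * w').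
Proof.
move=> dg [d1 d2]; split.
  apply: is_derive_fun (is_deriveM dg d1) => [s|]; first by rewrite cReM /= mul0r subr0.
  by rewrite cReD !cReM /= !mul0r !subr0 /GRing.scale /=; ring.
apply: is_derive_fun (is_deriveM dg d2) => [s|]; first by rewrite cImM /= mul0r addr0.
by rewrite cImD !cImM /= !mul0r !addr0 /GRing.scale /=; ring.
Qed.

Lemma ccontD (f g : R -> R[i]) : ccont f -> ccont g -> ccont (fun x => f x + g x).
Proof.
move=> [f1 f2] [g1 g2]; split => x.
  have -> : reF (fun x => f x + g x) = (fun x => reF f x + reF g x).
    by apply/funext => y; rewrite /reF cReD.
  by apply: cvgD; [exact: f1|exact: g1].
have -> : imF (fun x => f x + g x) = (fun x => imF f x + imF g x).
  by apply/funext => y; rewrite /imF cImD.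
by apply: cvgD; [exact: f2|exact: g2].
Qed.

Lemma ccont_cst (z : R[i]) : ccont (fun=> z).
Proof. by apply: cderiv_ccont => x; exact: cderiv_cst. Qed.

Lemma ccont_cplx g : continuous g -> ccont (cplx g).
Proof. by move=> cg; split => // x; exact: cst_continuous. Qed.

(** Integration by parts over a period. *)
Lemma fourier_deriv g g' k : (forall x, is_derive x 1 g (g' x)) -> continuous g' ->
  g 1 = g 0 -> fourier (cplx g') k = (0 +i* freq k)%C * fourier (cplx g) k.
Proof.
move=> dg cg' g10.
have cg : continuous g by move=> x; exact: is_derive_continuous (dg x).
pose e := @ek R (- k); pose w : R[i] := (0 +i* freq (- k))%C.
have ce : ccont e by exact: ccont_ek.
have d x : cderiv (fun x => cplx g x * e x) x (cplx g' x * e x + w * (cplx g x * e x)).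
  by rewrite (mulrCA w); exact: cderiv_realM (dg x) (cderiv_ek (- k) x).
have c1 := ccontM (ccont_cplx cg') ce; have c2 := ccontM (ccont_cplx cg) ce.
have := mean_deriv d (ccontD c1 (ccontM (ccont_cst w) c2)).
rewrite (meanD (ccont_pint c1) (ccont_pint (ccontM (ccont_cst w) c2))).
rewrite (meanZ w (ccont_pint c2)) /cplx g10 -(add0r (1 : R)) /e ek_periodic subrr.
move/eqP; rewrite addr_eq0 => /eqP; rewrite !fourierE => ->.
by rewrite -mulNr; congr (_ * _); apply: complexP; rewrite ?cReN ?cImN /= ?oppr0// /freq rmorphN /= mulrN opprK.
Qed.

Lemma derive1n_periodic f n : periodic f 1 -> periodic (derive1n n f) 1.
Proof.
move=> fp; elim: n => [|n IH] x; first by rewrite derive1n0.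
rewrite derive1nS /derive1 IH.
set g := derive1n n f in IH *.
suff -> : (fun h => h^-1 *: (g (h + (x + 1)) - g x)) =
    (fun h => h^-1 *: (g (h + x) - g x)) by [].
by apply/funext => h; rewrite addrA IH.
Qed.

(** The Cauchy estimates hold with uniform constants on the circle, and n
   integrations by parts give n powers of the frequency. Dividing by n! and
   summing over n gives the exponential of a multiple of the frequency. *)
Lemma fourier_decay f : periodic f 1 -> real_analytic f -> exists omega B : R,
  0 < omega /\ forall k, wt omega k * cmod (fourier (cplx f) k) <= B.
Proof.
move=> fp fa.
have [M [M0 hM]] : exists M, 0 <= M /\ forall x, 0 <= x <= 1 -> cauchy_est f M x.
  apply: locally_uniform_bound => [x M N MN|x _]; first exact: cauchy_est_mono.
  exact: cauchy_est_loc.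
have dn n x : is_derive x 1 (derive1n n f) (derive1n n.+1 f x).
  have [N [rho [rho0 hN]]] := cauchy_est_loc x fa.
  by have [|_ /(_ n)[]] := hN x; first by rewrite subrr normr0.
have cn n : continuous (derive1n n f) by move=> x; exact: is_derive_continuous (dn n x).
have bn n x : `|derive1n n f x| <= M * n`!%:R * M ^+ n.
  rewrite -(@periodic_int _ _ _ (- Num.floor x) x (derive1n_periodic n fp)).
  have [|_ /(_ n)[]//] := hM (x + (- Num.floor x)%:~R).
  rewrite rmorphN /=; have := floor_itv x.
  by rewrite intrD => /andP[h1 h2]; apply/andP; split; lra.
pose c k := cmod (fourier (cplx f) k).
have cM n k : (2 * pi * `|k%:~R|) ^+ n * c k <= 2 * (M * n`!%:R * M ^+ n).
  have -> : (2 * pi * `|k%:~R|) ^+ n * c k = cmod (fourier (cplx (derive1n n f)) k).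
    elim: n => [|n IH]; first by rewrite mul1r derive1n0.
    rewrite exprS -mulrA IH (@fourier_deriv (derive1n n f) _ k (dn n) (cn n.+1)).
      by rewrite cmodM cmod_freq.
    by rewrite -{1}(add0r (1 : R)); exact: derive1n_periodic.
  rewrite fourierE; apply: cmod_mean => [|x].
    by apply: ccont_pint; apply: ccontM; [exact: ccont_cplx|exact: ccont_ek].
  by rewrite cmodM cmod_ek mulr1 cmodR; exact: bn.
pose L := M + 1; have L0 : 0 < L by rewrite ltr_wpDl.
have ML : M <= L by rewrite lerDl.
exists (2 * L)^-1, (4 * L); split; first by rewrite invr_gt0 mulr_gt0.
move=> k; rewrite -/(c k).
have c0 : 0 <= c k by exact: cmod_ge0.
pose q := 2 * pi * `|k%:~R : R| / (2 * L).
have -> : wt (2 * L)^-1 k = expR q.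
  by rewrite /wt; congr expR; rewrite /q mulrAC.
(* The n-th term of the exponential series at q costs at most 2 L / 2^n, by the
   choice of q as half of the frequency over L. *)
have part N : \sum_(0 <= n < N) exp_coeff q n * c k <= 4 * L * (1 - 2^-1 ^+ N).
  elim: N => [|N IH]; first by rewrite big_nil expr0 subrr mulr0.
  rewrite big_nat_recr//=; apply: (@le_trans _ _ (4 * L * (1 - 2^-1 ^+ N) + 2 * L * 2^-1 ^+ N)).
    apply: lerD => //; rewrite /exp_coeff /= /q expr_div_n.
    have nf : 0 < N`!%:R :> R by rewrite ltr0n fact_gt0.
    have LN : 0 < (2 * L) ^+ N by rewrite exprn_gt0// mulr_gt0.
    rewrite mulrAC [_ / _ * c k]mulrAC ler_pdivrMr// ler_pdivrMr//.
    apply: (le_trans (cM N k)); rewrite [leRHS](_ : _ = 2 * (L * N`!%:R * L ^+ N)).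
      rewrite ler_wpM2l//; apply: ler_pM; rewrite ?mulr_ge0 ?exprn_ge0//.
        by rewrite ler_wpM2r.
      by rewrite lerXn2r ?nnegrE ?(ltW L0).
    have h2 : 2^-1 ^+ N * 2 ^+ N = 1 :> R by rewrite -exprMn mulVf// expr1n.
    rewrite exprMn; move: (2^-1 ^+ N) (2 ^+ N) (L ^+ N) h2 => a b d ab.
    rewrite [LHS](_ : _ = a * b * (2 * (L * N`!%:R * d))); last by ring.
    by rewrite ab mul1r.
  rewrite exprS; move: (2^-1 ^+ N) => p.
  by rewrite le_eqVlt; apply/orP; left; apply/eqP; field.
have lim : (fun N => series (exp_coeff q) N * c k) @ \oo --> expR q * c k.
  by apply: cvgMl; exact: is_cvg_series_exp_coeff.
rewrite -(cvg_lim _ lim)//; apply: limr_le; first exact: cvgP lim.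
apply: nearW => N; rewrite /series /= mulr_suml; apply: (le_trans (part N)).
rewrite -[leRHS]mulr1 ler_wpM2l ?mulr_ge0 ?(ltW L0)//.
Qed.

(** The square of 1 + a |k| dominates 1 + k^2, so that a little less width makes
   the coefficients summable. *)
Lemma wbnd_decay (delta delta' : R) (c : int -> R[i]) (B : R) : delta < delta' ->
  (forall k, wt delta' k * cmod (c k) <= B) -> exists M, wbnd delta c M.
Proof.
move=> dd cB; have [kappa hk] := @nhs_japanese R.
pose a := pi * (delta' - delta).
have a0 : 0 < a by rewrite mulr_gt0 ?pi_gt0// subr_gt0.
pose m := Num.min 1 (a ^+ 2).
have m0 : 0 < m by rewrite lt_min ltr01 exprn_gt0.
have B0 : 0 <= B by apply: le_trans (cB 0); rewrite mulr_ge0 ?wt_ge0 ?cmod_ge0.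
have Bm0 : 0 <= B / m by rewrite divr_ge0// ltW.
exists (B / m * kappa); apply: abnd_dom (nhsZ Bm0 hk) => k.
rewrite cmod_wt; set K := `|k%:~R : R|.
have K2 : k%:~R ^+ 2 = K ^+ 2 :> R by rewrite /K real_normK// num_real.
have K0 : 0 <= K by exact: normr_ge0.
have grow : m * (1 + k%:~R ^+ 2) <= wt (delta' - delta) k.
  apply: (@le_trans _ _ ((1 + a * K) ^+ 2)).
    rewrite K2 sqrrD expr1n mul1r mulrDr mulr1 exprMn.
    apply: (@le_trans _ _ (1 + a ^+ 2 * K ^+ 2)).
      by apply: lerD; [rewrite ge_min lexx|rewrite ler_wpM2r ?exprn_ge0// ge_min lexx orbT].
    by rewrite lerD2r lerDl mulrn_wge0// mulr_ge0// ltW.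
  rewrite (_ : wt _ k = expR (a * K) ^+ 2).
    have h1 := expR_ge1Dx (a * K).
    have h2 : 0 <= 1 + a * K by rewrite addr_ge0// mulr_ge0// ltW.
    by rewrite lerXn2r ?nnegrE ?expR_ge0.
  by rewrite -expRM_natl /wt -/K /a; congr expR; ring.
have k0 : 0 < 1 + k%:~R ^+ 2 :> R by rewrite ltr_pwDl// sqr_ge0.
rewrite ler_pdivlMr// mulrAC ler_pdivlMr//; apply: le_trans (cB k).
have -> : wt delta' k = wt delta k * wt (delta' - delta) k.
  by rewrite /wt -expRD; congr expR; ring.
rewrite -!mulrA ler_wpM2l ?wt_ge0// mulrC -mulrA [leRHS]mulrC ler_wpM2l ?cmod_ge0//.
Qed.

Lemma analytic_continuous f : real_analytic f -> continuous f.
Proof.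
move=> fa x; have [N [rho [rho0 hN]]] := cauchy_est_loc x fa.
have [|_ /(_ 0%N)[d _]] := hN x; first by rewrite subrr normr0.
exact: is_derive_continuous d.
Qed.

Lemma analytic_inG f : periodic f 1 -> real_analytic f ->
  exists omega : R, 0 < omega /\ forall delta s, 0 <= delta -> delta < omega ->
    inG delta s (cplx f).
Proof.
move=> fp fa; have [omega [B [w0 hB]]] := fourier_decay fp fa.
exists omega; split=> // delta s d0 dd.
have d1 : delta < (delta + omega) / 2 by lra.
have d2 : (delta + omega) / 2 < omega by lra.
have [M hM] := wbnd_decay d2 hB.
split; last by have [K [_ hK]] := wbnd_gevrey s d1; have [] := hK _ _ hM.
have [A [A0 hA]] : exists A, 0 <= A /\ forall x, 0 <= x <= 1 -> cauchy_est f A x.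
  apply: locally_uniform_bound => [x C N CN|x _]; first exact: cauchy_est_mono.
  exact: cauchy_est_loc.
apply: (@L2_bounded _ _ A) => [x||x].
- by rewrite /cplx fp.
- exact: ccont_cplx (analytic_continuous fa).
rewrite cmodR -(@periodic_int _ _ _ (- Num.floor x) x fp).
have [|_ /(_ 0%N)[_]] := hA (x + (- Num.floor x)%:~R).
  rewrite rmorphN /=; have := floor_itv x.
  by rewrite intrD => /andP[h1 h2]; apply/andP; split; lra.
by rewrite derive1n0 expr0 !mulr1.
Qed.

End FourierDecay.

(** * Analytic continuation to the strip *)

Section AnalyticContinuation.
Context {R : realType}.

(** The Fourier series converges in the strip, and its sum is real on the real
   axis because it is continuous there and represents a real function. *)
Lemma gevrey_analytic (delta s : R) : 0 < delta -> 1 <= s -> G_subset_A delta s.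
Proof.
move=> d0 s1 f [fL fs]; have [C [_ hC]] := @gevrey_wbnd R.
have cM := hC _ _ _ s1 fs; have fE := fourier_inversion d0 fL cM.
set c := fourier (cplx f) in cM fE.
have cc := ccont_fser d0 cM.
have real : fser c = cplx (fun x => complex.Re (fser c x)).
  apply: ae_eq_ccont => //; first by apply: ccont_cplx; case: cc.
  by apply: ae_mono fE => x e; rewrite /cplx -e.
exists (fun x => complex.Re (fser c x)); split; last first.
  by apply: ae_mono fE => x <-.
split; first by move=> x; rewrite fser_periodic.
exists (cser c); split; last first.
  by move=> x; rewrite -fserE; exact: (congr1 (fun h => h x) real).
move=> z zd; have [K [rho [K0 rho0 hK]]] := cser_taylor cM zd.
apply/cvg_ex; exists (cser (Dx c) z).
apply/cvgrPdist_le => e; rewrite ltcE /= => /andP[/eqP e2 e0].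
have K1 : 0 < K + 1 by rewrite ltr_wpDl.
pose q : R := Num.min rho (complex.Re e / (K + 1)).
have q0 : 0 < q by rewrite lt_min rho0 divr_gt0.
have near1 : \forall h \near (0 : R[i]^o)^', `|h| < q%:C%C.
  by apply: dnbhs0_lt; rewrite ltcR.
have near0 : \forall h \near (0 : R[i]^o)^', h != 0 by exact: nbhs_dnbhs_neq.
near=> h.
have h0 : h != 0 by near: h; exact: near0.
have : `|h| < q%:C%C by near: h; exact: near1.
rewrite normcmod ltcR lt_min => /andP[hr he].
have ee : e = (complex.Re e)%:C%C by case: (e) e2 => ? ? /= ->.
rewrite ee normcmod lecR.
have -> : cser (Dx c) z - h^-1 *: (cser c (h *: 1 + z) - cser c z) =
    - (h^-1 * (cser c (z + h) - cser c z - h * cser (Dx c) z)).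
  rewrite /GRing.scale /= mulr1 (addrC h z); field; exact: h0.
have ch : 0 < cmod h by rewrite cmod_gt0.
rewrite cmodN cmodM cmodV ler_pdivrMl//; apply: (le_trans (hK h hr)).
rewrite expr2 mulrCA ler_wpM2l ?cmod_ge0//.
rewrite ltr_pdivlMr// in he; apply: le_trans (ltW he).
by rewrite mulrC ler_wpM2l ?cmod_ge0// lerDl.
Unshelve. all: by end_near.
Qed.

End AnalyticContinuation.

(** * The lifespan and the theorem *)

Section Lifespan.
Context {R : realType}.

Lemma lifecst_gt0 (Delta : R) : 0 < Delta -> 0 < lifecst Delta.
Proof.
move=> D0; rewrite /lifecst /ntriples.
have n0 : 0 < #|{: unk * unk * unk}|%:R :> R.
  by rewrite ltr0n; apply/card_gt0P; exists (iu, iu, iu).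
have d1 : 0 < 1 + Delta^-1 by rewrite addr_gt0// invr_gt0.
by rewrite !mulr_gt0// expR_gt0.
Qed.

(** For continuous functions the Gevrey norm separates points; nonzero data have
   a nonzero norm, by which one may divide. *)
Lemma gevrey_norm_eq0 (Delta s : R) (f : R -> R) : 0 < Delta -> 1 <= s ->
  continuous f -> inG Delta s (cplx f) -> gevrey_norm Delta s (cplx f) = 0 -> f = cst 0.
Proof.
move=> D0 s1 cf [fL fs] f0; have [C [_ hC]] := @gevrey_wbnd R.
have := hC _ _ _ s1 fs; rewrite f0 mulr0 => c0.
have fE := fourier_inversion D0 fL c0.
have z k : fourier (cplx f) k = 0.
  apply: cmod_eq0; apply/eqP; rewrite eq_le cmod_ge0 andbT.
  by have := wbnd_term k c0; rewrite pmulr_rle0 ?wt_gt0.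
have e : cplx f = fun=> 0.
  apply: ae_eq_ccont (ccont_cplx cf) (ccont_cst 0) _.
  apply: ae_mono fE => x ->; rewrite /fser -(csum0 int); apply: eq_csum => k.
  by rewrite z mul0r.
by apply/funext => x; have /(congr1 (@complex.Re R)) := congr1 (fun g => g x) e.
Qed.

(** The largest time allowed by the smallness condition; any value would do when
   the condition is void, that is for zero data and no linear term. *)
Definition lifespan (K G N : R) : R :=
  if K * N ^+ 2 + G == 0 then 1 else (K * N ^+ 2 + G)^-1.

Section Asymptotics.
Variables (K G N : R).
Hypotheses (K0 : 0 < K) (N0 : 0 <= N).

Lemma lifespan_gt0 : 0 <= G -> 0 < lifespan K G N.
Proof.
move=> G0; rewrite /lifespan; case: eqP => // /eqP D.
by rewrite invr_gt0 lt_neqAle eq_sym D addr_ge0// mulr_ge0 ?(ltW K0)// exprn_ge0.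
Qed.

Lemma lifespan_le1 : lifespan K G N * (K * N ^+ 2 + G) <= 1.
Proof.
rewrite /lifespan; case: eqP => [->|/eqP D]; first by rewrite mulr0.
by rewrite mulVf.
Qed.

Lemma lifespan_large e : 0 < G -> 0 < e -> G / (K ^+ 2 * e) + 1 < N ->
  `|lifespan K G N * N ^+ 2 - K^-1| < e.
Proof.
move=> G0 e0 hN; have K2 : 0 < K ^+ 2 * e by rewrite mulr_gt0// exprn_gt0.
have q0 : 0 < G / (K ^+ 2 * e) by rewrite divr_gt0.
have N1 : 1 < N by move: q0 hN; move: (_ / _) => q; lra.
have hG : G < N * (K ^+ 2 * e).
  by rewrite -ltr_pdivrMr//; move: q0 hN; move: (_ / _) => q; lra.
have NN : N <= N ^+ 2 by rewrite expr2 ler_peMl// ltW.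
have D0 : 0 < K * N ^+ 2 + G by rewrite addr_gt0// mulr_gt0// exprn_gt0// (lt_trans ltr01).
rewrite /lifespan gt_eqF//.
have -> : (K * N ^+ 2 + G)^-1 * N ^+ 2 - K^-1 = - (G / (K * (K * N ^+ 2 + G))).
  by field; rewrite !lt0r_neq0.
have KD : 0 < K * (K * N ^+ 2 + G) by rewrite mulr_gt0.
rewrite normrN ger0_norm; last by rewrite divr_ge0// ltW.
rewrite ltr_pdivrMr//; apply: (lt_le_trans hG).
rewrite [leLHS](_ : _ = e * (K * (K * N))); last by ring.
rewrite ler_pM2l// ler_pM2l//; apply: (@le_trans _ _ (K * N ^+ 2)).
  by rewrite ler_pM2l.
by rewrite lerDl ltW.
Qed.

Lemma lifespan_small e : 0 < G -> 0 < e -> N < Num.min 1 (e * G ^+ 2 / K) ->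
  `|lifespan K G N - G^-1| < e.
Proof.
move=> G0 e0; rewrite lt_min ltr_pdivlMr// => /andP[N1 hN].
have NN : N ^+ 2 <= N by rewrite expr2 ler_piMl// ltW.
have KN : 0 <= K * N ^+ 2 by rewrite mulr_ge0 ?exprn_ge0// ltW.
have D0 : 0 < K * N ^+ 2 + G by rewrite ltr_wpDl.
rewrite /lifespan gt_eqF//.
have -> : (K * N ^+ 2 + G)^-1 - G^-1 = - (K * N ^+ 2 / (G * (K * N ^+ 2 + G))).
  by field; rewrite !lt0r_neq0.
have GD : 0 < G * (K * N ^+ 2 + G) by rewrite mulr_gt0.
rewrite normrN ger0_norm; last by rewrite divr_ge0// ltW.
rewrite ltr_pdivrMr//; apply: (@le_lt_trans _ _ (N * K)).
  by rewrite mulrC ler_pM2r.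
apply: (lt_le_trans hN); rewrite ler_pM2l// expr2 ler_pM2l//.
by rewrite lerDr.
Qed.

End Asymptotics.

End Lifespan.

Unset Implicit Arguments.

Theorem theorem40 (R : realType) (gamma : R) :
  (* (i) *)
  (forall u0 v0 : R -> R, analytic_data u0 v0 ->
     exists Delta : R, 0 < Delta /\ data_in_G Delta u0 v0 /\
       (forall s : R, 0 <= s -> G_subset_A Delta (s + 1)))
  /\
  (* (ii); T u0 v0 s Delta is the lifespan *)
  (exists T : (R -> R) -> (R -> R) -> R -> R -> R,
     (forall (u0 v0 : R -> R) (s Delta : R),
        analytic_data u0 v0 -> 0 < Delta -> data_in_G Delta u0 v0 ->
        2^-1 < s ->
        0 < T u0 v0 s Delta /\
        forall d : R, 0 < d < 1 ->
          let r := T u0 v0 s Delta * (1 - d) in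
          (exists u v : R[i] -> R -> R[i],
             holomorphic_solution gamma (Delta * d) (s + 1) r u0 v0 u v) /\
          (forall u v u' v' : R[i] -> R -> R[i],
             holomorphic_solution gamma (Delta * d) (s + 1) r u0 v0 u v ->
             holomorphic_solution gamma (Delta * d) (s + 1) r u0 v0 u' v' ->
             forall t : R[i], cmod t < r ->
               ae_equal (u t) (u' t) /\ ae_equal (v t) (v' t)))
     /\
     (forall s Delta : R, 2^-1 < s -> 0 < Delta ->
        let admissible (u0 v0 : R -> R) :=
          analytic_data u0 v0 /\ data_in_G Delta u0 v0 in
        let N (u0 v0 : R -> R) :=
          pair_norm Delta (s + 1) (cplx u0) (cplx v0) in
        (gamma = 0 ->
           exists c : R, 0 < c /\
             forall u0 v0, admissible u0 v0 ->
               (u0, v0) <> (cst 0, cst 0) ->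
               T u0 v0 s Delta = c / N u0 v0 ^+ 2) /\
        (gamma <> 0 ->
           (exists c : R, 0 < c /\
              forall e : R, 0 < e -> exists M : R,
                forall u0 v0, admissible u0 v0 -> M < N u0 v0 ->
                  `|T u0 v0 s Delta * N u0 v0 ^+ 2 - c| < e) /\
           (exists c : R, 0 < c /\
              forall e : R, 0 < e -> exists eta : R, 0 < eta /\
                forall u0 v0, admissible u0 v0 -> N u0 v0 < eta ->
                  `|T u0 v0 s Delta - c| < e)))).
Proof.
split.
  move=> u0 v0 [pu pv au av].
  have [w1 [w10 h1]] := analytic_inG pu au; have [w2 [w20 h2]] := analytic_inG pv av.
  pose m := Num.min w1 w2; have m0 : 0 < m by rewrite lt_min w10.
  have m1 : m <= w1 by rewrite ge_min lexx.
  have m2 : m <= w2 by rewrite ge_min lexx orbT.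
  exists (m / 2); split; first exact: divr_gt0.
  split=> [s s0|s s0]; last by apply: gevrey_analytic; [exact: divr_gt0|rewrite lerDr].
  have d0 : 0 <= m / 2 by rewrite divr_ge0// ltW.
  by split; [apply: h1|apply: h2] => //; move: m0 m1 m2; clear; lra.
have [C [C0 hC]] := @gevrey_wbnd R.
pose K Delta : R := lifecst Delta * C ^+ 2.
have K0 Delta : 0 < Delta -> 0 < K Delta.
  by move=> D0; rewrite mulr_gt0 ?exprn_gt0// lifecst_gt0.
pose G := 8 * expR 1 * `|gamma|.
have G0 : 0 <= G by rewrite !mulr_ge0// expR_ge0.
pose N (u0 v0 : R -> R) s Delta := pair_norm Delta (s + 1) (cplx u0) (cplx v0).
have N0 u0 v0 s Delta : 0 <= N u0 v0 s Delta by rewrite addr_ge0// gevrey_norm_ge0.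
exists (fun u0 v0 s Delta => lifespan (K Delta) G (N u0 v0 s Delta)); split.
  move=> u0 v0 s Delta an D0 dG s2.
  have s0 : 0 <= s by move: s2; lra.
  have s1 : 1 <= s + 1 by rewrite lerDr.
  have T0 := lifespan_gt0 (K0 _ D0) (N0 u0 v0 s Delta) G0.
  split=> // d d01 r; have [Gu Gv] := dG s s0.
  have hu := hC _ _ _ s1 (proj2 Gu); have hv := hC _ _ _ s1 (proj2 Gv).
  have n1 := gevrey_norm_ge0 Delta (s + 1) (cplx u0).
  have n2 := gevrey_norm_ge0 Delta (s + 1) (cplx v0).
  split.
    apply: (@solution_exists R gamma Delta (s + 1) _ C (N u0 v0 s Delta) u0 v0) => //.
    - exact: ltW.
    - by apply: wbnd_le hu; rewrite ler_pM2l// lerDl; exact: n2.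
    - by apply: wbnd_le hv; rewrite ler_pM2l// lerDr; exact: n1.
    exact: lifespan_le1.
  have [d0 _] := andP d01.
  have Dd : 0 < Delta * d by rewrite mulr_gt0.
  by move=> u v u' v' h h' t tr; exact: (solution_unique Dd s1 h h').
move=> s Delta s2 D0 admissible N'.
have s0 : 0 <= s by move: s2; lra.
have s1 : 1 <= s + 1 by rewrite lerDr.
split=> [g0|g0].
  exists (K Delta)^-1; split; first by rewrite invr_gt0 K0.
  move=> u0 v0 [[pu pv au av] dG] uv0.
  have G00 : G = 0 by rewrite /G g0 normr0 mulr0.
  have [Gu Gv] := dG s s0.
  have Nn : N u0 v0 s Delta != 0.
    apply/eqP => Nz; apply: uv0.
    have n1 := gevrey_norm_ge0 Delta (s + 1) (cplx u0).
    have n2 := gevrey_norm_ge0 Delta (s + 1) (cplx v0).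
    move: Nz => /eqP; rewrite /N /pair_norm (paddr_eq0 n1 n2) => /andP[/eqP z1 /eqP z2].
    rewrite (gevrey_norm_eq0 D0 s1 (analytic_continuous au) Gu z1).
    by rewrite (gevrey_norm_eq0 D0 s1 (analytic_continuous av) Gv z2).
  rewrite /lifespan G00 addr0 mulf_eq0 expf_eq0 /= (negPf Nn) (gt_eqF (K0 _ D0)) /=.
  by rewrite invfM.
have G1 : 0 < G by rewrite !mulr_gt0 ?expR_gt0// normr_gt0; exact/eqP.
split.
  exists (K Delta)^-1; split; first by rewrite invr_gt0 K0.
  move=> e e0; exists (G / (K Delta ^+ 2 * e) + 1) => u0 v0 _.
  exact: (lifespan_large (K0 _ D0) (N0 u0 v0 s Delta) G1 e0).
exists G^-1; split; first by rewrite invr_gt0.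
move=> e e0; exists (Num.min 1 (e * G ^+ 2 / K Delta)); split.
  by rewrite lt_min ltr01 divr_gt0 ?(K0 _ D0)// mulr_gt0// exprn_gt0.
by move=> u0 v0 _; exact: (lifespan_small (K0 _ D0) (N0 u0 v0 s Delta) G1 e0).
Qed.
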